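(* Let $T>0$. For $i=1,2$ let $g_i\in L^2(0,T;H)$, and let $\eta_i$ be the (weak) solution of the problem $$\eta_i''+\mathcal{A}\eta_i=f_i(t,\eta_i),\qquad \eta_i(0)=u_{0,i}\in V,\quad \eta_i'(0)=v_{0,i}\in H,$$ where $f_i(t,\eta)=\epsilon^{-1}\big(\sin\phi(\cdot,t)-\sin(\phi(\cdot,t)+\epsilon\eta)\big)+g_i(\cdot,t)$. Then, for any $t\in[0,T]$, $$|\eta_2'(t)-\eta_1'(t)|^2+\|\eta_2(t)-\eta_1(t)\|^2\le c\Big(|v_{0,2}-v_{0,1}|^2+\|u_{0,2}-u_{0,1}\|^2+\|g_2-g_1\|^2_{L^2(0,T;H)}\Big),$$ where $c$ is a constant independent of the data $u_{0,i},v_{0,i},g_i$ and of the solutions. Furthermore, for given $g\in L^2(0,T;H)$, $u_0\in V$, $v_0\in H$, the weak solution of $$\eta''+\mathcal{A}\eta=\epsilon^{-1}\big(\sin\phi-\sin(\phi+\epsilon\eta)\big)+g,\qquad \eta(0)=u_0,\quad \eta'(0)=v_0,$$ is unique.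
   Context: Let $I=(-L,L)$ with $L>0$, where $L$ may be infinite; all functions are real-valued. $H=L^2(I)$ with inner product $(u,v)=\int_{-L}^{L}uv\,dx$ and norm $|u|$. $V$ is a Hilbert space continuously embedded in $H$, with inner product $((u,v))$ and norm $\|u\|$ (the Sobolev $H^1$ norm or an equivalent one); the choices considered are $V=H^1_0(I)$ (homogeneous Dirichlet conditions) or $V=H^1_N(I)=\{u\in H^1(I): u_x(\pm L)=0\}$ (homogeneous Neumann conditions). $V^*$ is the dual of $V$, with pairing $\langle\cdot,\cdot\rangle$. The symmetric bilinear form $a(u,v)=(u_x,v_x)$ on $V\times V$ satisfies $|a(u,v)|\le\|u\|\,\|v\|$, and $\mathcal{A}\in\mathcal{L}(V,V^* )$ is defined by $\langle\mathcal{A}u,v\rangle=a(u,v)$ for $u,v\in V$. Standing assumption: $a$ is coercive, i.e. there is a constant $c_0>0$ with $a(u,u)\ge c_0\|u\|^2$ for all $u\in V$. Where $(u_x,v_x)$ itself is not coercive (as for $V=H^1_N(I)$), this is understood to be ensured by adding a regularization term such as $\epsilon u$, and coercivity is assumed without loss of generality. $\phi(x,t)$ is a fixed soliton solution of the sine-Gordon equation $\phi_{tt}-\phi_{xx}+\sin\phi=0$, and $0<\epsilon\le1$ is fixed. $'$ denotes the time derivative in the sense of distributions. $W(0,T)=\{u: u\in L^2(0,T;V),\ u'\in L^2(0,T;H),\ u''\in L^2(0,T;V^* )\}$. A weak solution of $\eta''+\mathcal{A}\eta=f(t,\eta)$, $\eta(0)=u_0\in V$, $\eta'(0)=v_0\in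 H$, is a function $\eta\in W(0,T)$ for which the equation is satisfied in $V^*$ a.e. on $[0,T]$ and the initial conditions are satisfied in $V$ and $H$ respectively. Weak solutions are identified with their representatives $\eta\in C([0,T];V)$, $\eta'\in C([0,T];H)$. *)

(* Defs.v *)
From HB Require Import structures.
From mathcomp Require Import all_boot all_order all_algebra.
From mathcomp Require Import all_classical all_reals all_analysis.

Set Implicit Arguments.
Unset Strict Implicit.
Unset Printing Implicit Defensive.

Import Order.TTheory GRing.Theory Num.Theory.
Import numFieldNormedType.Exports.

Local Open Scope classical_set_scope.
Local Open Scope ring_scope.

(** Elements of function spaces are represented by functions [R -> R]; two
    functions stand for the same element when they agree a.e. on I = (-L, L). *)

Section SpatialSpaces.
Context {R : realType}.
Implicit Types (L : \bar R) (u v w phi : R -> R).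

Definition interval_I L : set R := [set x | (- L < x%:E)%E /\ (x%:E < L)%E].

Lemma measurable_interval_I L : measurable (interval_I L).
Proof.
case: L => [r| |].
- suff -> : interval_I r%:E = `]- r, r[%classic by [].
  apply/seteqP; split => x; rewrite /interval_I /= in_itv /= !lte_fin.
    by case=> -> ->.
  by case/andP.
- suff -> : interval_I +oo%E = setT by [].
  by apply/seteqP; split => x //= _; split; rewrite ?ltNyr ?ltry.
- suff -> : interval_I -oo%E = set0 by [].
  by apply/seteqP; split => x //= [].
Qed.

Definition mu_I L := mrestr (@lebesgue_measure R) (measurable_interval_I L).

(** C_c^oo(A), for an open set A of the real line. *)
Definition test_function (A : set R) phi : Prop :=
  (forall n x, derivable (derive1n n phi) x 1) /\
  exists K : set R, [/\ compact K, K `<=` A & forall x, ~ K x -> phi x = 0].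

Definition L2_I L : set (R -> R) := [set u | u \in Lfun (mu_I L) 2%:E].

Definition ipH L u v : R := \int[mu_I L]_x (u x * v x).

Definition is_weak_derivative L u w : Prop :=
  forall phi, test_function (interval_I L) phi ->
    \int[mu_I L]_x (u x * derive1 phi x) = - \int[mu_I L]_x (w x * phi x).

Definition H1_I L : set (R -> R) :=
  [set u | L2_I L u /\ exists w, L2_I L w /\ is_weak_derivative L u w].

(** The L^2 weak derivative u_x; junk value 0 outside of H^1(I). *)
Definition weak_derivative L u : R -> R :=
  xget (cst 0) [set w | L2_I L w /\ is_weak_derivative L u w].

Definition ipH1 L u v : R :=
  ipH L u v + ipH L (weak_derivative L u) (weak_derivative L v).

(** The form (u_x, v_x) + kappa (u, v): kappa = 0 gives (u_x, v_x) itself and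
    kappa > 0 adds the regularization term used when the latter is not
    coercive. *)
Definition form_a L (kappa : R) u v : R :=
  ipH L (weak_derivative L u) (weak_derivative L v) + kappa * ipH L u v.

Definition ip_norm (ip : (R -> R) -> (R -> R) -> R) u : R :=
  Num.sqrt (ip u u).

(** V, with inner product [ip], is a Hilbert space lying between H^1_0(I) (the
    closure of the test functions) and H^1(I), whose norm is equivalent to the
    H^1 norm. This covers V = H^1_0(I), and V = H^1(I), which is the form domain
    of the Neumann problem: u_x(-L) = u_x(L) = 0 is not a closed condition in
    H^1(I) and is the natural boundary condition there. *)
Record is_energy_space L (V : set (R -> R))
    (ip : (R -> R) -> (R -> R) -> R) : Prop := IsEnergySpace {
  es_H1 : V `<=` H1_I L ;
  es_test : test_function (interval_I L) `<=` V ;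
  es_ae : forall u v, V u -> L2_I L v -> u = v %[ae mu_I L] -> V v ;
  es_lin : forall (r : R) u v, V u -> V v -> V (fun x => r * u x + v x) ;
  es_ipC : forall u v, V u -> V v -> ip u v = ip v u ;
  es_ipl : forall (r : R) u v w, V u -> V v -> V w ->
    ip (fun x => r * u x + v x) w = r * ip u w + ip v w ;
  es_equiv : exists c1 c2 : R, [/\ 0 < c1, 0 < c2 &
    forall u, V u -> c1 * ipH1 L u u <= ip u u /\ ip u u <= c2 * ipH1 L u u] ;
  es_complete : forall u_ : nat -> R -> R, (forall n, V (u_ n)) ->
    (forall e : R, 0 < e -> exists N, forall m n, (N <= m)%N -> (N <= n)%N ->
       ip_norm ip (u_ m - u_ n) < e) ->
    exists2 u, V u & ip_norm ip (u_ n - u) @[n --> \oo] --> (0 : R) }.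

End SpatialSpaces.

(** A normed space presented as the elements satisfying [ns_mem] of a vector
    space, with a seminorm on them; x and y are identified when
    [ns_norm (x - y) = 0]. *)
Record nspace (R : realType) := NSpace {
  ns_car :> lmodType R ;
  ns_mem : set ns_car ;
  ns_norm : ns_car -> R }.
Arguments ns_mem {R n} _.
Arguments ns_norm {R n} _.

Section TimeSpaces.
Context {R : realType}.
Variable X : nspace R.
Implicit Types (D : set R) (T : R) (f g : R -> X) (x : X).

Local Notation leb := (@lebesgue_measure R).

(** The step function sum_k 1_(A_k) x_k is encoded by the list of the
    (A_k, x_k). *)
Definition step := seq (set R * X).

Definition step_wf (s : step) : Prop :=
  forall k, (k < size s)%N ->
    let p := nth (set0, 0) s k in measurable p.1 /\ ns_mem p.2.

Definition step_val (s : step) (t : R) : X :=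
  \sum_(p <- s) (\1_(p.1) t : R) *: p.2.

Definition step_int D (s : step) : X :=
  \sum_(p <- s) fine (leb (D `&` p.1)) *: p.2.

(** Functions are Borel representatives: the step functions converge
    everywhere on D. *)
Definition strongly_measurable D f : Prop :=
  exists s_ : nat -> step, (forall n, step_wf (s_ n)) /\
    forall t, D t ->
      ns_norm (f t - step_val (s_ n) t) @[n --> \oo] --> (0 : R).

Definition L2_time D f : Prop :=
  [/\ forall t, D t -> ns_mem (f t), strongly_measurable D f &
      (\int[leb]_(t in D) ((ns_norm (f t) ^+ 2)%:E) < +oo)%E].

(** x is the Bochner integral of f over D (for D of finite measure). *)
Definition is_bochner_integral D f x : Prop :=
  [/\ ns_mem x, strongly_measurable D f & exists s_ : nat -> step,
    [/\ forall n, step_wf (s_ n),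
        (\int[leb]_(t in D) (ns_norm (f t - step_val (s_ n) t))%:E)%E
          @[n --> \oo] --> 0%E &
        ns_norm (x - step_int D (s_ n)) @[n --> \oo] --> (0 : R)]].

(** f' = g in the sense of X-valued distributions on (0, T). *)
Definition is_time_derivative T f g : Prop :=
  forall phi : R -> R, test_function `]0, T[%classic phi ->
    exists y : X,
      is_bochner_integral `]0, T[%classic (fun t => derive1 phi t *: f t) y /\
      is_bochner_integral `]0, T[%classic (fun t => phi t *: g t) (- y).

Definition continuous_time T f : Prop :=
  forall t, `[0, T]%classic t -> ns_mem (f t) /\
    ns_norm (f s - f t) @[s --> within `[0, T]%classic (nbhs t)] --> (0 : R).

End TimeSpaces.

Section WeakSolutions.
Context {R : realType}.
Implicit Types (L : \bar R) (V : set (R -> R)).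
Implicit Types (ip : (R -> R) -> (R -> R) -> R).

Definition spaceH L : nspace R :=
  @NSpace R (R -> R^o) (L2_I L) (ip_norm (ipH L)).

Definition spaceV V ip : nspace R := @NSpace R (R -> R^o) V (ip_norm ip).

(** The dual V^*; the values of a functional outside of V are irrelevant. *)
Definition dual_mem V ip (l : (R -> R) -> R) : Prop :=
  (forall (r : R) u v, V u -> V v ->
     l (fun x => r * u x + v x) = r * l u + l v) /\
  exists C : R, forall u, V u -> `|l u| <= C * ip_norm ip u.

Definition dual_norm V ip (l : (R -> R) -> R) : R :=
  sup [set `|l u| | u in [set u | V u /\ ip_norm ip u <= 1]].

Definition spaceVdual V ip : nspace R :=
  @NSpace R ((R -> R) -> R^o) (dual_mem V ip) (dual_norm V ip).

(** The embedding of H into V^*. *)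
Definition H_to_dual L (u : R -> R) : (R -> R) -> R := ipH L u.

Definition operator_A L (kappa : R) (u : R -> R) : (R -> R) -> R :=
  form_a L kappa u.

(** eta is in W(0,T), with eta' = deta and eta'' = ddeta. *)
Definition in_W L V ip (T : R) (eta deta : R -> R -> R)
    (ddeta : R -> (R -> R) -> R) : Prop :=
  [/\ L2_time (X := spaceV V ip) `]0, T[%classic eta,
      L2_time (X := spaceH L) `]0, T[%classic deta,
      L2_time (X := spaceVdual V ip) `]0, T[%classic ddeta,
      is_time_derivative (X := spaceH L) T eta deta &
      is_time_derivative (X := spaceVdual V ip) T
        (fun t => H_to_dual L (deta t)) ddeta].

(** eta, with time derivative deta (both being the continuous representatives),
    is a weak solution of eta'' + A eta = f(t, eta), eta(0) = u0,
    eta'(0) = v0. *)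
Definition weak_solution L V ip (kappa T : R) (f : R -> (R -> R) -> R -> R)
    (u0 v0 : R -> R) (eta deta : R -> R -> R) : Prop :=
  [/\ continuous_time (X := spaceV V ip) T eta,
      continuous_time (X := spaceH L) T deta,
      exists2 ddeta, in_W L V ip T eta deta ddeta &
        {ae (@lebesgue_measure R), forall t, `]0, T[%classic t ->
           forall v, V v ->
             ddeta t v + operator_A L kappa (eta t) v
               = H_to_dual L (f t (eta t)) v},
      eta 0 = u0 %[ae mu_I L] &
      deta 0 = v0 %[ae mu_I L]].

Definition sg_nonlinearity (eps : R) (phi : R -> R -> R) (g : R -> R -> R)
    (t : R) (eta : R -> R) : R -> R :=
  fun x => eps^-1 * (sin (phi x t) - sin (phi x t + eps * eta x)) + g t x.

(** Classical solution phi(x, t) of phi_tt - phi_xx + sin phi = 0 on the plane. *)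
Record sine_gordon_solution (phi : R -> R -> R) : Prop := SineGordonSolution {
  sg_dx : forall x t, derivable (phi ^~ t) x 1 ;
  sg_dt : forall x t, derivable (phi x) t 1 ;
  sg_dxx : forall x t, derivable (derive1 (phi ^~ t)) x 1 ;
  sg_dtt : forall x t, derivable (derive1 (phi x)) t 1 ;
  sg_cont : continuous (fun p : R * R => phi p.1 p.2) ;
  sg_cont_x : continuous (fun p : R * R => derive1 (phi ^~ p.2) p.1) ;
  sg_cont_t : continuous (fun p : R * R => derive1 (phi p.1) p.2) ;
  sg_cont_xx : continuous (fun p : R * R => derive1 (derive1 (phi ^~ p.2)) p.1) ;
  sg_cont_tt : continuous (fun p : R * R => derive1 (derive1 (phi p.1)) p.2) ;
  sg_eq : forall x t,
    derive1 (derive1 (phi x)) t - derive1 (derive1 (phi ^~ t)) x + sin (phi x t) = 0 }.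

End WeakSolutions.

(* Main.v *)
(* The difference w = eta2 - eta1 satisfies w'' + A w = F with
   |F| <= |w| + |g2 - g1| in H, since y |-> eps^-1 sin (phi + eps y) is
   1-Lipschitz. Its energy E = |w'|^2 + a(w, w) satisfies
   E(t) <= E(0) + int_0^t (|F|^2 + |w'|^2), and Gronwall's lemma together with
   coercivity concludes.
   As w' takes its values in H only, the equation cannot be tested against w'.
   It is tested at time r against the increment y = w(t + h) - w(t), which lies
   in V, and integrated over r in [t, t + h]. This bounds the growth in t of
   |y|^2 + int int_([t, t + h]^2) a(w r, w s) dr ds; dividing by h^2 and letting
   h tend to 0 yields the energy inequality. The scalar identities satisfied by
   (w, v) and (w', v) follow from the distributional equations by the
   du Bois-Reymond lemma. *)

Require Import Defs.
From mathcomp Require Import all_boot all_order all_algebra.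
From mathcomp Require Import all_classical all_reals all_analysis.
From mathcomp Require Import measurable_realfun ring lra.

Import Order.TTheory GRing.Theory Num.Theory.
Import numFieldNormedType.Exports.

Set Implicit Arguments.
Unset Strict Implicit.
Unset Printing Implicit Defensive.

Local Open Scope classical_set_scope.
Local Open Scope ring_scope.

(** The double integral is chosen so that the terms in [a] cancel. The derivative of |y|^2 is 2
    (w'(t + h) - w'(t), y). The equation tested against y, kept fixed while r runs over [t, t + h],
    turns this into the work of F minus twice the integral of a(w r, y) = a(w r, w(t + h)) - a(w r,
    w t). By the symmetry of [a], the double integral has exactly the opposite derivative. Only
    identities for fixed vectors are used. The work of F contributes at most h times the increment
    over [t, t + h] of a primitive of |F|^2 + |w'|^2. Integrated in t, this is h times a difference
    of integrals of the primitive over two windows of length h, hence of order h^2 like the other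
    terms. In the energy inequality no function of t is differentiated: growth is controlled by
    increments with an error e * d uniform in t, for which moduli of continuity suffice. To have
    them on the whole line, solutions are extended from [0, T] by constants. The window must fit to
    the right of t, so the inequality is obtained for t < T. *)

Lemma increment_nonincreasing (R : realType) (f : R -> R) (a b : R) :
  a <= b ->
  (forall e, 0 < e -> exists2 d0, 0 < d0 & forall t d, a <= t -> 0 <= d ->
     d <= d0 -> t + d <= b -> f (t + d) - f t <= e * d) ->
  f b <= f a.
Proof.
move=> ab H; apply/ler_addgt0Pr => e e0.
(* The interval is cut into n equal steps shorter than [d0] and the increments telescope; the slope
   e / (b - a + 1) keeps their sum below e, also when a = b. *)
have e1 : 0 < e / (b - a + 1) by apply: divr_gt0 => //; lra.
have [d0 d00 Hd] := H _ e1.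
pose n := (Num.truncn ((b - a) / d0)).+1.
have n0 : 0 < n%:R :> R by rewrite ltr0n.
pose d := (b - a) / n%:R.
have dge : 0 <= d by apply: divr_ge0; [lra|exact: ltW].
have dn : d * n%:R = b - a by rewrite /d divfK// gt_eqF.
have dd0 : d <= d0.
  rewrite /d ler_pdivrMr// -ler_pdivrMl// mulrC.
  by apply/ltW; rewrite /n truncnS_gt.
have key k : (k <= n)%N -> f (a + d * k%:R) - f a <= e / (b - a + 1) * (d * k%:R).
  elim: k => [_|k IH kn]; first by rewrite !mulr0 addr0 subrr.
  have Hk := IH (ltnW kn).
  have dk : d * k.+1%:R <= b - a.
    by rewrite -dn ler_wpM2l// ler_nat.
  have dk0 : 0 <= d * k%:R by rewrite mulr_ge0.
  have E : d * k.+1%:R = d * k%:R + d by rewrite -natr1 mulrDr mulr1.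
  have := Hd (a + d * k%:R) d _ dge dd0 _.
  rewrite E addrA => /(_ ltac:(lra) ltac:(lra)) H1; lra.
have := key n (leqnn n); rewrite dn (addrC a) subrK.
have : e / (b - a + 1) * (b - a) <= e.
  rewrite mulrAC ler_pdivrMr; last lra.
  by rewrite ler_wpM2l //; lra.
lra.
Qed.

(** * Semi-inner products *)

Section SemiInner.
Context {R : realType} {E : lmodType R}.

(** Only semi-definiteness on a subset is asked, since functions are not quotiented by a.e.
    equality. The same interface serves the product of H, the product [ip] of V and the form [a] on
    V. *)
Record semi_inner (D : set E) (B : E -> E -> R) : Prop := SemiInner {
  si_lin : forall r u v, D u -> D v -> D (r *: u + v) ;
  si_C : forall u v, D u -> D v -> B u v = B v u ;
  si_l : forall r u v w, D u -> D v -> D w ->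
    B (r *: u + v) w = r * B u w + B v w ;
  si_ge0 : forall u, D u -> 0 <= B u u }.

Variables (D : set E) (B : E -> E -> R).
Hypothesis HB : semi_inner D B.
Hypothesis D0 : D 0.
Implicit Types (u v w : E).

Definition si_norm u := Num.sqrt (B u u).

Lemma si_D u v : D u -> D v -> D (u + v).
Proof. by move=> Du Dv; rewrite -[u]scale1r; exact: (si_lin HB). Qed.

Lemma si_Z r u : D u -> D (r *: u).
Proof. by move=> Du; rewrite -[_ *: _]addr0; exact: (si_lin HB). Qed.

Lemma si_N u : D u -> D (- u).
Proof. by rewrite -scaleN1r; exact: si_Z. Qed.

Lemma si_B u v : D u -> D v -> D (u - v).
Proof. by move=> Du Dv; apply: si_D => //; exact: si_N. Qed.

Lemma si_Dl u v w : D u -> D v -> D w -> B (u + v) w = B u w + B v w.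
Proof. by move=> *; rewrite -[u]scale1r (si_l HB)// mul1r scale1r. Qed.

Lemma si_0l w : D w -> B 0 w = 0.
Proof.
move=> Dw; have := si_Dl D0 D0 Dw; rewrite addr0 => H.
by apply: (addrI (B 0 w)); rewrite addr0 -H.
Qed.

Lemma si_Zl r u w : D u -> D w -> B (r *: u) w = r * B u w.
Proof. by move=> *; rewrite -[_ *: _]addr0 (si_l HB)// si_0l// addr0. Qed.

Lemma si_Nl u w : D u -> D w -> B (- u) w = - B u w.
Proof. by move=> *; rewrite -scaleN1r si_Zl// mulN1r. Qed.

Lemma si_Bl u v w : D u -> D v -> D w -> B (u - v) w = B u w - B v w.
Proof. by move=> *; rewrite si_Dl ?si_Nl//; exact: si_N. Qed.

Lemma si_Dr u v w : D u -> D v -> D w -> B w (u + v) = B w u + B w v.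
Proof.
move=> Du Dv Dw; rewrite (si_C HB)//; last exact: si_D.
by rewrite si_Dl// (si_C HB Du)// (si_C HB Dv).
Qed.

Lemma si_Zr r u w : D u -> D w -> B w (r *: u) = r * B w u.
Proof.
move=> Du Dw; rewrite (si_C HB)//; last exact: si_Z.
by rewrite si_Zl// (si_C HB Du).
Qed.

Lemma si_Br u v w : D u -> D v -> D w -> B w (u - v) = B w u - B w v.
Proof.
move=> Du Dv Dw; rewrite (si_C HB)//; last exact: si_B.
by rewrite si_Bl// (si_C HB Du)// (si_C HB Dv).
Qed.

Lemma si_norm_ge0 u : 0 <= si_norm u. Proof. exact: sqrtr_ge0. Qed.

Lemma si_norm_sqr u : D u -> si_norm u ^+ 2 = B u u.
Proof. by move=> Du; rewrite sqr_sqrtr// (si_ge0 HB). Qed.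

Lemma si_sqrD u v : D u -> D v ->
  B (u + v) (u + v) = B u u + 2 * B u v + B v v.
Proof.
move=> Du Dv; have Duv := si_D Du Dv.
by rewrite si_Dl// !si_Dr// (si_C HB Dv Du); lra.
Qed.

Lemma si_sqrB u v : D u -> D v ->
  B (u - v) (u - v) = B u u - 2 * B u v + B v v.
Proof.
move=> Du Dv; have Duv := si_B Du Dv.
by rewrite si_Bl// !si_Br// (si_C HB Dv Du); lra.
Qed.

Lemma si_CS u v : D u -> D v -> `|B u v| <= si_norm u * si_norm v.
Proof.
move=> Du Dv.
have Bu := si_ge0 HB Du; have Bv := si_ge0 HB Dv.
have key r : 0 <= B u u - 2 * r * B u v + r ^+ 2 * B v v.
  have Drv := si_Z r Dv.
  have := si_ge0 HB (si_B Du Drv).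
  by rewrite si_sqrB// si_Zr// si_Zl// si_Zr//; lra.
rewrite /si_norm -sqrtrM// -sqrtr_sqr ler_sqrt ?mulr_ge0//.
have [Bv0|Bv0] := eqVneq (B v v) 0.
  have [->|b0] := eqVneq (B u v) 0; first by rewrite expr0n/= mulr_ge0.
  have := key ((B u u + 1) / (2 * B u v)).
  rewrite Bv0 mulr0 addr0.
  have -> : 2 * ((B u u + 1) / (2 * B u v)) * B u v = B u u + 1.
    by field.
  lra.
have Bv1 : 0 < B v v by rewrite lt_neqAle eq_sym Bv0.
have := key (B u v / B v v).
have -> : B u u - 2 * (B u v / B v v) * B u v + (B u v / B v v) ^+ 2 * B v v
  = (B u u * B v v - B u v ^+ 2) / B v v by field.
by rewrite pmulr_lge0 ?invr_gt0// subr_ge0.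
Qed.

Lemma si_le u v : D u -> D v -> B u v <= si_norm u * si_norm v.
Proof. by move=> Du Dv; apply: le_trans (si_CS Du Dv); exact: ler_norm. Qed.

Lemma si_normD u v : D u -> D v -> si_norm (u + v) <= si_norm u + si_norm v.
Proof.
move=> Du Dv; rewrite -(@ler_pXn2r _ 2)// ?nnegrE ?addr_ge0 ?si_norm_ge0//.
rewrite sqrrD !si_norm_sqr//; last exact: si_D.
by rewrite si_sqrD//; have := si_le Du Dv; rewrite -mulr_natl; lra.
Qed.

Lemma si_normZ r u : D u -> si_norm (r *: u) = `|r| * si_norm u.
Proof.
move=> Du; rewrite /si_norm si_Zl// ?si_Zr//; last exact: si_Z.
by rewrite mulrA -expr2 sqrtrM ?sqr_ge0// sqrtr_sqr.
Qed.

Lemma si_normN u : D u -> si_norm (- u) = si_norm u.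
Proof. by move=> Du; rewrite -scaleN1r si_normZ// normrN1 mul1r. Qed.

Lemma si_normB u v : D u -> D v -> si_norm (u - v) <= si_norm u + si_norm v.
Proof. by move=> Du Dv; rewrite -(si_normN Dv); apply: si_normD => //; exact: si_N. Qed.

Lemma si_normC u v : D u -> D v -> si_norm (u - v) = si_norm (v - u).
Proof. by move=> Du Dv; rewrite -opprB si_normN//; exact: si_B. Qed.

Lemma si_norm_distD v u w : D u -> D v -> D w -> si_norm (u - w) <= si_norm (u - v) + si_norm (v - w).
Proof.
move=> Du Dv Dw; have -> : u - w = (u - v) + (v - w) by rewrite addrA subrK.
by apply: si_normD; exact: si_B.
Qed.

Lemma si_norm_dist u v : D u -> D v -> `|si_norm u - si_norm v| <= si_norm (u - v).
Proof.
move=> Du Dv; rewrite ler_norml.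
have H1 : si_norm u <= si_norm (u - v) + si_norm v.
  by rewrite -{1}(subrK v u); apply: si_normD => //; exact: si_B.
have H2 : si_norm v <= si_norm (u - v) + si_norm u.
  by rewrite si_normC// -{1}(subrK u v); apply: si_normD => //; exact: si_B.
lra.
Qed.

End SemiInner.

(** * The space H = L^2(I) as a semi-inner product space *)

Section L2.
Context {R : realType} (L : \bar R).
Local Notation mu := (mu_I L).
Implicit Types u v : R -> R.

Lemma L2_IP u : L2_I L u <->
  measurable_fun setT u /\ mu.-integrable setT (EFin \o (fun x => u x ^+ 2)).
Proof.
split.
  rewrite /L2_I/= => Hu; split; last exact: Lfun2_integrable_sqr.
  by move: Hu; rewrite inE => /andP[]; rewrite inE.
move=> [mu_ /integrableP[_ iu]]; rewrite /L2_I/= inE; apply/andP; split.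
  by rewrite inE.
rewrite inE/= /finite_norm (@lty_poweRy _ _ 2)//.
rewrite powR_Lnorm//; apply: le_lt_trans iu.
apply: ge0_le_integral => //=.
- apply/measurable_EFinP/(@measurableT_comp _ _ _ _ _ _ (fun x : R => x `^ 2)) => //.
  exact/measurableT_comp.
- by apply/measurable_EFinP; apply: measurableT_comp => //; exact: measurable_funX.
- by move=> x _; rewrite lee_fin powR_mulrn// -normrX.
Qed.

Lemma L2_I_measurable u : L2_I L u -> measurable_fun setT u.
Proof. by case/L2_IP. Qed.

Lemma L2_I_mul u v : L2_I L u -> L2_I L v ->
  mu.-integrable setT (EFin \o (fun x => u x * v x)).
Proof.
move=> /L2_IP[mu_ iu] /L2_IP[mv iv].
apply: le_integrable (integrableD _ iu iv) => //.
- exact/measurable_EFinP/measurable_funM.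
- move=> x _ /=; rewrite lee_fin normrM [leRHS]ger0_norm ?addr_ge0 ?sqr_ge0//.
  rewrite -(real_normK (num_real (u x))) -(real_normK (num_real (v x))).
  have := sqr_ge0 (`|u x| - `|v x|); have := normr_ge0 (u x); have := normr_ge0 (v x).
  set a := `|u x|; set b := `|v x|; nra.
Qed.

Lemma L2_I_bounded_by u v : measurable_fun setT u -> L2_I L v ->
  (forall x, `|u x| <= `|v x|) -> L2_I L u.
Proof.
move=> mu_ /L2_IP[mv iv] uv; apply/L2_IP; split => //.
apply: le_integrable iv => //; first exact/measurable_EFinP/measurable_funX.
by move=> x _; rewrite lee_fin !normrX lerXn2r// nnegrE.
Qed.

Lemma L2_I_lin r u v : L2_I L u -> L2_I L v -> L2_I L (fun x => r * u x + v x).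
Proof.
move=> Lu Lv; have /L2_IP[mu_ iu] := Lu; have /L2_IP[mv iv] := Lv.
apply/L2_IP; split; first by apply: measurable_funD => //; exact: measurable_funM.
have -> : EFin \o (fun x => (r * u x + v x) ^+ 2) =
  (fun x => (r ^+ 2)%:E * (EFin \o (fun x => (u x ^+ 2)%R)) x)%E \+
  ((fun x => (2 * r)%:E * (EFin \o (fun x => (u x * v x)%R)) x)%E \+
   (EFin \o (fun x => v x ^+ 2))).
  by apply/funext => x /=; rewrite -!EFinM -!EFinD; congr EFin; ring.
apply: integrableD => //; first exact: integrableZl.
apply: integrableD => //; apply: integrableZl => //; exact: L2_I_mul.
Qed.

Lemma L2_I0 : L2_I L (0 : R -> R^o).
Proof.
apply/L2_IP; split; first exact: measurable_cst.
rewrite (_ : _ \o _ = cst 0%E); first exact: integrable0.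
by apply/funext => x /=; rewrite expr0n.
Qed.

Lemma ipH_semi_inner : @semi_inner R (R -> R^o) (L2_I L) (ipH L).
Proof.
split.
- exact: L2_I_lin.
- by move=> u v _ _; congr fine; apply: eq_integral => x _; rewrite mulrC.
- move=> r u v w Lu Lv Lw; rewrite /ipH.
  rewrite -RintegralZl//; last exact: L2_I_mul.
  rewrite -RintegralD//; last exact: L2_I_mul.
    by apply: eq_Rintegral => x _ /=; rewrite mulrDl mulrA.
  have := integrableZl measurableT r (L2_I_mul Lu Lw).
  by apply: eq_integrable => // x _ /=; rewrite EFinM.
- move=> u _; apply: Rintegral_ge0 => x _; rewrite -expr2; exact: sqr_ge0.
Qed.

Lemma ipH_eq0 u : L2_I L u -> ipH L u u = 0 -> u = 0 %[ae mu].
Proof.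
move=> Lu; have iu := L2_I_mul Lu Lu; have mu_ := L2_I_measurable Lu.
rewrite /ipH /Rintegral => H.
have H0 : (\int[mu]_x `|(u x * u x)%:E| = 0)%E.
  rewrite -[0%E](congr1 EFin H) fineK; last exact: integrable_fin_num iu.
  by apply: eq_integral => x _ /=; rewrite ger0_norm// -expr2 sqr_ge0.
have /ae_eq_integral_abs := H0; move=> /(_ measurableT) []//.
  exact/measurable_EFinP/measurable_funM.
move=> N HN; exists N; case: HN => mN N0 sub; split => //.
apply: subset_trans sub => x /= /not_implyP[_ /eqP ux]; apply/not_implyP; split => //=.
by move=> [/eqP]; rewrite mulf_eq0 orbb; exact/negP.
Qed.

Lemma ipH_ae0 u v : L2_I L u -> L2_I L v -> u = 0 %[ae mu] -> ipH L u v = 0.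
Proof.
move=> Lu Lv u0; rewrite /ipH /Rintegral.
rewrite (@ae_eq_integral _ _ _ mu _ (cst 0%E))//; first by rewrite integral0.
- by apply/measurable_EFinP/measurable_funM => //; exact: L2_I_measurable.
- case: u0 => N [mN N0 sub]; exists N; split => //.
  apply: subset_trans sub => x /= /not_implyP[_ ux]; apply/not_implyP; split => //=.
  by move=> u0; apply: ux; rewrite u0 mul0r.
Qed.

Lemma ipH_le u v : measurable_fun setT u -> L2_I L v ->
  (forall x, `|u x| <= `|v x|) -> ipH L u u <= ipH L v v.
Proof.
move=> mu_ Lv uv; have Lu := L2_I_bounded_by mu_ Lv uv.
apply: le_Rintegral => //; [exact: L2_I_mul..|].
by move=> x _; rewrite -!expr2 -[leLHS]real_normK ?num_real// -[leRHS]real_normK ?num_real// lerXn2r ?nnegrE.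
Qed.

End L2.

(** * Smooth bump functions *)

Section Smooth.
Context {R : realType}.
Implicit Types (f g : R -> R) (p : {poly R}).

(** Derivatives are supplied as witnesses, so that closure under sums, products and inverses is an
    induction on the order; [smooth_derivable] returns to the iterated derivatives of
    [test_function]. *)
Fixpoint smooth_upto n f : Prop :=
  if n is m.+1 then
    exists2 f', (forall x, is_derive x (1 : R) f (f' x)) & smooth_upto m f'
  else True.

Definition smooth f := forall n, smooth_upto n f.

Lemma smooth_upto_le n f : smooth_upto n.+1 f -> smooth_upto n f.
Proof.
elim: n f => // n IH f [f' f'E Hf']; exists f' => //; exact: IH.
Qed.

Lemma smooth_derivable f : smooth f ->
  forall n x, derivable (derive1n n f) x 1.
Proof.
move=> Hf n; have {Hf} := Hf n.+1; elim: n f => [|n IH] f [f' f'E Hf'] x.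
  by rewrite derive1n0; have := f'E x; case.
rewrite derive1Sn (_ : derive1 f = f'); first exact: IH.
by apply/funext => y; rewrite derive1E; have := f'E y; case.
Qed.

Lemma smooth_uptoD n f g : smooth_upto n f -> smooth_upto n g ->
  smooth_upto n (fun x => f x + g x).
Proof.
elim: n f g => // n IH f g [f' f'E Hf'] [g' g'E Hg'].
exists (fun x => f' x + g' x); last exact: IH.
by move=> x; exact: is_deriveD.
Qed.

Lemma smooth_uptoN n f : smooth_upto n f -> smooth_upto n (fun x => - f x).
Proof.
elim: n f => // n IH f [f' f'E Hf'].
exists (fun x => - f' x); last exact: IH.
by move=> x; exact: is_deriveN.
Qed.

Lemma smooth_uptoM n f g : smooth_upto n f -> smooth_upto n g ->
  smooth_upto n (fun x => f x * g x).
Proof.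
elim: n f g => // n IH f g Hf Hg.
have [f' f'E Hf'] := Hf; have [g' g'E Hg'] := Hg.
exists (fun x => f x * g' x + g x * f' x).
  by move=> x; exact: is_deriveM.
by apply: smooth_uptoD; apply: IH => //; exact: smooth_upto_le.
Qed.

Lemma smooth_uptoV n g : (forall x, g x != 0) -> smooth_upto n g ->
  smooth_upto n (fun x => (g x)^-1).
Proof.
move=> g0; elim: n => // n IH Hg.
have [g' g'E Hg'] := Hg; have Vg := IH (smooth_upto_le Hg).
exists (fun x => - ((g x)^-1 * (g x)^-1) * g' x).
  move=> x; apply: is_derive_eq (is_deriveV (g0 x) (g'E x)) _.
  by rewrite expr2 invfM.
by apply: smooth_uptoM => //; apply: smooth_uptoN; exact: smooth_uptoM.
Qed.

Lemma smooth_upto_affine n f (a b : R) : smooth_upto n f ->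
  smooth_upto n (fun x => f (a * x + b)).
Proof.
elim: n f => // n IH f [f' f'E Hf'].
exists (fun x => f' (a * x + b) * a).
  move=> x; have H : is_derive x (1 : R) (fun x => a * x + b) a.
    apply: is_derive_eq (is_deriveD (is_deriveZ a (is_derive_id x 1)) (is_derive_cst b x 1)) _.
    by rewrite addr0 scaler1.
  exact: (@is_derive1_comp _ f (fun x => a * x + b) x _ _ (f'E _) H).
apply: smooth_uptoM; first exact: IH.
case: n {IH Hf'} => // n; exists (cst 0); first by move=> x; exact: is_derive_cst.
by elim: n => // n IHn; exists (cst 0) => // x; exact: is_derive_cst.
Qed.

(** A single term of the exponential series gives y^n <= n! e^y for y >= 0. Used with y = 1/x to see
    that [flat p] vanishes at 0 faster than any power. *)
Lemma poly_expR_bounded p : exists C : R, forall y, 0 <= y ->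
  `|p.[y]| * expR (- y) <= C.
Proof.
have mono n (y : R) : 0 <= y -> y ^+ n * expR (- y) <= n`!%:R.
  move=> y0; rewrite expRN ler_pdivrMr ?expR_gt0//.
  case: n => [|n]; first by rewrite expr0 fact0 mul1r -[1]expR0 ler_expR.
  rewrite mulrC -ler_pdivrMr ?ltr0n ?fact_gt0//.
  by apply: le_trans (expR_ge1Dxn n y0); rewrite lerDr.
exists (\sum_(i < size p) `|p`_i| * i`!%:R) => y y0.
rewrite horner_coef; apply: le_trans (_ : (\sum_(i < size p) `|p`_i * y ^+ i|) * expR (- y) <= _).
  by rewrite ler_wpM2r ?expR_ge0// ler_norm_sum.
rewrite mulr_suml; apply: ler_sum => i _.
by rewrite normrM -mulrA ler_wpM2l// normrX ger0_norm// mono.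
Qed.

(* This family is stable under differentiation, with vanishing derivative at 0. *)
Definition flat p (x : R) : R := if 0 < x then p.[x^-1] * expR (- x^-1) else 0.

(** For x > 0 the derivative of p(1/x) e^(-1/x) is x^(-2) (p(1/x) - p'(1/x)) e^(-1/x), again a
    polynomial in 1/x times the exponential. *)
Definition flat_deriv p : {poly R} := 'X^2 * (p - p^`()).

Lemma is_derive_flat p (x : R) : is_derive x (1 : R) (flat p) (flat (flat_deriv p) x).
Proof.
have [x0|x0|->] := ltgtP x 0.
- rewrite {2}/flat ltNge (ltW x0)/=.
  apply: (near_eq_is_derive _ (is_derive_cst (0 : R) x 1)).
  near=> y; rewrite /flat ltNge /cst; suff -> : y <= 0 by [].
  by apply/ltW; near: y; exact: lt_nbhsl.
- rewrite {2}/flat x0.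
  have HV : is_derive x (1 : R) (fun y => y^-1) (- x ^- 2).
    by apply: is_derive_eq (is_deriveV (lt0r_neq0 x0) (is_derive_id x 1)) _; rewrite scaler1.
  have Hp := is_derive1_comp (is_derive_poly p x^-1) HV.
  have He := @is_derive1_comp _ expR (fun y => - y^-1) x _ _ (is_derive_expR _) (is_deriveN HV).
  apply: is_derive_eq (near_eq_is_derive _ (is_deriveM Hp He)) _.
    near=> y; rewrite /flat; suff -> : 0 < y by [].
    by near: y; exact: lt_nbhsr.
  rewrite /flat_deriv hornerM hornerXn hornerD hornerN.
  by rewrite -exprVn /GRing.scale/=; ring.
- rewrite {2}/flat ltxx.
  (* With y = 1/h, the difference quotient y p(y) e^(-y) equals h times (p X^2)(y) e^(-y): the
     factor X^2 pays for the quotient and leaves one h over a bounded quantity. *)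
  have [C HC] := poly_expR_bounded (p * 'X^2).
  suff H : (fun h : R => h^-1 *: (flat p (h + 0) - flat p 0)) @ 0^' --> (0 : R).
    have H' : (fun h : R => h^-1 *: ((flat p \o shift 0) (h *: (1 : R)) - flat p 0)) @ 0^' --> (0 : R).
      by under eq_fun do rewrite /= scaler1.
    by apply: DeriveDef; [apply/cvg_ex; exists 0|apply/cvg_lim].
  have E h : h^-1 *: (flat p (h + 0) - flat p 0) = h^-1 * flat p h.
    by rewrite addr0 /flat ltxx subr0.
  under eq_fun do rewrite E.
  apply/cvgr0Pnorm_le => e e0.
  have C0 : 0 <= C by apply: le_trans (HC 0 (lexx 0)); rewrite mulr_ge0 ?expR_ge0.
  have d0 : 0 < e / (C + 1) by rewrite divr_gt0//; lra.
  near=> h.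
  have hd : `|h| < e / (C + 1).
    by near: h; exact: (dnbhs0_lt d0).
  rewrite /flat; case: ifPn => [h0|_]; last by rewrite mulr0 normr0 ltW.
  have hV : 0 <= h^-1 by rewrite invr_ge0 ltW.
  have := HC _ hV; rewrite hornerM hornerXn [`|_ * _ ^+ 2|]normrM normrX.
  rewrite !normrM !(ger0_norm hV) (ger0_norm (expR_ge0 _)) => H.
  rewrite (ger0_norm (ltW h0)) in hd.
  have : h * (`|p.[h^-1]| * h^-1 ^+ 2 * expR (- h^-1)) <= h * C by rewrite ler_wpM2l// ltW.
  have -> : h * (`|p.[h^-1]| * h^-1 ^+ 2 * expR (- h^-1)) = h^-1 * (`|p.[h^-1]| * expR (- h^-1)).
    by field; rewrite gt_eqF.
  move=> /le_trans; apply.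
  apply: (@le_trans _ _ (h * (C + 1))); first by rewrite ler_wpM2l ?ltW//; lra.
  by apply/ltW; rewrite -ltr_pdivlMr//; lra.
Unshelve. all: by end_near.
Qed.

Lemma smooth_flat p : smooth (flat p).
Proof.
move=> n; elim: n p => // n IH p; exists (flat (flat_deriv p)); last exact: IH.
exact: is_derive_flat.
Qed.

Definition smooth_step (x : R) : R := flat 1 x / (flat 1 x + flat 1 (1 - x)).

Lemma flat1_ge0 (x : R) : 0 <= flat 1 x.
Proof. by rewrite /flat; case: ifP => // _; rewrite hornerC mul1r expR_ge0. Qed.

Lemma flat1_gt0 (x : R) : 0 < x -> 0 < flat 1 x.
Proof. by move=> x0; rewrite /flat x0 hornerC mul1r expR_gt0. Qed.

Lemma flat1_eq0 (x : R) : x <= 0 -> flat 1 x = 0.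
Proof. by move=> x0; rewrite /flat ltNge x0. Qed.

Lemma smooth_step_den_gt0 (x : R) : 0 < flat 1 x + flat 1 (1 - x).
Proof.
have [x0|x0] := ltP 0 x.
  by rewrite ltr_pwDl ?flat1_gt0 ?flat1_ge0.
by rewrite ltr_wpDl ?flat1_ge0// flat1_gt0//; lra.
Qed.

Lemma smooth_smooth_step : smooth smooth_step.
Proof.
move=> n; apply: smooth_uptoM; first exact: smooth_flat.
apply: smooth_uptoV; first by move=> x; rewrite gt_eqF// smooth_step_den_gt0.
apply: smooth_uptoD; first exact: smooth_flat.
rewrite (_ : (fun x => _) = (fun x => flat 1 ((- 1) * x + 1))).
  by apply: smooth_upto_affine; exact: smooth_flat.
by apply/funext => x; rewrite mulN1r addrC.
Qed.

Lemma smooth_step0 (x : R) : x <= 0 -> smooth_step x = 0.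
Proof. by move=> x0; rewrite /smooth_step flat1_eq0// mul0r. Qed.

Lemma smooth_step1 (x : R) : 1 <= x -> smooth_step x = 1.
Proof.
move=> x1; have := smooth_step_den_gt0 x; rewrite /smooth_step.
by rewrite (@flat1_eq0 (1 - x)) ?subr_le0// addr0 => H; rewrite divff// gt_eqF.
Qed.

Lemma smooth_step_ge0 (x : R) : 0 <= smooth_step x.
Proof. by rewrite divr_ge0 ?flat1_ge0// ltW// smooth_step_den_gt0. Qed.

Lemma smooth_step_le1 (x : R) : smooth_step x <= 1.
Proof.
by rewrite /smooth_step ler_pdivrMr ?smooth_step_den_gt0// mul1r lerDl flat1_ge0.
Qed.

End Smooth.

(** * Integrals over compact intervals of the line *)

Section IntervalIntegral.
Context {R : realType}.
Local Notation leb := (@lebesgue_measure R).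
Implicit Types (f g : R -> R).

(** Integrability is asked on every compact interval at once, so that splitting and shifting windows
    creates no side conditions. Functions known only on part of the line are first truncated or
    extended. *)
Definition locint f := forall a b, leb.-integrable `[a, b] (EFin \o f).

(** Not oriented: for a > b the interval is empty and the value is 0, hence the ordering hypotheses
    in the additivity lemmas. *)
Definition itvint f (a b : R) := \int[leb]_(x in `[a, b]) f x.

Lemma continuous_locint f : continuous f -> locint f.
Proof.
move=> cf a b; apply: continuous_compact_integrable.
  exact: segment_compact.
by move=> x; exact: continuous_subspaceT.
Qed.

Lemma locint_integrable f : leb.-integrable setT (EFin \o f) -> locint f.
Proof. by move=> fi a b; apply: integrableS fi. Qed.

Lemma locintD f g : locint f -> locint g -> locint (fun x => f x + g x).
Proof. by move=> fi gi a b; exact: (integrableD _ (fi a b) (gi a b)). Qed.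

Lemma locintB f g : locint f -> locint g -> locint (fun x => f x - g x).
Proof.
by move=> fi gi a b; exact: (integrableB _ (fi a b) (gi a b)).
Qed.

Lemma locintZ f r : locint f -> locint (fun x => r * f x).
Proof.
by move=> fi a b; exact: (integrableZl _ r (fi a b)).
Qed.

Lemma locint_cst r : locint (cst r).
Proof. by apply: continuous_locint => x; exact: cvg_cst. Qed.

Lemma locint_norm f : locint f -> locint (fun x => `|f x|).
Proof. by move=> fi a b; exact: integrable_norm (fi a b). Qed.

Lemma eq_itvint f g a b : (forall x, a <= x <= b -> f x = g x) ->
  itvint f a b = itvint g a b.
Proof. by move=> fg; apply: eq_Rintegral => x; rewrite inE/= in_itv/= => /fg. Qed.

Lemma itvintD f g a b : locint f -> locint g ->
  itvint (fun x => f x + g x) a b = itvint f a b + itvint g a b.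
Proof. by move=> fi gi; exact: RintegralD. Qed.

Lemma itvintB f g a b : locint f -> locint g ->
  itvint (fun x => f x - g x) a b = itvint f a b - itvint g a b.
Proof. by move=> fi gi; exact: RintegralB. Qed.

Lemma itvintZ f r a b : locint f ->
  itvint (fun x => r * f x) a b = r * itvint f a b.
Proof. by move=> fi; exact: RintegralZl. Qed.

Lemma itvint_cst r a b : a <= b -> itvint (cst r) a b = (b - a) * r.
Proof.
move=> ab; rewrite /itvint Rintegral_cst//= lebesgue_measure_itv/= lte_fin.
case: ltgtP ab => // [ab _|-> _]; first by rewrite -EFinB/= mulrC.
by rewrite subrr mul0r mulr0.
Qed.

Lemma itvint_id f a : itvint f a a = 0.
Proof. by rewrite /itvint set_itv1 Rintegral_set1. Qed.

Lemma le_itvint f g a b : locint f -> locint g ->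
  (forall x, a <= x <= b -> f x <= g x) -> itvint f a b <= itvint g a b.
Proof.
by move=> fi gi fg; apply: le_Rintegral => // x; rewrite /= in_itv/= => /fg.
Qed.

Lemma itvint_ge0 f a b : (forall x, a <= x <= b -> 0 <= f x) -> 0 <= itvint f a b.
Proof. by move=> f0; apply: Rintegral_ge0 => x; rewrite /= in_itv/= => /f0. Qed.

Lemma itvint_cat f a b c : locint f -> a <= b -> b <= c ->
  itvint f a c = itvint f a b + itvint f b c.
Proof.
move=> fi ab bc.
have := @Rintegral_itvB R f (BLeft a) (BRight c) b (fi a c).
rewrite !bnd_simp => /(_ ab bc).
rewrite Rintegral_itv_obnd_cbnd; last first.
  by apply: integrableS (fi b c) => //; apply: subset_itv; rewrite bnd_simp.
by rewrite -!/(itvint _ _ _) => <-; rewrite addrC subrK.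
Qed.

Lemma ler_norm_itvint f a b : locint f ->
  `|itvint f a b| <= itvint (fun x => `|f x|) a b.
Proof. by move=> fi; exact: le_normr_Rintegral. Qed.

(** Stands in for differentiating an integral: with c the value of f at an endpoint and e its
    oscillation, this is a first-order expansion with explicit error. *)
Lemma itvint_near f a b c e : locint f -> a <= b ->
  (forall x, a <= x <= b -> `|f x - c| <= e) ->
  `|itvint f a b - (b - a) * c| <= (b - a) * e.
Proof.
move=> fi ab H; have ci := locint_cst c.
rewrite -(itvint_cst c ab) -itvintB//.
apply: le_trans (ler_norm_itvint _ _ (locintB fi ci)) _.
rewrite -(itvint_cst e ab); apply: le_itvint => //.
- exact: locint_norm (locintB fi ci).
- exact: locint_cst.
Qed.

Lemma itvint_norm_le f a b e : locint f -> a <= b ->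
  (forall x, a <= x <= b -> `|f x| <= e) -> `|itvint f a b| <= (b - a) * e.
Proof.
move=> fi ab H; have := @itvint_near f a b 0 e fi ab.
by rewrite mulr0 subr0; apply => x /H; rewrite subr0.
Qed.

(** Absolute continuity of the integral, applied to f truncated to [a, b], which is integrable on
    the line. The modulus is halved because lengths are compared by <= here and measures by <
    there. *)
Lemma itvint_small f a b e : locint f -> 0 < e -> exists2 d, 0 < d &
  forall s t, a <= s -> s <= t -> t <= b -> t - s <= d ->
    itvint (fun x => `|f x|) s t <= e.
Proof.
move=> fi e0.
have fi' : leb.-integrable setT (EFin \o (f \_ `[a, b])).
  by rewrite -restrict_EFin; apply: (integrable_mkcond _ _).1 (fi a b).
have [d [d0 Hd]] := integral_normr_continuous fi' e0.
exists (d / 2); first by rewrite divr_gt0.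
move=> s t as_ st tb ts.
rewrite (@eq_itvint _ (fun x => `|(f \_ `[a, b]) x|)); last first.
  move=> x /andP[sx xt]; rewrite patchE mem_set//= in_itv/=.
  by apply/andP; split; [exact: le_trans sx|exact: le_trans xt _].
apply/ltW; suff lst : (leb `[s, t]%classic < d%:E)%E by exact: (Hd `[s, t]%classic).
rewrite lebesgue_measure_itv/=; case: ifP => _; last by rewrite lte_fin.
by rewrite -EFinB lte_fin (le_lt_trans ts)// ltr_pdivrMr// ltr_pMr// ltr1n.
Qed.

Lemma itvint_smallN f a b e : locint f -> 0 < e -> exists2 d, 0 < d &
  forall s t, a <= s -> s <= t -> t <= b -> t - s <= d -> `|itvint f s t| <= e.
Proof.
move=> fi e0; have [d d0 Hd] := itvint_small a b fi e0; exists d => // s t *.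
by apply: le_trans (ler_norm_itvint _ _ fi) _; exact: Hd.
Qed.

End IntervalIntegral.

(** * Smooth approximations of indicators of intervals *)

Section Bump.
Context {R : realType}.
Local Notation leb := (@lebesgue_measure R).
Implicit Types (f g : R -> R).

Lemma cvg_natmul_ge1 (x : R) : 0 < x -> \forall n \near \oo, 1 <= n.+1%:R * x.
Proof.
move=> x0; near=> n; rewrite -ler_pdivrMr//.
apply: le_trans (_ : n%:R <= _); last by rewrite ler_nat.
by near: n; exact: nbhs_infty_ger.
Unshelve. all: by end_near.
Qed.

Definition step_slope : R -> R := derive1 smooth_step.

Lemma is_derive_smooth_step (x : R) : is_derive x (1 : R) smooth_step (step_slope x).
Proof.
have := @smooth_derivable R _ (@smooth_smooth_step R) 0 x; rewrite derive1n0 => H.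
by apply: DeriveDef => //; exact: (esym (derive1E _ _)).
Qed.

Lemma step_slope_continuous : continuous step_slope.
Proof.
move=> x; apply: differentiable_continuous; apply/derivable1_diffP.
have := @smooth_derivable R _ (@smooth_smooth_step R) 1 x.
by rewrite derive1n1.
Qed.

Lemma step_slope_outside (x : R) : ~~ (0 <= x <= 1) -> step_slope x = 0.
Proof.
rewrite negb_and -!ltNge => /orP[x0|x1]; rewrite /step_slope derive1E.
  rewrite (@near_eq_derive _ _ _ _ (cst (0 : R))) ?derive_cst//.
  by near=> y; apply: smooth_step0; apply/ltW; near: y; exact: lt_nbhsl.
rewrite (@near_eq_derive _ _ _ _ (cst (1 : R))) ?derive_cst//.
by near=> y; apply: smooth_step1; apply/ltW; near: y; exact: lt_nbhsr.
Unshelve. all: by end_near.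
Qed.

Lemma step_slope_bounded : exists2 M : R, 0 < M & forall x, `|step_slope x| <= M.
Proof.
have cn : {within `[0, 1], continuous (fun x => `|step_slope x|)}.
  apply: continuous_subspaceT => x; apply: continuous_comp.
    exact: step_slope_continuous.
  exact: norm_continuous.
have [c _ Hc] := EVT_max (@ler01 R) cn.
exists (`|step_slope c| + 1); first by rewrite ltr_wpDl.
move=> x; have [x01|x01] := boolP (0 <= x <= 1).
  rewrite ler_wpDr//; apply: Hc.
  by rewrite in_itv.
by rewrite step_slope_outside// normr0 addr_ge0.
Qed.

(* Approximates the indicator of ]s, t], with ramps of width 1/c. *)
Definition bump (c s t x : R) : R := smooth_step (c * x + - (c * s)) - smooth_step (c * x + - (c * t)).

(** The derivative of the ramp starting at s: an approximate identity at s of mass 1, supported in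
    [s, s + 1/c]. *)
Definition bump_kernel (c s x : R) : R := c * step_slope (c * x + - (c * s)).

Lemma bump_smooth c s t : smooth (bump c s t).
Proof.
move=> n; apply: smooth_uptoD; last apply: smooth_uptoN;
  apply: smooth_upto_affine; exact: smooth_smooth_step.
Qed.

Lemma is_derive_step_affine c s x :
  is_derive x (1 : R) (fun x => smooth_step (c * x + - (c * s))) (bump_kernel c s x).
Proof.
have H : is_derive x (1 : R) (fun x => c * x + - (c * s)) c.
  apply: is_derive_eq (is_deriveD (is_deriveZ c (is_derive_id x 1)) (is_derive_cst (- (c * s)) x 1)) _.
  by rewrite addr0 scaler1.
apply: is_derive_eq (@is_derive1_comp _ smooth_step (fun x => c * x + - (c * s)) x _ _
  (is_derive_smooth_step _) H) _.
by rewrite mulrC.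
Qed.

Lemma derive1_bump c s t x :
  derive1 (bump c s t) x = bump_kernel c s x - bump_kernel c t x.
Proof.
have H := is_deriveB (is_derive_step_affine c s x) (is_derive_step_affine c t x).
by rewrite derive1E; case: H.
Qed.

Lemma bump_kernel_continuous c s : continuous (bump_kernel c s).
Proof.
move=> x; apply: cvgM; first exact: cvg_cst.
apply: (@cvg_comp _ _ _ (fun y => c * y + - (c * s)) step_slope); last exact: step_slope_continuous.
apply: cvgD; last exact: cvg_cst.
by apply: cvgM; [exact: cvg_cst|exact: cvg_id].
Qed.

Lemma bump_kernel_outside c s x : 0 < c -> ~~ (s <= x <= s + c^-1) ->
  bump_kernel c s x = 0.
Proof.
move=> c0 H; rewrite /bump_kernel step_slope_outside ?mulr0//.
apply: contra H => /andP[H1 H2]; apply/andP; split.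
  by rewrite -(ler_pM2l c0); lra.
by rewrite -(ler_pM2l c0) mulrDr divff ?gt_eqF//; lra.
Qed.

Lemma bump_outside c s t x : 0 < c -> s <= t -> ~~ (s <= x <= t + c^-1) ->
  bump c s t x = 0.
Proof.
move=> c0 st; rewrite negb_and -!ltNge /bump => /orP[xs|xt].
  by rewrite !smooth_step0 ?subrr// -mulrBr mulr_ge0_le0 ?ltW//; lra.
have tx1 : 1 <= c * (x - t) by rewrite mulrC -ler_pdivrMr// mul1r; lra.
have sx1 : 1 <= c * (x - s) by apply: le_trans tx1 _; rewrite ler_pM2l//; lra.
by rewrite !smooth_step1 ?subrr// -mulrBr.
Qed.

Lemma bump_norm c s t x : `|bump c s t x| <= 1.
Proof.
rewrite /bump ler_norml.
have := smooth_step_ge0 (c * x + - (c * s)); have := smooth_step_le1 (c * x + - (c * s)).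
have := smooth_step_ge0 (c * x + - (c * t)); have := smooth_step_le1 (c * x + - (c * t)).
lra.
Qed.

Lemma bump_continuous c s t : continuous (bump c s t).
Proof.
move=> x; apply: differentiable_continuous; apply/derivable1_diffP.
by have := @smooth_derivable R _ (@bump_smooth c s t) 0 x; rewrite derive1n0.
Qed.

Lemma test_function_bump (A : set R) c s t : 0 < c -> s <= t ->
  `[s, t + c^-1]%classic `<=` A -> test_function A (bump c s t).
Proof.
move=> c0 st sA; split; first exact: smooth_derivable (bump_smooth c s t).
exists `[s, t + c^-1]%classic; split => //; first exact: segment_compact.
move=> x Kx; apply: bump_outside => //; apply/negP => H; apply: Kx.
by rewrite /= in_itv.
Qed.

Lemma itvint_bump_kernel c s : 0 < c -> itvint (bump_kernel c s) s (s + c^-1) = 1.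
Proof.
move=> c0; have sc : s < s + c^-1 by rewrite ltrDl invr_gt0.
rewrite /itvint /Rintegral.
pose b := s + c^-1; rewrite -/b in sc *.
have E : (\int[leb]_(x in `[s, b]) (bump_kernel c s x)%:E
    = (smooth_step (c * b + - (c * s)))%R%:E - (smooth_step (c * s + - (c * s)))%R%:E)%E.
  apply: (@continuous_FTC2 R (bump_kernel c s) (fun x => smooth_step (c * x + - (c * s)))) => //.
  - by apply: continuous_subspaceT; exact: bump_kernel_continuous.
  - have cts x : {for x, continuous (fun x => smooth_step (c * x + - (c * s)))}.
      apply: differentiable_continuous; apply/derivable1_diffP.
      by have := is_derive_step_affine c s x; case.
    split.
    + by move=> x _; have := is_derive_step_affine c s x; case.
    + exact: cvg_at_right_filter (cts s).
    + exact: cvg_at_left_filter (cts _).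
  - by move=> x _; rewrite derive1E; have := is_derive_step_affine c s x; case.
rewrite E subrr (@smooth_step0 _ 0)// smooth_step1 /=; first by rewrite subr0.
by rewrite /b mulrDr divff ?gt_eqF// addrAC subrr add0r.
Qed.

Lemma bump_kernel_approx f s : continuous f ->
  itvint (fun x => bump_kernel n.+1%:R s x * f x) s (s + n.+1%:R^-1)
    @[n --> \oo] --> f s.
Proof.
move=> cf; have [M M0 HM] := step_slope_bounded.
apply/cvgrPdist_le => e e0.
(* The kernel is at most c * M on a window of length 1/c, so an oscillation e / M of f over that
   window is small enough. *)
have := cf s; move=> /cvgrPdist_le /(_ (e / M) (divr_gt0 e0 M0)) /nbhs_ballP[d /= d0 Hd].
near=> n.
have n0 : 0 < n.+1%:R :> R by rewrite ltr0n.
set c := n.+1%:R : R in n0 *.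
have cd : c^-1 < d.
  rewrite invf_plt ?posrE// (@lt_trans _ _ n%:R)//; last by rewrite ltr_nat.
  by near: n; exact: nbhs_infty_gtr.
have ck := continuous_locint (@bump_kernel_continuous c s).
have ckf : locint (fun x => bump_kernel c s x * f x).
  by apply: continuous_locint => x; apply: continuousM; [exact: bump_kernel_continuous|exact: cf].
rewrite -[f s]mulr1 -(itvint_bump_kernel s n0) -itvintZ// -itvintB//; last exact: locintZ.
have sc : s <= s + c^-1 by rewrite lerDl invr_ge0 ltW.
apply: le_trans (itvint_norm_le (e := c * e) _ sc _) _.
- by apply: locintB => //; exact: locintZ.
- move=> x /andP[sx xc]; rewrite mulrC -mulrBr normrM /bump_kernel normrM (gtr0_norm n0) -mulrA.
  rewrite ler_pM2l//; apply: le_trans (ler_pM _ _ (HM _) (Hd x _)) _ => //.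
    rewrite /ball/= distrC ger0_norm ?subr_ge0//.
    by rewrite (le_lt_trans _ cd)// lerBlDl.
  by rewrite mulrC divfK// gt_eqF.
- by rewrite addrAC subrr add0r mulrA mulVf ?gt_eqF// mul1r.
Unshelve. all: by end_near.
Qed.

(** The half-open interval is exact: the first ramp still vanishes at s, and the second has not
    started at t. Hence equality holds eventually at every point, not only almost everywhere. *)
Lemma bump_cvg s t (x : R) : s <= t ->
  \forall n \near \oo, bump n.+1%:R s t x = \1_(`]s, t]) x.
Proof.
move=> st; rewrite /bump.
have [xs|sx] := leP x s.
  near=> n; have n0 : 0 < n.+1%:R :> R by rewrite ltr0n.
  rewrite !smooth_step0 ?subrr ?indicE ?memNset//=.
  - by rewrite in_itv/= ltNge xs.
  - by rewrite -mulrBr mulr_ge0_le0// ?subr_le0//; lra.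
  - by rewrite -mulrBr mulr_ge0_le0// ?subr_le0//; lra.
have [xt|tx] := leP x t.
  near=> n; have n0 : 0 < n.+1%:R :> R by rewrite ltr0n.
  rewrite smooth_step1 ?smooth_step0 ?subr0 ?indicE ?mem_set//=.
  - by rewrite in_itv/= sx xt.
  - by rewrite -mulrBr mulr_ge0_le0// ?subr_le0//; lra.
  - rewrite -mulrBr; near: n; apply: cvg_natmul_ge1; lra.
near=> n; have n0 : 0 < n.+1%:R :> R by rewrite ltr0n.
rewrite !smooth_step1 ?subrr ?indicE ?memNset//=.
- by rewrite in_itv/= sx/= leNgt tx.
- rewrite -mulrBr; near: n; apply: cvg_natmul_ge1; lra.
- rewrite -mulrBr; near: n; apply: cvg_natmul_ge1; lra.
Unshelve. all: by end_near.
Qed.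

(** Dominated convergence with bound |f|. The integration runs up to b so as to include the second
    ramp, which lies to the right of t; integrability is asked on [s, b] only, since f may be
    controlled only inside I. *)
Lemma itvint_bump_cvg f s t b : s <= t -> t <= b -> leb.-integrable `[s, b] (EFin \o f) ->
  itvint (fun x => bump n.+1%:R s t x * f x) s b @[n --> \oo] --> itvint f s t.
Proof.
move=> st tb fi; have mf : measurable_fun `[s, b] f by apply/measurable_EFinP; exact: measurable_int fi.
have E : itvint f s t = fine (\int[leb]_(x in `[s, b]) (\1_(`]s, t]) x * f x)%:E).
  have fi' : leb.-integrable `]s, t] (EFin \o f).
    by apply: integrableS fi => //; apply: subset_itv; rewrite bnd_simp.
  rewrite /itvint -Rintegral_itv_obnd_cbnd// /Rintegral.
  rewrite [in LHS]integral_mkcond [in RHS]integral_mkcond; congr fine.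
  apply: eq_integral => x _; rewrite !patchE indicE.
  case: ifPn => [|/negbTE xst].
    rewrite !inE/= !in_itv/= => /andP[sx xt].
    by rewrite mem_set/= ?in_itv/= ?(ltW sx) ?(le_trans xt tb)// mul1r.
  by rewrite mul0r; case: ifP.
have i1 : leb.-integrable `[s, b] (fun x => (\1_(`]s, t]) x * f x)%:E).
  apply: le_integrable fi => //.
    by apply/measurable_EFinP/measurable_funM => //; exact: measurable_indic.
  move=> x _; rewrite lee_fin normrM ler_piMl// indicE.
  by case: (_ \in _); rewrite ?normr1 ?normr0.
rewrite E /itvint /Rintegral; apply: fine_cvg; rewrite fineK; last exact: integrable_fin_num i1.
have := @dominated_cvg _ _ _ leb `[s, b]%classic (measurable_itv _)
  (fun n x => (bump n.+1%:R s t x * f x)%:E)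
  (fun x => (\1_(`]s, t]) x * f x)%:E) (fun x => `|f x|%:E).
apply => //.
- move=> n; apply/measurable_EFinP/measurable_funM => //.
  by apply: measurable_funTS; apply: continuous_measurable_fun; exact: bump_continuous.
- move=> x _; apply: cvg_near_cst; near=> n; congr EFin; congr (_ * _).
  by near: n; exact: bump_cvg.
- exact: integrable_norm fi.
- by move=> n x _; rewrite lee_fin normrM ler_piMl// bump_norm.
Unshelve. all: by end_near.
Qed.

Lemma Rintegral_support (D : set R) f a b : `[a, b]%classic `<=` D ->
  (forall x, ~~ (a <= x <= b) -> f x = 0) ->
  \int[leb]_(x in D) f x = itvint f a b.
Proof.
move=> abD f0; rewrite /itvint Rintegral_mkcond [RHS]Rintegral_mkcond.
apply: eq_Rintegral => x _; rewrite !patchE.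
have [xab|xab] := boolP (x \in (`[a, b]%classic : set R)).
  by rewrite mem_set//; apply: abD; exact: set_mem xab.
case: ifP => // _; apply: f0; apply: contra xab => xab.
by rewrite inE/= in_itv.
Qed.

End Bump.

Lemma ae_imply (d : measure_display) (T : measurableType d) (R : realType)
    (mu : {measure set T -> \bar R}) (P Q : T -> Prop) :
  (forall x, P x -> Q x) -> {ae mu, forall x, P x} -> {ae mu, forall x, Q x}.
Proof.
move=> PQ [N [mN N0 sub]]; exists N; split => //.
by apply: subset_trans sub => x /= nQ Px; exact/nQ/PQ.
Qed.

(** * The du Bois-Reymond lemma *)

Section DuBoisReymond.
Context {R : realType}.
Local Notation leb := (@lebesgue_measure R).
Implicit Types (f g : R -> R).

(** Testing with [bump c s t]: as c grows, its derivative tends to evaluation at s minus evaluation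
    at t, and the bump itself to the indicator of (s, t]. The strict inequalities leave room for the
    support [s, t + 1/c]. *)
Lemma test_pairing_itvint (a b s t : R) f g : continuous f -> locint g ->
  (forall phi, test_function `]a, b[%classic phi ->
     \int[leb]_(x in `]a, b[) (derive1 phi x * f x)
     = - \int[leb]_(x in `]a, b[) (phi x * g x)) ->
  a < s -> s <= t -> t < b -> f t - f s = itvint g s t.
Proof.
move=> cf lg H as_ st tb.
have sup n (c := n.+1%:R : R) : t + c^-1 < b ->
    itvint (fun x => bump_kernel c s x * f x) s (s + c^-1)
    - itvint (fun x => bump_kernel c t x * f x) t (t + c^-1)
    = - itvint (fun x => bump c s t x * g x) s b.
  move=> tcb; have c0 : 0 < c by rewrite ltr0n.
  have cV : 0 < c^-1 by rewrite invr_gt0.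
  have sub u v : a < u -> v < b -> (`[u, v]%classic `<=` (`]a, b[%classic : set R)).
    move=> au vb x; rewrite /= !in_itv/= => /andP[ux xv].
    by rewrite (lt_le_trans au ux) (le_lt_trans xv vb).
  have ki u : leb.-integrable `]a, b[ (EFin \o (fun x => bump_kernel c u x * f x)).
    have : locint (fun x => bump_kernel c u x * f x).
      apply: continuous_locint => x.
      by apply: continuousM; [exact: bump_kernel_continuous|exact: cf].
    move=> /(_ a b); apply: integrableS => //; exact: subset_itv_oo_cc.
  have := H _ (test_function_bump c0 st (sub s (t + c^-1) as_ tcb)).
  under eq_Rintegral do rewrite derive1_bump mulrBl.
  rewrite RintegralB//.
  rewrite (@Rintegral_support _ _ _ s (s + c^-1)); last 2 first.
  - by apply: sub => //; apply: le_lt_trans tcb; rewrite lerD2r.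
  - by move=> x xs; rewrite bump_kernel_outside// mul0r.
  rewrite (@Rintegral_support _ _ _ t (t + c^-1)); last 2 first.
  - by apply: sub => //; exact: lt_le_trans st.
  - by move=> x xs; rewrite bump_kernel_outside// mul0r.
  rewrite (@Rintegral_support _ _ _ s (t + c^-1)); last 2 first.
  - by apply: sub.
  - by move=> x xs; rewrite bump_outside// mul0r.
  rewrite -(@Rintegral_support _ `[s, b]%classic _ s (t + c^-1))//.
  - by apply: subset_itv; rewrite bnd_simp// ltW.
  - by move=> x xs; rewrite bump_outside// mul0r.
have L := cvgB (@bump_kernel_approx R f s cf) (@bump_kernel_approx R f t cf).
have Rt := cvgN (itvint_bump_cvg st (ltW tb) (lg s b)).
have {}L := L ltac:(typeclasses eauto); have {}Rt := Rt ltac:(typeclasses eauto).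
have E : f s - f t = - itvint g s t.
  apply: (cvg_unique _ L); first exact: norm_hausdorff.
  apply: cvg_trans Rt; apply: near_eq_cvg; near=> n.
  symmetry; apply: (sup n).
  have : 1 <= n.+1%:R * ((b - t) / 2).
    by near: n; apply: cvg_natmul_ge1; rewrite divr_gt0// subr_gt0.
  rewrite -ler_pdivrMl ?ltr0n// mulr1.
  have : 0 < b - t by rewrite subr_gt0.
  by move: (n.+1%:R^-1) => z; lra.
by rewrite -[RHS]opprK -E opprB.
Unshelve. all: by end_near.
Qed.

(** The endpoints a and b are reached by shrinking [s, t] by d on both sides: continuity of f
    accounts for two errors and absolute continuity of the integral of g for two more, each at most
    e / 4. *)
Lemma du_bois_reymond (a b : R) f g : continuous f -> locint g ->
  (forall phi, test_function `]a, b[%classic phi ->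
     \int[leb]_(x in `]a, b[) (derive1 phi x * f x)
     = - \int[leb]_(x in `]a, b[) (phi x * g x)) ->
  forall s t, a <= s -> s <= t -> t <= b -> f t - f s = itvint g s t.
Proof.
move=> cf lg H s t as_ st tb.
have [->|s_ne_t] := eqVneq s t; first by rewrite subrr itvint_id.
have {s_ne_t}slt : s < t by rewrite lt_neqAle s_ne_t.
apply/eqP; rewrite -subr_eq0 -normr_le0; apply/ler_addgt0Pr => e e0.
have e4 : 0 < e / 4 by rewrite divr_gt0.
have := cf s; move=> /cvgrPdist_le /(_ _ e4) /nbhs_ballP[d1 /= d10 H1].
have := cf t; move=> /cvgrPdist_le /(_ _ e4) /nbhs_ballP[d2 /= d20 H2].
have [d3 d30 H3] := itvint_smallN s t lg e4.
(* The bound (t - s) / 3 keeps s + d <= t - d; halving [d1] and [d2] puts the shifted points inside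
   the open balls. *)
pose d := Num.min (Num.min (d1 / 2) (d2 / 2)) (Num.min d3 ((t - s) / 3)).
have d0 : 0 < d by rewrite !lt_min !divr_gt0 ?d30 ?subr_gt0.
have dd1 : d <= d1 / 2 by rewrite /d !ge_min lexx.
have dd2 : d <= d2 / 2 by rewrite /d !ge_min lexx !orbT.
have dd3 : d <= d3 by rewrite /d !ge_min lexx !orbT.
have dts : d <= (t - s) / 3 by rewrite /d !ge_min lexx !orbT.
have K := test_pairing_itvint cf lg H.
have {K}K : f (t - d) - f (s + d) = itvint g (s + d) (t - d) by apply: K; lra.
rewrite (@itvint_cat _ g s (s + d) t)//; [|lra|lra].
rewrite (@itvint_cat _ g (s + d) (t - d) t)//; [|lra|lra].
rewrite -K.
have {}H1 : `|f s - f (s + d)| <= e / 4.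
  apply: H1; rewrite /ball/= opprD addrA subrr add0r normrN gtr0_norm//; lra.
have {}H2 : `|f t - f (t - d)| <= e / 4.
  apply: H2; rewrite /ball/= opprB addrCA subrr addr0 gtr0_norm//; lra.
have : `|itvint g s (s + d)| <= e / 4 by apply: H3; lra.
have : `|itvint g (t - d) t| <= e / 4 by apply: H3; lra.
move: H1 H2; rewrite !ler_norml; lra.
Qed.

(** Lebesgue's differentiation theorem: at almost every x the primitive from p has derivative f x,
    while the hypothesis makes this primitive constant near x. *)
Lemma itvint0_ae0 (p q : R) f : p < q -> leb.-integrable `[p, q] (EFin \o f) ->
  (forall s t, p < s -> s <= t -> t < q -> itvint f s t = 0) ->
  {ae leb, forall x, p < x < q -> f x = 0}.
Proof.
move=> pq fi H; pose g := f \_ `[p, q].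
have gi : leb.-integrable setT (EFin \o g).
  by rewrite /g -restrict_EFin; apply: (integrable_mkcond _ _).1 fi.
have lg := locint_integrable gi.
have := @FTC1 R g (BLeft p) (fun y => lg p y) (integrable_locally (measurable_itv _) fi).
apply: ae_imply => x Hx /andP[px xq].
have [|_] := Hx; first by rewrite /= lte_fin.
rewrite /g patchE mem_set/=; last by rewrite in_itv/= !ltW.
move=> <-; rewrite derive1E (@near_eq_derive _ _ _ _ (cst (itvint g p x))) ?derive_cst//.
have gE s t : p < s -> s <= t -> t < q -> itvint g s t = 0.
  move=> ps st tq; rewrite -(H s t)//; apply: eq_itvint => y /andP[sy yt].
  by rewrite /g patchE mem_set//= in_itv/= (ltW (lt_le_trans ps sy)) (ltW (le_lt_trans yt tq)).
near=> y; rewrite -/(itvint g p y) /cst.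
have py : p < y by near: y; exact: lt_nbhsr.
have yq : y < q by near: y; exact: lt_nbhsl.
have [xy|/ltW yx] := leP x y.
  by rewrite (@itvint_cat _ g p x y)// ?ltW// (gE _ _ px xy yq) addr0.
by rewrite (@itvint_cat _ g p y x)// ?ltW// (gE _ _ py yx xq) addr0.
Unshelve. all: by end_near.
Qed.

Variable L : \bar R.

Lemma itvint_mu_I f (a b : R) : `[a, b]%classic `<=` interval_I L ->
  \int[mu_I L]_(x in `[a, b]) f x = itvint f a b.
Proof.
move=> sub; rewrite /itvint /Rintegral; congr fine.
apply: eq_measure_integral => A mA AD.
have AI : A `<=` interval_I L by exact: subset_trans sub.
by rewrite -[in RHS](setIidl AI).
Qed.

Lemma integrable_mu_I f (a b : R) : `[a, b]%classic `<=` interval_I L ->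
  (mu_I L).-integrable `[a, b] (EFin \o f) -> leb.-integrable `[a, b] (EFin \o f).
Proof.
move=> sub /integrableP[mf fi]; apply/integrableP; split => //.
rewrite (@eq_measure_integral _ _ _ _ (mu_I L))// => A mA AD.
have AI : A `<=` interval_I L by exact: subset_trans sub.
by rewrite -[in LHS](setIidl AI).
Qed.

Lemma interval_I_segment (a b : R) : interval_I L a -> interval_I L b ->
  `[a, b]%classic `<=` interval_I L.
Proof.
move=> [a1 _] [_ b2] x; rewrite /= in_itv/= => /andP[ax xb]; split.
  by rewrite (lt_le_trans a1)// lee_fin.
by rewrite (le_lt_trans _ b2)// lee_fin.
Qed.

Lemma interval_I_nbhs (x : R) : interval_I L x ->
  exists2 r : R, 0 < r & forall y, x - r < y < x + r -> interval_I L y.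
Proof.
rewrite /interval_I; case: L => [l| |] //= [].
- rewrite !lte_fin => lx xl; exists (Num.min (x + l) (l - x)).
    by rewrite lt_min; apply/andP; split; lra.
  move=> y /andP[]; rewrite -ltrBlDl => /[swap]; rewrite lt_min => /andP[y1 y2].
  rewrite ltrBlDr -ltrBlDl lt_min => /andP[y3 y4].
  by rewrite !lte_fin; split; lra.
- by move=> _ _; exists 1 => // y _; rewrite ltNyr ltry.
- by move=> _; rewrite ltNge leNye.
Qed.

(** The fundamental lemma of the calculus of variations on I. Bumps are admissible test functions,
    and in the limit all integrals of f over segments of I vanish. *)
Lemma weak_derivative0_ae0 f : measurable_fun setT f ->
  (forall a b, `[a, b]%classic `<=` interval_I L ->
     (mu_I L).-integrable `[a, b] (EFin \o f)) ->
  (forall phi, test_function (interval_I L) phi -> \int[mu_I L]_x (f x * phi x) = 0) ->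
  f = 0 %[ae mu_I L].
Proof.
move=> mf fi H.
have K0 s t : interval_I L s -> s <= t -> interval_I L t -> itvint f s t = 0.
  move=> Is st It; have [r r0 Hr] := interval_I_nbhs It.
  pose b := t + r / 2; have Ib : interval_I L b by apply: Hr; rewrite /b; apply/andP; split; lra.
  have tb : t < b by rewrite /b; lra.
  have sub := interval_I_segment Is Ib.
  have lim := itvint_bump_cvg st (ltW tb) (integrable_mu_I sub (fi _ _ sub)).
  apply: (cvg_unique _ lim); first exact: norm_hausdorff.
  apply: cvg_near_cst; near=> n.
  have cr : 1 <= n.+1%:R * (r / 2) by near: n; apply: cvg_natmul_ge1; lra.
  set c := n.+1%:R : R in cr *.
  have c0 : 0 < c by rewrite ltr0n.
  have tcb : t + c^-1 <= b.
    by move: cr; rewrite -ler_pdivrMl// mulr1 /b lerD2l.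
  have sub' : `[s, t + c^-1]%classic `<=` interval_I L.
    by apply: subset_trans sub; apply: subset_itv; rewrite bnd_simp.
  rewrite -(itvint_mu_I _ sub) -(H _ (test_function_bump c0 st sub')).
  rewrite Rintegral_mkcond; apply: eq_Rintegral => x _; rewrite patchE mulrC.
  case: ifPn => // xsb; rewrite bump_outside ?mulr0//.
  apply: contra xsb => /andP[sx xt]; rewrite inE/= in_itv/= sx/=; exact: le_trans tcb.
(* I is covered by the countably many intervals with rational endpoints in I, enumerated through
   [unpickle]; the null sets can then be united, for L finite or infinite alike. *)
pose P n x := forall p q : rat, unpickle n = Some (p, q) ->
  interval_I L (ratr p) -> interval_I L (ratr q) -> (ratr p : R) < x < ratr q -> f x = 0.
have : {ae leb, forall x, forall n, P n x}.
  apply: ae_foralln => n; rewrite /P.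
  case: (unpickle n) => [[p q]|]; last by apply: nearW => x p q.
  have [pq|pq] := ltP (ratr p : R) (ratr q : R); last first.
    by apply: nearW => x p' q' [<- <-] _ _ /andP[px /(lt_trans px)]; rewrite ltNge pq.
  have [Ip|Ip] := pselect (interval_I L (ratr p)); last by apply: nearW => x p' q' [<- _].
  have [Iq|Iq] := pselect (interval_I L (ratr q)); last by apply: nearW => x p' q' [_ <-].
  have sub := interval_I_segment Ip Iq.
  have : {ae leb, forall x, ratr p < x < ratr q -> f x = 0}.
    apply: (itvint0_ae0 pq (integrable_mu_I sub (fi _ _ sub))) => s t ps st tq.
    apply: K0 => //; apply: sub; rewrite /= in_itv/=; apply/andP; split; apply: ltW => //.
      exact: le_lt_trans tq.
    exact: lt_le_trans st.
  by apply: ae_imply => x Hx p' q' [<- <-].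
case=> N [mN N0 subN]; exists (N `|` ~` interval_I L); split.
- by apply: measurableU => //; apply: measurableC; exact: measurable_interval_I.
- change (leb ((N `|` ~` interval_I L) `&` interval_I L) = 0%E).
  rewrite setIUl setICl setU0; apply: subset_measure0 N0 => //.
  by apply: measurableI => //; exact: measurable_interval_I.
- move=> x /= fx; have [Ix|Ix] := pselect (interval_I L x); last by right.
  left; apply: subN => /= Hx; apply: fx => _.
  have [r r0 Hr] := interval_I_nbhs Ix.
  have [p] := rat_in_itvoo (ltac:(lra) : x - r < x); rewrite in_itv/= => /andP[p1 p2].
  have [q] := rat_in_itvoo (ltac:(lra) : x < x + r); rewrite in_itv/= => /andP[q1 q2].
  apply: (Hx (pickle (p, q)) p q); rewrite ?pickleK//.
  - by apply: Hr; rewrite p1 (lt_trans p2)//; lra.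
  - by apply: Hr; rewrite q2 andbT (lt_trans _ q1)//; lra.
  - by rewrite p2 q1.
Unshelve. all: by end_near.
Qed.

End DuBoisReymond.

(** * Energy spaces *)

Section EnergySpace.
Context {R : realType} (L : \bar R).
Local Notation leb := (@lebesgue_measure R).
Local Notation mu := (mu_I L).
Implicit Types u v w phi : R -> R.

Lemma mu_I_itv_lty (a b : R) : (mu `[a, b]%classic < +oo)%E.
Proof.
change (leb (`[a, b]%classic `&` interval_I L) < +oo)%E.
apply: (@le_lt_trans _ _ (leb (`[a, b]%classic : set R))).
  apply: le_measure; rewrite ?inE//; apply: measurableI => //.
  exact: measurable_interval_I.
by rewrite /= lebesgue_measure_itv/=; case: ifP => _; rewrite ?ltry// -EFinB ltry.
Qed.

Lemma continuous_compact_support_L2 (K : set R) h : continuous h -> compact K ->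
  (forall x, ~ K x -> h x = 0) -> L2_I L h.
Proof.
move=> ch cK hK; apply/L2_IP.
have mh := continuous_measurable_fun ch.
split => //.
have [M [_ HM]] := compact_bounded cK.
pose m : R := `|M| + 1.
have Km x : K x -> -m <= x <= m.
  move=> Kx; rewrite -ler_norml; apply: HM => //.
  by rewrite /m ltr_pwDr// ler_norm.
have mm : - m <= m by rewrite ge0_cp// /m addr_ge0.
have cn : {within `[-m, m], continuous (fun x => `|h x ^+ 2|)}.
  by apply: continuous_subspaceT => x; apply: cvg_norm; exact: (cvgM (ch x) (ch x)).
have [c _ Hc] := EVT_max mm cn.
have i1 : mu.-integrable `[-m, m] (EFin \o (fun x => h x ^+ 2)).
  apply: measurable_bounded_integrable => //.
  - exact: mu_I_itv_lty.
  - by apply: measurable_funTS; exact: measurable_funX.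
  - exists `|h c ^+ 2|; split; first exact: num_real.
    by move=> y hy x /= /Hc /le_trans; apply; exact: ltW.
have -> : EFin \o (fun x => h x ^+ 2) = (EFin \o (fun x => h x ^+ 2)) \_ `[-m, m].
  apply/funext => x; rewrite patchE; case: ifPn => // xm /=.
  rewrite hK ?expr0n// => /Km xm'; move: xm; rewrite notin_setE/= in_itv/=; exact.
by apply: (integrable_mkcond _ _).1 i1.
Qed.

Lemma test_function_L2 (A : set R) phi : test_function A phi -> L2_I L phi.
Proof.
move=> [dphi [K [cK KA Kphi]]]; apply: (continuous_compact_support_L2 _ cK Kphi) => x.
apply: differentiable_continuous; apply/derivable1_diffP.
by have := dphi 0%N x; rewrite derive1n0.
Qed.

Lemma test_function_derive1_L2 (A : set R) phi : test_function A phi ->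
  L2_I L (derive1 phi).
Proof.
move=> [dphi [K [cK KA Kphi]]]; apply: (continuous_compact_support_L2 (K := K)) => //.
  move=> x; apply: differentiable_continuous; apply/derivable1_diffP.
  by have := dphi 1%N x; rewrite derive1n1.
move=> x Kx; rewrite derive1E (@near_eq_derive _ _ _ _ (cst 0)) ?derive_cst//.
have oK : open (~` K) by apply: closed_openC; exact: compact_closed.
have : nbhs x (~` K) by exact: open_nbhs_nbhs.
by apply: filterS => y Ky; rewrite Kphi.
Qed.

Lemma L2_I_integrable_itv u (a b : R) : L2_I L u -> mu.-integrable `[a, b] (EFin \o u).
Proof.
move=> /L2_IP[mu_ iu].
have i1 : mu.-integrable `[a, b] (EFin \o cst (1 : R)).
  apply: measurable_bounded_integrable => //; first exact: mu_I_itv_lty.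
  by exists 1; split; [exact: num_real|move=> y y1 x _; rewrite /= normr1 ltW].
have i2 : mu.-integrable `[a, b] (EFin \o (fun x => u x ^+ 2)).
  by apply: integrableS iu.
apply: le_integrable (integrableD _ i1 i2) => //.
  by apply/measurable_EFinP; apply: measurable_funTS.
move=> x _ /=; rewrite lee_fin [leRHS]ger0_norm ?addr_ge0 ?sqr_ge0//.
rewrite -(real_normK (num_real (u x))); have := normr_ge0 (u x).
by move: `|u x| => z; nra.
Qed.

Lemma ipH_aer u v w : L2_I L u -> L2_I L v -> L2_I L w -> u = v %[ae mu] ->
  ipH L u w = ipH L v w.
Proof.
move=> Lu Lv Lw uv; apply/eqP; rewrite -subr_eq0; apply/eqP.
rewrite -(si_Bl (ipH_semi_inner L) (@L2_I0 R L))//.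
apply: ipH_ae0 => //; first exact: (si_B (ipH_semi_inner L) (@L2_I0 R L)).
by apply: ae_imply uv => x + _ => /(_ I) /= uvx; rewrite /= !fctE uvx subrr.
Qed.

Lemma weak_derivative_unique u w1 w2 : L2_I L w1 -> L2_I L w2 ->
  is_weak_derivative L u w1 -> is_weak_derivative L u w2 -> w1 = w2 %[ae mu].
Proof.
move=> L1 L2 H1 H2.
have Lw : L2_I L ((w1 : R -> R^o) - w2) by exact: (si_B (ipH_semi_inner L) (@L2_I0 R L)).
have : ((w1 : R -> R^o) - w2) = 0 %[ae mu].
  apply: weak_derivative0_ae0.
  - exact: L2_I_measurable Lw.
  - by move=> a b _; exact: L2_I_integrable_itv.
  - move=> phi tphi; have Lphi := test_function_L2 tphi.
    rewrite -[LHS]/(ipH L ((w1 : R -> R^o) - w2) phi).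
    rewrite (si_Bl (ipH_semi_inner L) (@L2_I0 R L))//.
    by apply/eqP; rewrite subr_eq0 -eqr_opp /ipH -H1// -H2.
by apply: ae_imply => x + _ => /(_ I) /eqP; rewrite !fctE subr_eq0 => /eqP.
Qed.

Lemma weak_derivativeP u : H1_I L u ->
  L2_I L (weak_derivative L u) /\ is_weak_derivative L u (weak_derivative L u).
Proof.
move=> [_ [w Hw]]; rewrite /weak_derivative.
exact: (@xgetPex _ (cst 0) [set w | L2_I L w /\ is_weak_derivative L u w] (ex_intro _ w Hw)).
Qed.

Lemma H1_I_L2 u : H1_I L u -> L2_I L u. Proof. by case. Qed.

Lemma is_weak_derivative_lin r u v w1 w2 : L2_I L u -> L2_I L v ->
  L2_I L w1 -> L2_I L w2 -> is_weak_derivative L u w1 ->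
  is_weak_derivative L v w2 ->
  is_weak_derivative L (fun x => r * u x + v x) (fun x => r * w1 x + w2 x).
Proof.
move=> Lu Lv L1 L2 H1 H2 phi tphi.
have Lphi := test_function_L2 tphi; have Ldphi := test_function_derive1_L2 tphi.
rewrite -[LHS]/(ipH L (fun x => r * u x + v x) (derive1 phi)).
rewrite -[in RHS]/(ipH L (fun x => r * w1 x + w2 x) phi).
by rewrite !(si_l (ipH_semi_inner L))// /ipH H1// H2//; lra.
Qed.

(** [weak_derivative] chooses a representative, so it is linear only up to a.e. equality; pairing
    with an L^2 function hides the choice. *)
Lemma ipH_weak_derivative_lin r u v z : H1_I L u -> H1_I L v ->
  H1_I L (fun x => r * u x + v x) -> L2_I L z ->
  ipH L (weak_derivative L (fun x => r * u x + v x)) z =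
  r * ipH L (weak_derivative L u) z + ipH L (weak_derivative L v) z.
Proof.
move=> Hu Hv Huv Lz.
have [L1 D1] := weak_derivativeP Hu; have [L2 D2] := weak_derivativeP Hv.
have [L3 D3] := weak_derivativeP Huv.
rewrite -(si_l (ipH_semi_inner L))//; apply: ipH_aer => //; first exact: L2_I_lin.
apply: weak_derivative_unique D3 _ => //; first exact: L2_I_lin.
by apply: is_weak_derivative_lin => //; exact: H1_I_L2.
Qed.

Variables (V : set (R -> R)) (ip : (R -> R) -> (R -> R) -> R).
Hypothesis hV : is_energy_space L V ip.

Lemma energy_L2 u : V u -> L2_I L u.
Proof. by move=> /(es_H1 hV) /H1_I_L2. Qed.

(** The zero function is a test function with empty support; stability of V under linear
    combinations would not by itself show that V is nonempty. *)
Lemma energy0 : V (0 : R -> R^o).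
Proof.
apply: (es_test hV); split; last by exists set0; split => //; exact: compact0.
move=> n x; elim: n => [|n IH]; first by rewrite derive1n0; exact: derivable_cst.
rewrite derive1Sn (_ : derive1 _ = 0)//.
by apply/funext => y; rewrite derive1E derive_cst.
Qed.

Lemma ipH1_ge0 u : 0 <= ipH1 L u u.
Proof.
by rewrite addr_ge0//; apply: Rintegral_ge0 => x _; rewrite -expr2 sqr_ge0.
Qed.

Lemma ip_semi_inner : @semi_inner R (R -> R^o) V ip.
Proof.
split.
- exact: (es_lin hV).
- exact: (es_ipC hV).
- exact: (es_ipl hV).
- move=> u Vu; have [c1 [c2 [c10 c20 H]]] := es_equiv hV.
  have [H1 _] := H u Vu; apply: le_trans H1.
  by rewrite mulr_ge0 ?ipH1_ge0// ltW.
Qed.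

(** Lets [a] itself serve as the inner product of V in the energy argument. Coercivity supplies
    positivity, and it is used again at the end to return to the norm of [ip]. *)
Lemma form_a_semi_inner kappa :
  (exists2 c0 : R, 0 < c0 &
     forall u, V u -> c0 * ip_norm ip u ^+ 2 <= form_a L kappa u u) ->
  @semi_inner R (R -> R^o) V (form_a L kappa).
Proof.
move=> [c0 c00 H]; split.
- exact: (es_lin hV).
- move=> u v Vu Vv; have Hu := es_H1 hV Vu; have Hv := es_H1 hV Vv.
  have [L1 _] := weak_derivativeP Hu; have [L2 _] := weak_derivativeP Hv.
  rewrite /form_a (si_C (ipH_semi_inner L) L1)//.
  by rewrite (si_C (ipH_semi_inner L) (energy_L2 Vu))//; exact: energy_L2.
- move=> r u v w Vu Vv Vw.
  have [Lw _] := weak_derivativeP (es_H1 hV Vw).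
  have [Hu Hv] := (es_H1 hV Vu, es_H1 hV Vv).
  have Huv := es_H1 hV (es_lin hV r Vu Vv).
  rewrite /form_a (ipH_weak_derivative_lin Hu Hv Huv Lw).
  rewrite (si_l (ipH_semi_inner L) r (energy_L2 Vu) (energy_L2 Vv) (energy_L2 Vw)).
  move: (ipH L _ _) (ipH L _ _) (ipH L _ _) (ipH L _ _) => x1 x2 x3 x4.
  by rewrite !mulrDr (mulrCA kappa r) addrACA.
- by move=> u Vu; apply: le_trans (H u Vu); rewrite mulr_ge0 ?sqr_ge0// ltW.
Qed.

Lemma ip_eq0_ae u : V u -> ip u u = 0 -> u = 0 %[ae mu].
Proof.
move=> Vu u0; have [c1 [c2 [c10 c20 H]]] := es_equiv hV.
have [H1 _] := H u Vu; move: H1; rewrite u0 pmulr_rle0// => H1.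
apply: ipH_eq0 (energy_L2 Vu) _; apply/eqP; rewrite eq_le.
rewrite (si_ge0 (ipH_semi_inner L) (energy_L2 Vu)) andbT.
apply: le_trans H1; rewrite lerDl.
by apply: Rintegral_ge0 => x _; rewrite -expr2 sqr_ge0.
Qed.

(** An a.e. zero function has 0 as a weak derivative, so its H^1 norm vanishes, and the equivalence
    of norms carries this to [ip]. This makes initial conditions stated a.e. usable in V. *)
Lemma ae0_ip_eq0 u : V u -> u = 0 %[ae mu] -> ip u u = 0.
Proof.
move=> Vu u0; have [c1 [c2 [c10 c20 H]]] := es_equiv hV.
have [_ H1] := H u Vu; apply/eqP; rewrite eq_le (si_ge0 ip_semi_inner Vu) andbT.
apply: le_trans H1 _; rewrite /ipH1 (ipH_ae0 (energy_L2 Vu) (energy_L2 Vu) u0) add0r.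
have [Lw Dw] := weak_derivativeP (es_H1 hV Vu).
rewrite (@ipH_ae0 _ _ (weak_derivative L u))//; first by rewrite mulr0.
apply: weak_derivative_unique Dw _ => //; first exact: L2_I0.
move=> phi tphi; have Ldphi := test_function_derive1_L2 tphi.
rewrite -[LHS]/(ipH L u (derive1 phi)) (ipH_ae0 (energy_L2 Vu) Ldphi u0).
rewrite -[in RHS]/(ipH L (0 : R -> R^o) phi) (si_0l (ipH_semi_inner L) (@L2_I0 R L)) ?oppr0//.
exact: test_function_L2 tphi.
Qed.

Lemma ipH_le_ip : exists2 c : R, 0 < c & forall u, V u -> ipH L u u <= c * ip u u.
Proof.
have [c1 [c2 [c10 c20 H]]] := es_equiv hV.
exists c1^-1 => [|u Vu]; first by rewrite invr_gt0.
have [H1 _] := H u Vu; rewrite ler_pdivlMl//; apply: le_trans H1.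
rewrite ler_pM2l// lerDl.
by apply: Rintegral_ge0 => x _; rewrite -expr2 sqr_ge0.
Qed.

End EnergySpace.

(** * Bochner integrals and bounded functionals *)

Section BochnerPairing.
Context {R : realType}.
Local Notation leb := (@lebesgue_measure R).

(* No measurability is required, as the norm of V^* of a strongly measurable
   function is not known to be measurable. *)
Lemma ge0_le_integralW d (T : measurableType d) (mu : {measure set T -> \bar R})
    (D : set T) (f g : T -> \bar R) :
  (forall x, D x -> 0 <= f x)%E -> (forall x, D x -> f x <= g x)%E ->
  (\int[mu]_(x in D) f x <= \int[mu]_(x in D) g x)%E.
Proof.
move=> f0 fg; have g0 x : D x -> (0 <= g x)%E by move=> Dx; exact: le_trans (f0 _ Dx) (fg _ Dx).
rewrite !ge0_integralE//; apply: le_ereal_sup => _ [h hf <-]; exists h => // x.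
apply: le_trans (hf x) _; rewrite !patchE; case: ifPn => // /set_mem; exact: fg.
Qed.

Variable X : nspace R.

(** [nspace] carries no axioms, so the stability of its members under linear combinations is bundled
    with the functional. The instances are u |-> (u, v) on H and evaluation at v on V^*. *)
Record bounded_functional (l : X -> R) : Prop := BoundedFunctional {
  bf_mem0 : ns_mem (0 : X) ;
  bf_mem : forall r (u v : X), ns_mem u -> ns_mem v -> ns_mem (r *: u + v) ;
  bf_lin : forall r (u v : X), ns_mem u -> ns_mem v -> l (r *: u + v) = r * l u + l v ;
  bf_bound : exists2 C, 0 < C & forall u, ns_mem u -> `|l u| <= C * ns_norm u }.

Variable l : X -> R.
Hypothesis hl : bounded_functional l.

Lemma bf0 : l 0 = 0.
Proof.
have := bf_lin hl 1 (bf_mem0 hl) (bf_mem0 hl); rewrite scale1r addr0 mul1r => H.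
by apply: (addrI (l 0)); rewrite addr0 -H.
Qed.

Lemma bf_memZ r (u : X) : ns_mem u -> ns_mem (r *: u).
Proof. by move=> mu; rewrite -[_ *: _]addr0; apply: (bf_mem hl) => //; exact: (bf_mem0 hl). Qed.

Lemma bfZ r (u : X) : ns_mem u -> l (r *: u) = r * l u.
Proof. by move=> mu; rewrite -[_ *: _]addr0 (bf_lin hl)// ?bf0 ?addr0//; exact: (bf_mem0 hl). Qed.

Lemma bf_memB (u v : X) : ns_mem u -> ns_mem v -> ns_mem (u - v).
Proof. by move=> mu mv; rewrite addrC -scaleN1r; exact: (bf_mem hl). Qed.

Lemma bfB (u v : X) : ns_mem u -> ns_mem v -> l (u - v) = l u - l v.
Proof. by move=> mu mv; rewrite addrC -scaleN1r (bf_lin hl)// mulN1r addrC. Qed.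

Lemma step_wf_cons (p : set R * X) (s : step X) : step_wf (p :: s) ->
  [/\ measurable p.1, ns_mem p.2 & step_wf s].
Proof.
move=> H; have [H1 H2] := H 0%N isT; split => // k ks; exact: (H k.+1).
Qed.

Lemma step_val_cons (p : set R * X) (s : step X) t :
  step_val (p :: s) t = (\1_(p.1) t : R) *: p.2 + step_val s t.
Proof. by rewrite /step_val big_cons. Qed.

Lemma step_int_cons D (p : set R * X) (s : step X) :
  step_int D (p :: s) = fine (leb (D `&` p.1)) *: p.2 + step_int D s.
Proof. by rewrite /step_int big_cons. Qed.

Lemma step_val_mem s t : step_wf s -> ns_mem (step_val (X := X) s t).
Proof.
elim: s => [_|p s IH /step_wf_cons[mp np ws]].
  by rewrite /step_val big_nil; exact: (bf_mem0 hl).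
by rewrite step_val_cons; apply: (bf_mem hl) => //; exact: IH.
Qed.

Lemma step_int_mem D s : step_wf s -> ns_mem (step_int (X := X) D s).
Proof.
elim: s => [_|p s IH /step_wf_cons[mp np ws]].
  by rewrite /step_int big_nil; exact: (bf_mem0 hl).
by rewrite step_int_cons; apply: (bf_mem hl) => //; exact: IH.
Qed.

Lemma measurable_step s D : step_wf s ->
  measurable_fun D (fun t => l (step_val (X := X) s t)).
Proof.
elim: s => [_|p s IH /step_wf_cons[mp np ws]].
  rewrite (_ : (fun t => _) = cst 0); first exact: measurable_cst.
  by apply/funext => t; rewrite /step_val big_nil bf0.
rewrite (_ : (fun t => _) = (fun t => \1_(p.1) t * l p.2 + l (step_val s t))); last first.
  by apply/funext => t; rewrite step_val_cons (bf_lin hl)//; exact: step_val_mem.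
apply: measurable_funD; last exact: IH.
by apply: measurable_funM => //; apply: measurable_indic.
Qed.

Lemma integral_step s D : measurable D -> (leb D < +oo)%E -> step_wf s ->
  leb.-integrable D (EFin \o (fun t => l (step_val (X := X) s t))) /\
  \int[leb]_(t in D) l (step_val s t) = l (step_int D s).
Proof.
move=> mD fD; elim: s => [_|p s IH /step_wf_cons[mp np ws]].
  rewrite (_ : (fun t => _) = cst 0); last first.
    by apply/funext => t; rewrite /step_val big_nil bf0.
  rewrite /step_int big_nil bf0; split; first exact: integrable0.
  by rewrite Rintegral_cst// mul0r.
have [i1 e1] := IH ws.
have E : (fun t => l (step_val (p :: s) t)) = (fun t => l p.2 * \1_(p.1) t + l (step_val s t)).
  by apply/funext => t; rewrite step_val_cons (bf_lin hl) ?(mulrC (l _))//; exact: step_val_mem.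
have ip : leb.-integrable D (EFin \o \1_(p.1)).
  apply: measurable_bounded_integrable => //.
  exists 1; split; first exact: num_real.
  by move=> y y1 t _ /=; rewrite indicE; case: (_ \in _); rewrite /= ?normr1 ?normr0;
    apply: ltW => //; exact: lt_trans y1.
have i2 : leb.-integrable D (EFin \o (fun t => l p.2 * \1_(p.1) t)).
  exact: (integrableZl _ _ ip).
rewrite E; split; first exact: (integrableD _ i2 i1).
rewrite RintegralD// RintegralZl// e1 step_int_cons (bf_lin hl)//; last exact: step_int_mem.
rewrite mulrC; congr (_ * _ + _).
by rewrite /Rintegral integral_indic// setIC.
Qed.

Variable D : set R.
Hypothesis (mD : measurable D) (fD : (leb D < +oo)%E).

Lemma measurable_pairing (f : R -> X) : (forall t, D t -> ns_mem (f t)) ->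
  strongly_measurable D f -> measurable_fun D (l \o f).
Proof.
move=> fm [s_ [ws H]]; have [C C0 HC] := bf_bound hl.
apply: (@measurable_fun_cvg _ _ R D (fun n t => l (step_val (s_ n) t))) => [n|t Dt].
  exact: measurable_step.
have L : C * ns_norm (f t - step_val (s_ n) t) @[n --> \oo] --> (0 : R).
  by rewrite -[0 in X in _ --> X](mulr0 C); apply: cvgM (H t Dt); exact: cvg_cst.
apply/cvgrPdist_le => e e0; move/cvgrPdist_le : L => /(_ _ e0); apply: filterS => n.
rewrite sub0r normrN => He; have ms := step_val_mem t (ws n).
rewrite /= -bfB//; last exact: fm.
apply: le_trans (HC _ (bf_memB (fm _ Dt) ms)) _.
by apply: le_trans He; exact: ler_norm.
Qed.

(** Bounded functionals commute with the Bochner integral, since they do so on step functions.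
    Integrability of [l \o f] is part of the conclusion: it is the sum of an integrable error and of
    [l] applied to one close step function. *)
Lemma bochner_pairing (f : R -> X) (x : X) : (forall t, D t -> ns_mem (f t)) ->
  is_bochner_integral D f x ->
  leb.-integrable D (EFin \o (l \o f)) /\ \int[leb]_(t in D) l (f t) = l x.
Proof.
move=> fm [xm sm [s_ [ws H1 H2]]]; have [C C0 HC] := bf_bound hl.
have mf := measurable_pairing fm sm.
have mg n : measurable_fun D (fun t => l (f t) - l (step_val (s_ n) t)).
  by apply: measurable_funB => //; exact: measurable_step.
have small e : 0 < e -> \forall n \near \oo,
    leb.-integrable D (EFin \o (fun t => l (f t) - l (step_val (s_ n) t))) /\
    `|\int[leb]_(t in D) (l (f t) - l (step_val (s_ n) t))| <= e.
  move=> e0; have eC : 0 < e / C by rewrite divr_gt0.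
  have : \forall n \near \oo, (\int[leb]_(t in D) (ns_norm (f t - step_val (s_ n) t))%:E < (e / C)%:E)%E.
    have : nbhs (0 : \bar R) [set y | (y < (e / C)%:E)%E].
      by apply: open_nbhs_nbhs; split; [exact: open_ereal_lt_ereal|rewrite /= lte_fin].
    by move/H1.
  apply: filterS => n Hn.
  (* The constant is moved to the scalar side before integrating: the norm of the error may be
     nonmeasurable, and no constant can be taken out of its integral. *)
  have le1 : (\int[leb]_(t in D) (C^-1 * `|l (f t) - l (step_val (s_ n) t)|)%:E < (e / C)%:E)%E.
    apply: le_lt_trans Hn; apply: ge0_le_integralW.
      by move=> t _; rewrite lee_fin mulr_ge0// invr_ge0 ltW.
    move=> t Dt; have ms := step_val_mem t (ws n).
    rewrite lee_fin -bfB//; last exact: fm.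
    rewrite ler_pdivrMl//; apply: HC; exact: bf_memB (fm _ Dt) ms.
  have i1 : leb.-integrable D (EFin \o (fun t => C^-1 * `|l (f t) - l (step_val (s_ n) t)|)).
    apply/integrableP; split.
      by apply/measurable_EFinP; apply: measurable_funM => //; apply: measurableT_comp => //; exact: mg.
    apply: le_lt_trans (lt_trans le1 (ltry _)); apply: ge0_le_integralW.
      by move=> t _; exact: abse_ge0.
    by move=> t _ /=; rewrite lee_fin ger0_norm// mulr_ge0// invr_ge0 ltW.
  have i2 : leb.-integrable D (EFin \o (fun t => `|l (f t) - l (step_val (s_ n) t)|)).
    apply: eq_integrable (integrableZl _ C i1) => // t _ /=.
    by rewrite -EFinM mulrA divff ?gt_eqF// mul1r.
  have i3 : leb.-integrable D (EFin \o (fun t => l (f t) - l (step_val (s_ n) t))).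
    apply: le_integrable i2 => //; first by apply/measurable_EFinP; exact: mg.
    by move=> t _ /=; rewrite normr_id.
  split => //; have {}i3 := @le_normr_Rintegral _ _ _ leb D _ mD i3; apply: (le_trans i3).
  rewrite -[X in _ <= X](divfK (lt0r_neq0 C0)) -ler_pdivrMr//.
  rewrite mulrC -RintegralZl//.
  have f1 := @integrable_fin_num _ _ _ leb D mD _ i1.
  by rewrite -lee_fin /Rintegral fineK// ltW.
have fi : leb.-integrable D (EFin \o (l \o f)).
  have := small 1 ltr01 => /filter_ex [n [i1 _]].
  have [i2 _] := integral_step mD fD (ws n).
  apply: eq_integrable (integrableD _ i1 i2) => // t _ /=.
  by rewrite -EFinD subrK.
split => //; apply/eqP; rewrite -subr_eq0 -normr_le0; apply/ler_addgt0Pr => e e0.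
rewrite add0r; have e2 : 0 < e / 2 by rewrite divr_gt0.
have eC : 0 < e / 2 / C by rewrite divr_gt0.
have H2' : \forall n \near \oo, `|ns_norm (x - step_int D (s_ n))| <= e / 2 / C.
  by move/cvgrPdist_le : H2 => /(_ _ eC); apply: filterS => n; rewrite sub0r normrN.
have [n [[i1 Hn] Hx]] := filter_ex (filterI (small _ e2) H2').
have [i2 E2] := integral_step mD fD (ws n).
move: Hn; rewrite RintegralB// E2 => Hn.
have : `|l x - l (step_int D (s_ n))| <= e / 2.
  have ms := step_int_mem D (ws n).
  rewrite -bfB//; apply: le_trans (HC _ (bf_memB xm ms)) _.
  rewrite mulrC -ler_pdivlMr//; apply: le_trans Hx; exact: ler_norm.
move: Hn; rewrite !ler_norml; lra.
Qed.

End BochnerPairing.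

(** Turns a vector-valued distributional derivative into the scalar identities that
    [du_bois_reymond] takes as hypothesis. *)
Lemma time_derivative_pairing (R : realType) (X : nspace R) (l : X -> R) (T : R)
    (f g : R -> X) : bounded_functional l ->
  (forall t, `]0, T[%classic t -> ns_mem (f t)) ->
  (forall t, `]0, T[%classic t -> ns_mem (g t)) ->
  is_time_derivative T f g ->
  forall phi, test_function `]0, T[%classic phi ->
    \int[@lebesgue_measure R]_(t in `]0, T[) (derive1 phi t * l (f t))
    = - \int[@lebesgue_measure R]_(t in `]0, T[) (phi t * l (g t)).
Proof.
move=> hl fm gm H phi /H[y [y1 y2]].
have fin : (@lebesgue_measure R `]0%R, T[%classic < +oo)%E.
  by rewrite lebesgue_measure_itv/=; case: ifP => _; rewrite ?ltry// -EFinB ltry.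
have [_] := bochner_pairing hl (measurable_itv _) fin (fun t Dt => bf_memZ hl (derive1 phi t) (fm t Dt)) y1.
have [_] := bochner_pairing hl (measurable_itv _) fin (fun t Dt => bf_memZ hl (phi t) (gm t Dt)) y2.
have ym : ns_mem y by case: y1.
rewrite -[X in l X]sub0r bfB// ?bf0// ?sub0r; last exact: (bf_mem0 hl).
have -> : \int[@lebesgue_measure R]_(t in `]0, T[) l (phi t *: g t)
    = \int[@lebesgue_measure R]_(t in `]0, T[) (phi t * l (g t)).
  by apply: eq_Rintegral => t; rewrite inE => Dt; rewrite bfZ//; exact: gm.
have -> : \int[@lebesgue_measure R]_(t in `]0, T[) l (derive1 phi t *: f t)
    = \int[@lebesgue_measure R]_(t in `]0, T[) (derive1 phi t * l (f t)).
  by apply: eq_Rintegral => t; rewrite inE => Dt; rewrite bfZ//; exact: fm.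
by move=> -> ->; rewrite opprK.
Qed.

(** * Energy inequality by difference quotients *)

Section Steklov.
Context {R : realType}.
Implicit Types (f g : R -> R).

Lemma modulus_continuous f : (forall e, 0 < e -> exists2 d, 0 < d &
    forall x y, `|x - y| <= d -> `|f x - f y| <= e) -> continuous f.
Proof.
move=> H x; apply/cvgrPdist_le => e e0; have [d d0 Hd] := H e e0.
apply/nbhs_ballP; exists d => //= y xy; apply: Hd; exact: ltW.
Qed.

Lemma itvint_shift f (t d h : R) : locint f -> 0 <= d -> 0 <= h ->
  itvint f (t + d) (t + d + h) =
  itvint f t (t + h) + itvint f (t + h) (t + h + d) - itvint f t (t + d).
Proof.
move=> lf d0 h0.
have E1 := @itvint_cat _ f t (t + d) (t + d + h) lf ltac:(lra) ltac:(lra).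
have E2 := @itvint_cat _ f t (t + h) (t + h + d) lf ltac:(lra) ltac:(lra).
move: E2; rewrite addrAC E1 => E2.
by rewrite -E2 [X in X - _]addrC addrK.
Qed.

Variables (k : R -> R -> R) (K : R).
Hypothesis kC : forall x y, k x y = k y x.
Hypothesis kK : forall x y, `|k x y| <= K.
Hypothesis kmod : forall e, 0 < e -> exists2 d, 0 < d &
  forall x y z, `|x - y| <= d -> `|k x z - k y z| <= e.

Lemma steklov_K_ge0 : 0 <= K.
Proof. exact: le_trans (kK 0 0). Qed.

Lemma kernel_continuous z : continuous (fun x => k x z).
Proof.
apply: modulus_continuous => e /kmod[d d0 Hd]; exists d => // x y; exact: Hd.
Qed.

Lemma kernel_locint z : locint (fun x => k x z).
Proof. by apply: continuous_locint; exact: kernel_continuous. Qed.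

Lemma kernel_locintr z : locint (k z).
Proof.
rewrite (_ : k z = fun x => k x z); first exact: kernel_locint.
by apply/funext => x; exact: kC.
Qed.

(** Despite the name it is not divided by h; the estimates carry the powers of h instead. *)
Definition inner_avg (h t x : R) := itvint (k x) t (t + h).

(* The double integral of k over [t, t + h]^2. Its derivative in t is twice the
   integral of k(., t + h) - k(., t), which is the term that the form a
   contributes when the equation is tested against w(t + h) - w(t). *)
Definition square_int (h t : R) := itvint (inner_avg h t) t (t + h).

Lemma inner_avg_diff h t e d : 0 <= h ->
  (forall x y z, `|x - y| <= d -> `|k x z - k y z| <= e) ->
  forall x y, `|x - y| <= d -> `|inner_avg h t x - inner_avg h t y| <= h * e.
Proof.
move=> h0 Hd x y xy; rewrite /inner_avg -itvintB; [|exact: kernel_locintr..].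
have -> : h * e = (t + h - t) * e by congr (_ * _); lra.
apply: itvint_norm_le => //; [|lra|by move=> z _; exact: Hd].
by apply: locintB; exact: kernel_locintr.
Qed.

Lemma inner_avg_locint h t : 0 <= h -> locint (inner_avg h t).
Proof.
move=> h0; apply: continuous_locint; apply: modulus_continuous => e e0.
have e1 : 0 < e / (h + 1) by rewrite divr_gt0//; lra.
have [d d0 Hd] := kmod e1; exists d => // x y xy.
apply: le_trans (inner_avg_diff t h0 Hd xy) _.
have -> : h * (e / (h + 1)) = e * (h / (h + 1)) by rewrite mulrCA.
have h1 : h / (h + 1) <= 1 by rewrite ler_pdivrMr; lra.
by rewrite ler_piMr// ltW.
Qed.

(** Bookkeeping for [square_int_increment]: S is the old double integral, P and Q the strips gained
    and lost by the outer range, G the integral of k(., t + h) - k(., t) over the window, u and v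
    the strips of that integral. As P - Q is close to d (x - y) = d G, outer and inner range
    contribute d G each. *)
Lemma square_int_arith (d h n e X S P Q G u v x y : R) : 0 <= d -> h * n = e / 8 ->
  8 * K * d <= e -> X - (S + P - Q) - d * (G + u - v) <= h * (2 * (d * n)) ->
  u <= d * (2 * K) -> - (d * (2 * K)) <= v -> P - d * x <= d * (h * n) ->
  - (d * (h * n)) <= Q - d * y -> x - y = G -> X - S <= d * (2 * G) + e * d.
Proof.
move=> d0 hn dK H u1 v1 P1 Q1 GE; rewrite -GE in H *.
have -> : d * (2 * (x - y)) = d * (x - y) + d * (x - y) by ring.
have E1 : h * (2 * (d * n)) = 2 * (d * (e / 8)) by rewrite -hn; ring.
rewrite E1 in H; rewrite hn in P1 Q1.
have : d * (x - y + u - v) <= d * (x - y + e / 2) by apply: ler_wpM2l => //; lra.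
have -> : d * (x - y + e / 2) = d * x - d * y + d * e / 2 by field.
have -> : d * (x - y) = d * x - d * y by ring.
have E2 : d * (e / 8) = d * e / 8 by rewrite mulrA.
rewrite (mulrC e d); rewrite !E2 in H P1 Q1.
move: H P1 Q1; move: (d * (x - y + u - v)) (d * x) (d * y) (d * e) => a b c f; lra.
Qed.

(** Moving the square by d changes the inner and the outer range; by the symmetry of k both changes
    agree to first order, whence the factor 2. The admissible d does not depend on t, as
    [increment_nonincreasing] requires. *)
Lemma square_int_increment h e : 0 < h -> 0 < e -> exists2 d0, 0 < d0 &
  forall t d, 0 <= d -> d <= d0 ->
  square_int h (t + d) - square_int h t <=
  d * (2 * itvint (fun r => k r (t + h) - k r t) t (t + h)) + e * d.
Proof.
move=> h0 e0; have K0 := steklov_K_ge0; have h0' := ltW h0.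
(* Error budget: with h * n = e / 8, the inner change and the two outer strips cost e d / 4 each
   time; the two strips of [g] cost 4 K d^2, at most e d / 2 by the second bound on d. *)
have n0 : 0 < e / (8 * h) by rewrite divr_gt0// mulr_gt0.
have [d1 d10 Hd] := kmod n0; set n := e / (8 * h) in n0 Hd.
have hn : h * n = e / 8 by rewrite /n; field; rewrite gt_eqF.
exists (Num.min d1 (e / (8 * (K + 1)))).
  by rewrite lt_min d10 divr_gt0// mulr_gt0//; lra.
move=> t d dge; rewrite le_min => /andP[dd1 dK].
have {}dK : 8 * K * d <= e.
  move: dK; rewrite ler_pdivlMr; last by rewrite mulr_gt0//; lra.
  nra.
have lk := kernel_locintr; have lk' := kernel_locint.
have lg : locint (fun r => k r (t + h) - k r t) by apply: locintB; exact: lk'.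
have li := inner_avg_locint t h0'; have li' := inner_avg_locint (t + d) h0'.
set g := fun r => k r (t + h) - k r t in lg *.
have near1 x : `|itvint (k x) (t + h) (t + h + d) - d * k x (t + h)| <= d * n.
  have := @itvint_near _ (k x) (t + h) (t + h + d) (k x (t + h)) n (lk x).
  have -> : t + h + d - (t + h) = d by lra.
  apply; first lra; move=> z /andP[z1 z2]; rewrite kC (kC x); apply: Hd.
  by rewrite ler_norml; lra.
have near2 x : `|itvint (k x) t (t + d) - d * k x t| <= d * n.
  have := @itvint_near _ (k x) t (t + d) (k x t) n (lk x).
  have -> : t + d - t = d by lra.
  apply; first lra; move=> z /andP[z1 z2]; rewrite kC (kC x); apply: Hd.
  by rewrite ler_norml; lra.
have D1 x : `|(inner_avg h (t + d) x - inner_avg h t x) - d * g x| <= 2 * (d * n).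
  rewrite {1}/inner_avg itvint_shift// -/(inner_avg h t x).
  have := near1 x; have := near2 x; rewrite /g !ler_norml; lra.
have I1 : `|itvint (inner_avg h (t + d)) (t + d) (t + d + h)
    - itvint (inner_avg h t) (t + d) (t + d + h) - d * itvint g (t + d) (t + d + h)|
    <= h * (2 * (d * n)).
  rewrite -itvintZ// -!itvintB//; last 2 first.
  - by apply: locintB.
  - exact: locintZ.
  have := @itvint_norm_le _ (fun x => inner_avg h (t + d) x - inner_avg h t x - d * g x)
    (t + d) (t + d + h) (2 * (d * n)).
  have -> : t + d + h - (t + d) = h by lra.
  apply => //; first by apply: locintB; [exact: locintB|exact: locintZ].
  lra.
have gK x : `|g x| <= 2 * K.
  rewrite /g; have := kK x (t + h); have := kK x t; rewrite !ler_norml; lra.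
have G1 : `|itvint g (t + h) (t + h + d)| <= d * (2 * K).
  have := @itvint_norm_le _ g (t + h) (t + h + d) (2 * K) lg.
  have -> : t + h + d - (t + h) = d by lra.
  by apply => [|x _]; [lra|exact: gK].
have G2 : `|itvint g t (t + d)| <= d * (2 * K).
  have := @itvint_norm_le _ g t (t + d) (2 * K) lg.
  have -> : t + d - t = d by lra.
  by apply => [|x _]; [lra|exact: gK].
have A1 : `|itvint (inner_avg h t) (t + h) (t + h + d) - d * inner_avg h t (t + h)| <= d * (h * n).
  have := @itvint_near _ (inner_avg h t) (t + h) (t + h + d) (inner_avg h t (t + h)) (h * n) li.
  have -> : t + h + d - (t + h) = d by lra.
  apply; first lra; move=> z /andP[z1 z2]; apply: (inner_avg_diff t h0' Hd).
  by rewrite ler_norml; lra.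
have A2 : `|itvint (inner_avg h t) t (t + d) - d * inner_avg h t t| <= d * (h * n).
  have := @itvint_near _ (inner_avg h t) t (t + d) (inner_avg h t t) (h * n) li.
  have -> : t + d - t = d by lra.
  apply; first lra; move=> z /andP[z1 z2]; apply: (inner_avg_diff t h0' Hd).
  by rewrite ler_norml; lra.
have Ig : inner_avg h t (t + h) - inner_avg h t t = itvint g t (t + h).
  rewrite /inner_avg -itvintB//; apply: eq_itvint => x _; rewrite /g.
  by rewrite kC (kC t).
have E2 := itvint_shift t li dge h0'.
have E3 := itvint_shift t lg dge h0'.
rewrite /square_int; move: I1; rewrite E2 E3 ler_norml => /andP[_ I1].
have u1 : itvint g (t + h) (t + h + d) <= d * (2 * K) by move: G1; rewrite ler_norml => /andP[].
have v1 : - (d * (2 * K)) <= itvint g t (t + d) by move: G2; rewrite ler_norml => /andP[].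
move: A1 A2; rewrite !ler_norml => /andP[_ A1] /andP[A2 _].
exact: (square_int_arith dge hn dK I1 u1 v1 A1 A2 Ig).
Qed.

Lemma square_int_near h t e d : 0 <= h -> h <= d ->
  (forall x y z, `|x - y| <= d -> `|k x z - k y z| <= e) ->
  `|square_int h t - h ^+ 2 * k t t| <= h ^+ 2 * (2 * e).
Proof.
move=> h0 hd Hd.
have thh : t + h - t = h by lra.
have H1 x : t <= x <= t + h -> `|inner_avg h t x - h * k t t| <= h * (2 * e).
  move=> /andP[x1 x2].
  have := @itvint_near _ (k x) t (t + h) (k t t) (2 * e) (kernel_locintr x).
  rewrite thh; apply; first lra; move=> z /andP[z1 z2].
  have : `|k x z - k t z| <= e by apply: Hd; rewrite ler_norml; lra.
  have : `|k z t - k t t| <= e by apply: Hd; rewrite ler_norml; lra.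
  rewrite (kC z t) !ler_norml; lra.
have := @itvint_near _ (inner_avg h t) t (t + h) (h * k t t) (h * (2 * e)) (inner_avg_locint t h0).
rewrite thh !mulrA -expr2; apply; first lra.
by move=> x /H1; rewrite mulrA.
Qed.

End Steklov.

(** The weight h suits an increment y of size h: after integration over a window of length h both
    terms on the right are of order h^2. *)
Lemma young_weighted (R : realFieldType) (h x y : R) : 0 < h ->
  2 * (x * y) <= h * x ^+ 2 + y ^+ 2 / h.
Proof.
move=> h0; rewrite -subr_ge0.
have -> : h * x ^+ 2 + y ^+ 2 / h - 2 * (x * y) = (h * x - y) ^+ 2 / h.
  by field; rewrite gt_eqF.
by rewrite divr_ge0 ?sqr_ge0// ltW.
Qed.

(** Bookkeeping for [wdiff_increment]: [pyz] pairs y with the remainder and n is the norm of the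
    change of y. The cross term and n^2 each cost at most e d / 2. *)
Lemma wdiff_arith (R : realFieldType) (M e e1 d B pyz n : R) : 0 <= M -> 0 < e1 -> 0 <= d ->
  8 * (e1 * M) <= e / 2 -> 8 * (M + e1) ^+ 2 * d <= e -> pyz <= M * 2 * (2 * (d * e1)) ->
  0 <= n -> n <= d * (2 * M) + 2 * (d * e1) ->
  2 * (d * B + pyz) + n ^+ 2 <= d * (2 * B) + e * d.
Proof.
move=> M0 e10 d0 he hd hp n0 hn.
have n2 : n ^+ 2 <= (d * (2 * M) + 2 * (d * e1)) ^+ 2 by rewrite lerXn2r// nnegrE (le_trans n0).
have E1 : (d * (2 * M) + 2 * (d * e1)) ^+ 2 = d * (8 * (M + e1) ^+ 2 * d) / 2 by field.
have E2 : 2 * (M * 2 * (2 * (d * e1))) = d * (8 * (e1 * M)) by ring.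
have l1 := ler_wpM2l d0 he; have l2 := ler_wpM2l d0 hd.
rewrite E1 in n2; rewrite -E2 in l1.
have E3 : d * (e / 2) = d * e / 2 by rewrite mulrA.
rewrite E3 in l1; rewrite (mulrC e) mulrDr.
have -> : d * (2 * B) = 2 * (d * B) by ring.
move: l1 l2 n2 hp; move: (d * (8 * _ * d)) (M * 2 * _) (n ^+ 2) (d * e) (d * B) => u v x y z; lra.
Qed.

Lemma sqr_lower (R : realFieldType) (M e h x n : R) : 0 <= h -> 0 < e -> 0 <= x -> x <= M ->
  0 <= n -> h * x <= n + h * e -> h ^+ 2 * (x ^+ 2 - 2 * e * M) <= n ^+ 2.
Proof.
move=> h0 e0 x0 xM n0 hn.
have eM : 2 * e * x <= 2 * e * M by rewrite ler_pM2l// mulr_gt0.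
(* For x < e the bound h (x - e) is negative and cannot be squared, but then the left-hand side is
   nonpositive. *)
have [xe|ex] := ltP x e.
  apply: le_trans (sqr_ge0 n); rewrite mulr_ge0_le0 ?sqr_ge0//.
  have : x * x <= x * e by rewrite ler_wpM2l// ltW.
  by have := mulr_ge0 (ltW e0) x0; rewrite expr2; lra.
have hxe : h * (x - e) <= n by rewrite mulrBr; lra.
have h2 : (h * (x - e)) ^+ 2 <= n ^+ 2.
  by rewrite lerXn2r// nnegrE mulr_ge0// subr_ge0.
apply: le_trans h2; rewrite exprMn ler_wpM2l ?sqr_ge0// sqrrB.
have := sqr_ge0 e; rewrite -mulr_natl; lra.
Qed.

Lemma sqr_upper (R : realFieldType) (M e h x n : R) : 0 <= h -> 0 < e -> e <= 1 -> x <= M ->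
  0 <= n -> n <= h * x + h * e -> n ^+ 2 <= h ^+ 2 * (x ^+ 2 + 2 * e * M + e).
Proof.
move=> h0 e0 e1 xM n0 hn.
have h2 : n ^+ 2 <= (h * (x + e)) ^+ 2.
  by rewrite lerXn2r ?mulrDr// nnegrE (le_trans n0).
apply: le_trans h2 _; rewrite exprMn ler_wpM2l ?sqr_ge0// sqrrD.
have eM : 2 * e * x <= 2 * e * M by rewrite ler_pM2l// mulr_gt0.
have ee : e * e <= e * 1 by rewrite ler_pM2l.
rewrite -mulr_natl (expr2 e); lra.
Qed.

Lemma sub_le_trans (R : numDomainType) (x y x0 y0 : R) : 0 <= y0 -> x - y <= x0 - y0 ->
  x <= x0 + y.
Proof.
by move=> y00 H; rewrite -lerBlDr; apply: le_trans H _; rewrite gerBl.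
Qed.

(** The growth 2 B of |y|^2 and the growth 2 I of the double integral meet the bound on 2 B, which
    contains -2 I; what remains, h (F' - F), is the growth of the subtracted term. Four errors of e
    d / 3, e d / 3, e d / 6 and e d / 6 add up to e d. *)
Lemma steklov_arith (R : realFieldType) (h d e e' X X' S S' B I F F' i1 i2 i3 : R) :
  0 <= h -> 0 <= d -> h * e' = e / 6 ->
  X' - X <= d * (2 * B) + e / 3 * d -> S' - S <= d * (2 * I) + e / 3 * d ->
  2 * B <= h * (F' - F) - 2 * I -> - (d * e') <= i3 - d * F' -> i2 - d * F <= d * e' ->
  X' + S' - h * (i1 + i3 - i2) - (X + S - h * i1) <= e * d.
Proof.
move=> h0 d0 he H1 H2 HB H3 H4.
have dB := ler_wpM2l d0 HB; have h3 := ler_wpM2l h0 H3; have h4 := ler_wpM2l h0 H4.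
have E1 : h * (d * e') = e * d / 6 by rewrite mulrCA he; field.
have E2 : d * (h * (F' - F) - 2 * I) = h * (d * F') - h * (d * F) - d * (2 * I) by ring.
have E3 : e / 3 * d = e * d / 3 by field.
rewrite E2 in dB; rewrite mulrN E1 mulrBr in h3; rewrite E1 mulrBr in h4.
rewrite E3 in H1 H2; rewrite mulrBr mulrDr.
move: dB h3 h4 H1 H2.
move: (h * i1) (h * i2) (h * i3) (h * (d * F)) (h * (d * F')) (d * (2 * I)) (d * (2 * B)) (e * d)
  => a1 a2 a3 a4 a5 a6 a7 a8.
lra.
Qed.

(** Division by c = h^2. The constant 4 M + 6 collects 2 e1 M twice and e1 once from the velocities,
    2 e1 twice from the double integrals and e1 from the forcing. *)
Lemma energy_arith (R : realFieldType) (M e e1 c u v x y z A1 A2 A3 A4 A5 : R) : 0 < c ->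
  e1 * (4 * M + 6) <= e -> c * (A1 - 2 * e1 * M) <= u ->
  v <= c * (A2 + 2 * e1 * M + e1) -> u + x <= v + y + z ->
  - (c * (2 * e1)) <= x - c * A3 -> y - c * A4 <= c * (2 * e1) ->
  z <= c * (A5 + e1) -> A1 + A3 <= A2 + A4 + A5 + e.
Proof.
move=> c0 he Hu Hv H Hx Hy Hz.
apply: (@le_trans _ _ (A2 + A4 + A5 + e1 * (4 * M + 6))); last by rewrite lerD2l.
rewrite -(ler_pM2l c0).
have E1 : c * (A1 - 2 * e1 * M) = c * A1 - 2 * (c * (e1 * M)) by ring.
have E2 : c * (A2 + 2 * e1 * M + e1) = c * A2 + 2 * (c * (e1 * M)) + c * e1 by ring.
have E3 : c * (2 * e1) = 2 * (c * e1) by ring.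
have E4 : c * (A5 + e1) = c * A5 + c * e1 by ring.
have -> : c * (A1 + A3) = c * A1 + c * A3 by ring.
have -> : c * (A2 + A4 + A5 + e1 * (4 * M + 6))
    = c * A2 + c * A4 + c * A5 + 4 * (c * (e1 * M)) + 6 * (c * e1) by ring.
rewrite E1 in Hu; rewrite E2 in Hv; rewrite E3 in Hx Hy; rewrite E4 in Hz.
move: Hu Hv H Hx Hy Hz.
move: (c * A1) (c * A2) (c * A3) (c * A4) (c * A5) (c * (e1 * M)) (c * e1) => B1 B2 B3 B4 B5 B6 B7.
lra.
Qed.

Section Clamp.
Context {R : realType}.
Implicit Types T x y : R.

(* Precomposition with [clamp T] extends a continuous function on [0, T] to a
   continuous function on the line. *)
Definition clamp T x := Num.max 0 (Num.min T x).

Lemma clamp_itv T x : 0 <= T -> 0 <= clamp T x <= T.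
Proof. by move=> T0; rewrite /clamp le_max lexx/= ge_max T0 ge_min lexx. Qed.

Lemma clamp_id T x : 0 <= x <= T -> clamp T x = x.
Proof. by move=> /andP[x0 xT]; rewrite /clamp min_r// max_r. Qed.

Lemma clamp_dist T x y : `|clamp T x - clamp T y| <= `|x - y|.
Proof.
have min_dist u v : `|Num.min T u - Num.min T v| <= `|u - v|.
  rewrite ler_norml; have := ler_norm (u - v); have := ler_norm (v - u).
  by rewrite distrC; case: (leP T u) => ?; case: (leP T v) => ?; lra.
apply: le_trans (min_dist x y); rewrite /clamp; move: (Num.min T x) (Num.min T y) => u v.
rewrite ler_norml; have := ler_norm (u - v); have := ler_norm (v - u).
by rewrite distrC; case: (leP 0 u) => ?; case: (leP 0 v) => ?; lra.
Qed.

End Clamp.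

Lemma itvint_avg_le (R : realType) (f : R -> R) (t h c e : R) : locint f -> 0 <= h ->
  (forall x, t <= x <= t + h -> `|f x - c| <= e) -> itvint f t (t + h) <= h * (c + e).
Proof.
move=> lf h0 Hf; have th : t <= t + h by rewrite lerDl.
have := itvint_near lf th Hf; rewrite (addrC t) addrK => Hn.
by rewrite mulrDr; exact: ler_distlDr Hn.
Qed.

(** * The energy inequality for w'' + A w = F in an abstract pair V, H *)

Section EnergyInequality.
Local Opaque itvint.
Context {R : realType} {E : lmodType R}.
Variables (H V : set E) (p a : E -> E -> R).
Hypotheses (HH : semi_inner H p) (HV : semi_inner V a).
Hypotheses (H0 : H 0) (V0 : V 0) (VH : V `<=` H).
Variables (w w' : R -> E) (N : R -> R) (T M : R).
Local Notation nH := (si_norm p).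
Local Notation nV := (si_norm a).
Hypotheses (wV : forall t, V (w t)) (w'H : forall t, H (w' t)).
Hypotheses (wM : forall t, nV (w t) <= M) (wMH : forall t, nH (w t) <= M)
  (w'M : forall t, nH (w' t) <= M).
Hypothesis wmod : forall e, 0 < e -> exists2 d, 0 < d &
  forall s t, `|s - t| <= d -> nV (w s - w t) <= e.
Hypothesis w'mod : forall e, 0 < e -> exists2 d, 0 < d &
  forall s t, `|s - t| <= d -> nH (w' s - w' t) <= e.
Hypothesis wderiv : forall v, H v -> forall s t, 0 <= s -> s <= t -> t <= T ->
  p (w t - w s) v = itvint (fun r => p (w' r) v) s t.
Hypothesis N2 : locint (fun r => N r ^+ 2).
(** Here [beta] represents r |-> <w''(r), v>. Since it may depend on v and be modified on null sets,
    the bound can be asked at every r of [0, T]. *)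
Hypothesis w'deriv : forall v, V v -> exists beta, [/\ locint beta,
  forall s t, 0 <= s -> s <= t -> t <= T -> p (w' t - w' s) v = itvint beta s t &
  forall r, 0 <= r <= T -> `|beta r + a (w r) v| <= N r * nH v].

Let wH t : H (w t). Proof. exact: VH. Qed.

Lemma energy_M_ge0 : 0 <= M.
Proof. exact: le_trans (si_norm_ge0 a (w 0)) (wM 0). Qed.

Lemma w'_pairing_locint v : H v -> locint (fun r => p (w' r) v).
Proof.
move=> Hv; apply: continuous_locint; apply: modulus_continuous => e e0.
have n0 : 0 < nH v + 1 by rewrite ltr_wpDl// si_norm_ge0.
have [d d0 Hd] := w'mod (divr_gt0 e0 n0); exists d => // x y xy.
rewrite -(si_Bl HH H0)//; apply: le_trans (si_CS HH H0 _ _) _ => //.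
  exact: (si_B HH H0).
apply: le_trans (ler_pM (si_norm_ge0 p _) (si_norm_ge0 p _) (Hd _ _ xy) (lexx _)) _.
by rewrite mulrAC ler_pdivrMr// ler_pM2l// lerDl.
Qed.

Lemma w'_sqr_modulus e : 0 < e -> exists2 d, 0 < d & forall x y, `|x - y| <= d ->
  `|p (w' x) (w' x) - p (w' y) (w' y)| <= e.
Proof.
move=> e0; have M0 := energy_M_ge0; have n0 : 0 < 2 * M + 1 by lra.
have [d d0 Hd] := w'mod (divr_gt0 e0 n0); exists d => // x y xy.
have Hxy := si_B HH H0 (w'H x) (w'H y).
have -> : p (w' x) (w' x) - p (w' y) (w' y)
    = p (w' x - w' y) (w' x) + p (w' x - w' y) (w' y).
  rewrite !(si_Bl HH H0)// (si_C HH (w'H y) (w'H x)).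
  by rewrite addrA subrK.
apply: le_trans (ler_normD _ _) _.
have h1 := si_CS HH H0 Hxy (w'H x); have h2 := si_CS HH H0 Hxy (w'H y).
have b1 := ler_pM (si_norm_ge0 p _) (si_norm_ge0 p _) (Hd _ _ xy) (w'M x).
have b2 := ler_pM (si_norm_ge0 p _) (si_norm_ge0 p _) (Hd _ _ xy) (w'M y).
apply: le_trans (lerD (le_trans h1 b1) (le_trans h2 b2)) _.
rewrite -mulrDr mulrAC ler_pdivrMr// ler_pM2l//; lra.
Qed.

Lemma w'_sqr_continuous : continuous (fun r => p (w' r) (w' r)).
Proof. by apply: modulus_continuous; exact: w'_sqr_modulus. Qed.

Definition gram s t := a (w s) (w t).

Lemma gramC s t : gram s t = gram t s.
Proof. exact: (si_C HV). Qed.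

Lemma gram_le s t : `|gram s t| <= M * M.
Proof.
apply: le_trans (si_CS HV V0 (wV s) (wV t)) _.
by apply: ler_pM => //; exact: si_norm_ge0.
Qed.

Lemma gram_modulus e : 0 < e -> exists2 d, 0 < d & forall x y z,
  `|x - y| <= d -> `|gram x z - gram y z| <= e.
Proof.
move=> e0; have M0 := energy_M_ge0; have n0 : 0 < M + 1 by lra.
have [d d0 Hd] := wmod (divr_gt0 e0 n0); exists d => // x y z xy.
rewrite /gram -(si_Bl HV V0)//.
apply: le_trans (si_CS HV V0 (si_B HV V0 (wV x) (wV y)) (wV z)) _.
apply: le_trans (ler_pM (si_norm_ge0 a _) (si_norm_ge0 a _) (Hd _ _ xy) (wM z)) _.
by rewrite mulrAC ler_pdivrMr// ler_pM2l// lerDl.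
Qed.

(** The two sides of Young's inequality for the work of the force on y: N^2, and |y|^2 / h^2, which
    is at most the mean of |w'|^2 over the window. *)
Definition force_density r := N r ^+ 2 + p (w' r) (w' r).

Lemma force_density_ge0 r : 0 <= force_density r.
Proof. by rewrite addr_ge0 ?sqr_ge0// (si_ge0 HH). Qed.

Lemma w'_sqr_locint : locint (fun r => p (w' r) (w' r)).
Proof. exact: continuous_locint w'_sqr_continuous. Qed.

Lemma force_density_locint : locint force_density.
Proof. by apply: locintD => //; exact: w'_sqr_locint. Qed.

(** Testing the weak identity with the remainder z itself gives |z|^2 <= d e |z|: differentiability
    in the norm of H follows from scalar identities. *)
Lemma w_strong_derivative e : 0 < e -> exists2 d0, 0 < d0 & forall s d, 0 <= s ->
  0 <= d -> d <= d0 -> s + d <= T -> nH (w (s + d) - w s - d *: w' s) <= d * e.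
Proof.
move=> e0; have [d0 d00 Hd] := w'mod e0; exists d0 => // s d s0 dge dd0 sdT.
set z := w (s + d) - w s - d *: w' s.
have Hw := si_B HH H0 (wH (s + d)) (wH s).
have Hd' := si_Z HH H0 d (w'H s).
have Hz : H z by exact: (si_B HH H0).
have sds : s + d - s = d by lra.
have E1 : nH z ^+ 2 = itvint (fun r => p (w' r) z) s (s + d) - d * p (w' s) z.
  rewrite (si_norm_sqr HH)// {1}/z (si_Bl HH H0)// (si_Zl HH H0)// wderiv//; lra.
have := @itvint_near _ (fun r => p (w' r) z) s (s + d) (p (w' s) z) (e * nH z) (w'_pairing_locint Hz).
rewrite sds => K.
have {K}: nH z ^+ 2 <= d * (e * nH z).
  rewrite E1; apply: le_trans (ler_norm _) _; apply: K; first lra.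
  move=> x /andP[x1 x2]; rewrite -(si_Bl HH H0)//.
  apply: le_trans (si_CS HH H0 (si_B HH H0 (w'H x) (w'H s)) Hz) _.
  apply: ler_wpM2r; first exact: si_norm_ge0.
  by apply: Hd; rewrite ger0_norm; lra.
have [->|z0] := eqVneq (nH z) 0; first by move=> _; rewrite mulr_ge0// ltW.
have zp : 0 < nH z by rewrite lt_neqAle eq_sym z0 si_norm_ge0.
by rewrite mulrA expr2 ler_pM2r.
Qed.

Definition wdiff h t := w (t + h) - w t.

Lemma wdiffV h t : V (wdiff h t). Proof. exact: (si_B HV V0). Qed.

Let wdiffH h t : H (wdiff h t). Proof. exact/VH/wdiffV. Qed.

(** Jensen's inequality in scalar form: the displacement identity is tested with y, Young's
    inequality with weight h is applied, and one |y|^2 is absorbed. *)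
Lemma wdiff_sqr_le h t : 0 < h -> 0 <= t -> t + h <= T ->
  p (wdiff h t) (wdiff h t) <= h * itvint (fun r => p (w' r) (w' r)) t (t + h).
Proof.
move=> h0 t0 thT; set y := wdiff h t; have Hy : H y := wdiffH h t.
have E1 : p y y = itvint (fun r => p (w' r) y) t (t + h).
  by rewrite {1}/y wderiv//; lra.
have cs := @le_itvint R (fun r => 2 * p (w' r) y)
  (fun r => h * p (w' r) (w' r) + p y y / h) t (t + h).
have {cs} : 2 * p y y <= h * itvint (fun r => p (w' r) (w' r)) t (t + h) + p y y.
  have lp := w'_pairing_locint Hy; have ls := w'_sqr_locint.
  rewrite {1}E1 -(itvintZ _ _ _ lp) -(itvintZ _ _ _ ls).
  apply: le_trans (cs _ _ _) _.
  - by apply: locintZ; exact: w'_pairing_locint.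
  - by apply: locintD; [apply: locintZ; exact: w'_sqr_locint|exact: locint_cst].
  - move=> r _; have := young_weighted (nH (w' r)) (nH y) h0.
    rewrite !(si_norm_sqr HH)//; apply: le_trans.
    by rewrite ler_pM2l//; exact: (si_le HH H0).
  - rewrite itvintD; [|by apply: locintZ; exact: w'_sqr_locint|exact: locint_cst].
    rewrite itvint_cst; last lra.
    by rewrite lerD2l (_ : t + h - t = h); [rewrite mulrC divfK// gt_eqF|lra].
lra.
Qed.

(** The equation is tested with the single vector y at all times r of the window, so one [beta]
    suffices. The Gram difference is a(w r, y), and [wdiff_sqr_le] replaces the |y|^2 left by
    Young's inequality. *)
Lemma wdiff_power h t : 0 < h -> 0 <= t -> t + h <= T ->
  2 * p (w' (t + h) - w' t) (wdiff h t) <=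
  h * itvint force_density t (t + h)
  - 2 * itvint (fun r => gram r (t + h) - gram r t) t (t + h).
Proof.
move=> h0 t0 thT; set y := wdiff h t.
have Vy : V y := wdiffV h t; have Hy : H y := VH Vy.
have [beta [lb Eb Hb]] := w'deriv Vy.
rewrite Eb; [|lra..].
have lg : locint (fun r => gram r (t + h) - gram r t).
  by apply: locintB; apply: continuous_locint; apply: modulus_continuous => e e0;
    have [d d0 Hd] := gram_modulus e0; exists d => // x z xz; exact: Hd.
have yy := wdiff_sqr_le h0 t0 thT; rewrite -/y in yy.
have lN : locint (fun r => h * N r ^+ 2 + p y y / h).
  by apply: locintD; [exact: locintZ|exact: locint_cst].
have : itvint (fun r => 2 * beta r + 2 * (gram r (t + h) - gram r t)) t (t + h)
    <= itvint (fun r => h * N r ^+ 2 + p y y / h) t (t + h).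
  apply: le_itvint => //; first by apply: locintD; exact: locintZ.
  move=> r /andP[r1 r2]; have rT : 0 <= r <= T by apply/andP; split; lra.
  have := Hb r rT; have := young_weighted (N r) (nH y) h0.
  rewrite (si_norm_sqr HH)//.
  have -> : gram r (t + h) - gram r t = a (w r) y by rewrite /y /wdiff (si_Br HV V0).
  by move: (N r * nH y) => c; rewrite ler_norml; lra.
rewrite (itvintD _ _ (locintZ 2 lb) (locintZ 2 lg)).
rewrite (itvintD _ _ (locintZ h N2) (@locint_cst R (p y y / h))).
have tth : t <= t + h by lra.
rewrite (itvint_cst (p y y / h) tth) (itvintZ _ _ _ lb) (itvintZ _ _ _ lg) (itvintZ _ _ _ N2).
rewrite (_ : t + h - t = h); last lra.
rewrite (mulrC h (_ / _)) divfK ?gt_eqF//.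
rewrite [itvint force_density _ _]itvintD//; last exact: w'_sqr_locint.
by rewrite mulrDr; lra.
Qed.

(** First-order expansion of |y|^2: by [w_strong_derivative], y changes by d (w'(t + h) - w'(t))
    plus a remainder of norm at most 2 d e1. *)
Lemma wdiff_increment h e : 0 < h -> 0 < e -> exists2 d0, 0 < d0 & forall t d,
  0 <= t -> 0 <= d -> d <= d0 -> t + d + h <= T ->
  p (wdiff h (t + d)) (wdiff h (t + d)) - p (wdiff h t) (wdiff h t) <=
  d * (2 * p (w' (t + h) - w' t) (wdiff h t)) + e * d.
Proof.
move=> h0 e0; have M0 := energy_M_ge0.
(* The remainder is paired with 2 y, where |y| <= 2 M, which costs 8 e1 M d; the constant 16 makes
   this at most e d / 2, and M + 1 avoids dividing by 0. *)
pose e1 := e / (16 * (M + 1)).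
have e10 : 0 < e1 by rewrite divr_gt0// mulr_gt0//; lra.
have he1 : 8 * (e1 * M) <= e / 2.
  have -> : 8 * (e1 * M) = e / 2 * (M / (M + 1)) by rewrite /e1; field; lra.
  by rewrite ler_piMr ?divr_ge0 ?(ltW e0)// ler_pdivrMr; lra.
have [d1 d10 Hd] := w_strong_derivative e10.
have q0 : 0 < 8 * (M + e1) ^+ 2 + 1 by rewrite ltr_wpDl// mulr_ge0// sqr_ge0.
exists (Num.min d1 (e / (8 * (M + e1) ^+ 2 + 1))).
  by rewrite lt_min d10 divr_gt0.
move=> t d t0 dge; rewrite le_min => /andP[dd1 dq] tdhT.
have hd : 8 * (M + e1) ^+ 2 * d <= e.
  by move: dq; rewrite ler_pdivlMr// => dq; apply: le_trans dq; rewrite mulrC ler_wpM2l// lerDl.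
set y := wdiff h t; have Hy : H y := wdiffH h t.
pose D1 := w (t + h + d) - w (t + h) - d *: w' (t + h).
pose D2 := w (t + d) - w t - d *: w' t.
have D1e : nH D1 <= d * e1 by apply: Hd => //; lra.
have D2e : nH D2 <= d * e1 by apply: Hd => //; lra.
have HD1 : H D1 by apply: (si_B HH H0); [exact: (si_B HH H0)|exact: (si_Z HH H0)].
have HD2 : H D2 by apply: (si_B HH H0); [exact: (si_B HH H0)|exact: (si_Z HH H0)].
pose dw := w' (t + h) - w' t; have Hdw : H dw by exact: (si_B HH H0).
pose z := D1 - D2; have Hz : H z by exact: (si_B HH H0).
have ze : nH z <= 2 * (d * e1) by apply: le_trans (si_normB HH H0 HD1 HD2) _; lra.
have yE : wdiff h (t + d) = y + (d *: dw + z).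
  have E1 : w (t + h + d) - w (t + h) = d *: w' (t + h) + D1 by rewrite [RHS]addrC subrK.
  have E2 : w (t + d) - w t = d *: w' t + D2 by rewrite [RHS]addrC subrK.
  have -> : d *: dw + z = w (t + h + d) - w (t + h) - (w (t + d) - w t).
    by rewrite /dw /z scalerBr addrACA -opprD -E1 -E2.
  rewrite /y /wdiff [t + d + h]addrAC.
  by rewrite opprB addrA [X in _ = X + _]addrC !subrKA.
have Hdz : H (d *: dw) by exact: (si_Z HH H0).
have Hq : H (d *: dw + z) by exact: (si_D HH).
rewrite yE (si_sqrD HH)//.
rewrite -(si_norm_sqr HH Hq) (si_Dr HH Hdz Hz Hy) (si_Zr HH H0 d Hdw Hy) (si_C HH Hy Hdw).
have yM : nH y <= M * 2.
  apply: le_trans (si_normB HH H0 (wH _) (wH _)) _.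
  by have := wMH (t + h); have := wMH t; lra.
have pyz : p y z <= M * 2 * (2 * (d * e1)).
  apply: le_trans (si_le HH H0 Hy Hz) _.
  by apply: ler_pM => //; exact: si_norm_ge0.
have nq : nH (d *: dw + z) <= d * (2 * M) + 2 * (d * e1).
  apply: le_trans (si_normD HH H0 Hdz Hz) _; apply: lerD => //.
  rewrite (si_normZ HH H0)// ger0_norm// ler_wpM2l//.
  by apply: le_trans (si_normB HH H0 (w'H _) (w'H _)) _; have := w'M (t + h); have := w'M t; lra.
rewrite -[X in X - _]addrA [X in X - _]addrC addrK.
exact: (@wdiff_arith R M e e1 d (p dw y) _ _ M0 e10 dge he1 hd pyz (si_norm_ge0 p _) nq).
Qed.

(** Clamping makes the primitive constant outside [0, T], hence uniformly continuous on the line. *)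
Definition force_primitive s := itvint force_density 0 (clamp T s).

Hypothesis T0 : 0 <= T.

Lemma force_primitiveB s t : s <= t -> 0 <= s -> t <= T ->
  force_primitive t - force_primitive s = itvint force_density s t.
Proof.
move=> st s0 tT; rewrite /force_primitive !clamp_id; try (apply/andP; split; lra).
by rewrite (@itvint_cat _ _ 0 s t)//; [rewrite addrC addKr|exact: force_density_locint].
Qed.

Lemma force_primitive_modulus e : 0 < e -> exists2 d, 0 < d & forall x y, `|x - y| <= d ->
  `|force_primitive x - force_primitive y| <= e.
Proof.
move=> e0; have [d d0 Hd] := itvint_smallN 0 T force_density_locint e0.
exists d => // x y xy.
have cxy := le_trans (clamp_dist T x y) xy.
have /andP[cx0 cxT] := clamp_itv x T0; have /andP[cy0 cyT] := clamp_itv y T0.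
have fE z : force_primitive z = force_primitive (clamp T z).
  by rewrite /force_primitive (clamp_id (clamp_itv z T0)).
rewrite (fE x) (fE y).
have [le_yx|/ltW le_xy] := leP (clamp T y) (clamp T x).
  rewrite force_primitiveB//; apply: Hd => //.
  by apply: le_trans cxy; rewrite ler_norm.
rewrite distrC force_primitiveB//; apply: Hd => //.
by apply: le_trans cxy; rewrite distrC ler_norm.
Qed.

Lemma force_primitive_locint : locint force_primitive.
Proof. by apply: continuous_locint; apply: modulus_continuous; exact: force_primitive_modulus. Qed.

(** The subtracted term in [f] grows at the rate h (F(t + h) - F(t)), with F the primitive, which is
    the bound of [wdiff_power]; so [f] is nonincreasing. The same term at time 0 is nonnegative and
    is dropped. *)
Lemma steklov_energy h tau : 0 < h -> 0 <= tau -> tau + h <= T ->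
  p (wdiff h tau) (wdiff h tau) + square_int gram h tau <=
  p (wdiff h 0) (wdiff h 0) + square_int gram h 0
  + h * itvint force_primitive tau (tau + h).
Proof.
move=> h0 tau0 thT.
pose f t := p (wdiff h t) (wdiff h t) + square_int gram h t
  - h * itvint force_primitive t (t + h).
have lF := force_primitive_locint.
suff : f tau <= f 0.
  have : 0 <= h * itvint force_primitive 0 (0 + h).
    rewrite mulr_ge0 ?(ltW h0)//; apply: itvint_ge0 => x _.
    by apply: itvint_ge0 => y _; exact: force_density_ge0.
  exact: sub_le_trans.
apply: increment_nonincreasing => // e e0.
have e3 : 0 < e / 3 by rewrite divr_gt0.
have [d1 d10 H1] := wdiff_increment h0 e3.
have [d2 d20 H2] := square_int_increment gramC gram_le gram_modulus h0 e3.
have e6 : 0 < e / (6 * h) by rewrite divr_gt0// mulr_gt0.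
have [d3 d30 H3] := force_primitive_modulus e6.
exists (Num.min d1 (Num.min d2 d3)); first by rewrite !lt_min d10 d20.
move=> t d t0 dge; rewrite !le_min => /and3P[dd1 dd2 dd3] tdtau.
have thT' : t + h <= T by lra.
have tth : t <= t + h by lra.
have tdh : t + d + h <= T by lra.
have N1 : `|itvint force_primitive (t + h) (t + h + d) - d * force_primitive (t + h)| <= d * (e / (6 * h)).
  have := @itvint_near _ force_primitive (t + h) (t + h + d) (force_primitive (t + h)) (e / (6 * h)) lF.
  have -> : t + h + d - (t + h) = d by lra.
  apply; first lra; move=> x /andP[x1 x2]; apply: H3; rewrite ger0_norm; lra.
have N2' : `|itvint force_primitive t (t + d) - d * force_primitive t| <= d * (e / (6 * h)).
  have := @itvint_near _ force_primitive t (t + d) (force_primitive t) (e / (6 * h)) lF.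
  have -> : t + d - t = d by lra.
  apply; first lra; move=> x /andP[x1 x2]; apply: H3; rewrite ger0_norm; lra.
have {}H1 := H1 t d t0 dge dd1 tdh.
have {}H2 := H2 t d dge dd2.
have B := wdiff_power h0 t0 thT'.
rewrite -(@force_primitiveB t (t + h) tth t0 thT') in B.
have sh := itvint_shift t lF dge (ltW h0).
rewrite /f sh.
move: N1 N2'; rewrite !ler_norml => /andP[N1 _] /andP[_ N2'].
have he : h * (e / (6 * h)) = e / 6 by field; rewrite gt_eqF.
exact: (@steklov_arith R h d e (e / (6 * h)) _ _ _ _ _ _ _ _ _ _ _ (ltW h0) dge he H1 H2 B N1 N2').
Qed.

Definition energy t := p (w' t) (w' t) + a (w t) (w t).

Lemma energy_inequality tau : 0 <= tau -> tau < T ->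
  energy tau <= energy 0 + itvint force_density 0 tau.
Proof.
move=> tau0 tauT; apply/ler_addgt0Pr => e e0; have M0 := energy_M_ge0.
have q0 : 0 < 4 * M + 6 by lra.
(* The bound 1 lets [sqr_upper] absorb e1^2 into e1; the factor 4 M + 6 is the error total of
   [energy_arith]. *)
pose e1 := Num.min 1 (e / (4 * M + 6)).
have e10 : 0 < e1 by rewrite lt_min ltr01 divr_gt0.
have e11 : e1 <= 1 by rewrite ge_min lexx.
have he1 : e1 * (4 * M + 6) <= e by rewrite -ler_pdivlMr// /e1 ge_min lexx orbT.
have [d1 d10 H1] := w_strong_derivative e10.
have [d2 d20 H2] := gram_modulus e10.
have [d3 d30 H3] := force_primitive_modulus e10.
pose h := Num.min (Num.min d1 d2) (Num.min d3 (T - tau)).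
have h0 : 0 < h by rewrite !lt_min d10 d20 d30 subr_gt0.
have hd1 : h <= d1 by rewrite /h !ge_min lexx.
have hd2 : h <= d2 by rewrite /h !ge_min lexx !orbT.
have hd3 : h <= d3 by rewrite /h !ge_min lexx !orbT.
have hT : h <= T - tau by rewrite /h !ge_min lexx !orbT.
clearbody h; clearbody e1.
have thT : tau + h <= T by rewrite -lerBrDl.
have h0T : 0 + h <= T by apply: le_trans thT; rewrite lerD2r.
have h0' := ltW h0.
have z1 t : 0 <= t -> t + h <= T -> nH (wdiff h t - h *: w' t) <= h * e1.
  by move=> t0 tT; apply: H1.
have Hhw t : H (h *: w' t) by exact: (si_Z HH H0).
have lo : h ^+ 2 * (p (w' tau) (w' tau) - 2 * e1 * M) <= p (wdiff h tau) (wdiff h tau).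
  rewrite -(si_norm_sqr HH (w'H tau)) -(si_norm_sqr HH (wdiffH h tau)).
  apply: sqr_lower => //; try exact: si_norm_ge0.
  have := si_norm_dist HH H0 (wdiffH h tau) (Hhw tau).
  rewrite (si_normZ HH H0)// (ger0_norm h0') => Hn.
  exact: ler_distlCDr (le_trans Hn (z1 tau tau0 thT)).
have up : p (wdiff h 0) (wdiff h 0) <= h ^+ 2 * (p (w' 0) (w' 0) + 2 * e1 * M + e1).
  rewrite -(si_norm_sqr HH (w'H 0)) -(si_norm_sqr HH (wdiffH h 0)).
  apply: sqr_upper => //; try exact: si_norm_ge0.
  have := si_norm_dist HH H0 (wdiffH h 0) (Hhw 0).
  rewrite (si_normZ HH H0)// (ger0_norm h0') => Hn.
  exact: ler_distlDr (le_trans Hn (z1 0 (lexx 0) h0T)).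
have S1 := square_int_near gramC gram_modulus tau h0' hd2 H2.
have S0 := square_int_near gramC gram_modulus 0 h0' hd2 H2.
have F1 : itvint force_primitive tau (tau + h) <= h * (force_primitive tau + e1).
  apply: itvint_avg_le => //; first exact: force_primitive_locint.
  move=> x /andP[x1 x2]; apply: H3.
  by rewrite ger0_norm ?subr_ge0// lerBlDl (le_trans x2)// lerD2l.
have S := steklov_energy h0 tau0 thT.
have hF1 := ler_wpM2l h0' F1; rewrite mulrA -expr2 in hF1.
have Ftau : force_primitive tau = itvint force_density 0 tau.
  by rewrite /force_primitive clamp_id// tau0 ltW.
move: S1 S0; rewrite !ler_norml => /andP[S1 _] /andP[_ S0].
have h2 : 0 < h ^+ 2 by rewrite exprn_gt0.
rewrite -Ftau /energy -/(gram tau tau) -/(gram 0 0).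
exact: (energy_arith h2 he1 lo up S S1 S0 hF1).
Qed.

End EnergyInequality.

(** * Gronwall's lemma *)

Section Gronwall.
Context {R : realType}.
Local Notation leb := (@lebesgue_measure R).

Lemma gronwall (f : R -> R) (A C T : R) : continuous f -> 0 <= A -> 0 <= C ->
  (forall t, 0 <= t -> t < T -> f t <= A + C * itvint f 0 t) ->
  forall t, 0 <= t -> t < T -> f t <= A * expR (C * T).
Proof.
move=> cf A0 C0 H t t0 tT.
have lf := continuous_locint cf.
(* Its derivative is C e^(-C x) times f x - (A + C * itvint f 0 x), which is nonpositive by
   hypothesis, so u t <= u 0 = A. *)
pose u x := (A + C * itvint f 0 x) * expR (- C * x).
have Fd x : x \in `]0, t[ -> is_derive x (1 : R) (itvint f 0) (f x).
  rewrite in_itv/= => /andP[x0 xt].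
  have [d1 d2] := @continuous_FTC1_closed R f 0 x t xt (lf 0 t) x0 (cf x).
  by apply: DeriveDef; [exact: d1|rewrite -derive1E; exact: d2].
have Ed x : is_derive x (1 : R) (fun x => expR (- C * x)) (expR (- C * x) * - C).
  have Hl : is_derive x (1 : R) (fun y => - C * y) (- C).
    by apply: is_derive_eq (is_deriveZ (- C) (is_derive_id x 1)) _; rewrite scaler1.
  exact: (@is_derive1_comp _ expR (fun y => - C * y) x _ _ (is_derive_expR _) Hl).
have Ud x : x \in `]0, t[ -> is_derive x (1 : R) u
    ((A + C * itvint f 0 x) * (expR (- C * x) * - C) + expR (- C * x) * (C * f x)).
  move=> xt; have H1 : is_derive x (1 : R) (fun x => A + C * itvint f 0 x) (C * f x).
    apply: is_derive_eq (is_deriveD (is_derive_cst A x 1) (is_deriveZ C (Fd x xt))) _.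
    by rewrite add0r.
  exact: is_derive_eq (is_deriveM H1 (Ed x)) _.
have uc : {within `[0, t], continuous u}.
  move=> x; apply: cvgM.
    apply: cvgD; first exact: cvg_cst.
    apply: cvgM; first exact: cvg_cst.
    exact: (parameterized_integral_continuous t0 (lf 0 t)).
  apply: (@continuous_subspaceT _ _ _ (fun x => expR (- C * x))) => y.
  by have [d _] := Ed y; exact/differentiable_continuous/derivable1_diffP.
have : u t <= u 0.
  apply: (@ler0_derive1_nincr R u 0 t) => // x xt; have [d1 d2] := Ud x xt => //.
  rewrite derive1E d2; move: (xt); rewrite in_itv/= => /andP[x0 xt'].
  have := H x (ltW x0) (lt_trans xt' tT).
  have := expR_gt0 (- C * x); move: (expR _) (f x) (itvint f 0 x) => e fx I e0 Hx.
  have -> : (A + C * I) * (e * - C) + e * (C * fx) = (e * C) * (fx - (A + C * I)) by ring.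
  by rewrite mulr_ge0_le0 ?mulr_ge0 ?(ltW e0)// subr_le0.
rewrite /u itvint_id mulr0 addr0 mulr0 expR0 mulr1 mulNr expRN ler_pdivrMr ?expR_gt0// => Hu.
apply: le_trans (H t t0 tT) (le_trans Hu _).
by rewrite ler_wpM2l// ler_expR ler_wpM2l// ltW.
Qed.

(** Recovers the final time, which the energy inequality misses because its window extends to the
    right of t. *)
Lemma continuous_le_endpoint (f : R -> R) (T B : R) : continuous f -> 0 < T ->
  (forall t, 0 <= t -> t < T -> f t <= B) -> f T <= B.
Proof.
move=> cf T0 H; apply/ler_addgt0Pr => e e0.
have := cf T; move=> /cvgrPdist_le /(_ _ e0) /nbhs_ballP[d /= d0 Hd].
pose t := Num.max 0 (T - d / 2).
have t0 : 0 <= t by rewrite le_max lexx.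
have tT : t < T by rewrite gt_max T0/= ltrBlDr ltrDl divr_gt0.
have := Hd t; rewrite /ball/= ger0_norm ?subr_ge0 ?(ltW tT)// => Hdt.
have td : T - t < d.
  rewrite ltrBlDr -ltrBlDl lt_max; apply/orP; right.
  by rewrite ltrD2l ltrN2 ltr_pdivrMr// ltr_pMr// ltr1n.
have := Hdt td; have := H t t0 tT; rewrite ler_norml; lra.
Qed.

Lemma sin_lipschitz (x y : R) : `|sin x - sin y| <= `|x - y|.
Proof.
wlog xy : x y / x < y.
  move=> Hw; have [/Hw//|yx|->] := ltgtP x y; last by rewrite !subrr.
  by rewrite distrC (distrC x); exact: Hw.
have [c _ Hc] : exists2 c, c \in `]x, y[ & sin y - sin x = cos c * (y - x).
  apply: MVT => //.
  exact: continuous_subspaceT (@continuous_sin R).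
rewrite distrC Hc normrM (distrC x) ler_piMl// ler_norml.
by rewrite cos_geN1 cos_le1.
Qed.

Lemma integrable_of_sqr (D : set R) (f : R -> R) : measurable D -> (leb D < +oo)%E ->
  measurable_fun D f -> (\int[leb]_(x in D) ((f x) ^+ 2)%:E < +oo)%E ->
  leb.-integrable D (EFin \o (fun x => f x ^+ 2)) /\ leb.-integrable D (EFin \o f).
Proof.
move=> mD fD mf fi.
have i2 : leb.-integrable D (EFin \o (fun x => f x ^+ 2)).
  apply/integrableP; split; first by apply/measurable_EFinP; exact: measurable_funX.
  apply: le_lt_trans fi; apply: ge0_le_integralW; first by move=> x _; exact: abse_ge0.
  by move=> x _ /=; rewrite lee_fin ger0_norm// sqr_ge0.
split => //.
have i1 : leb.-integrable D (EFin \o cst (1 : R)).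
  apply: measurable_bounded_integrable => //.
  by exists 1; split; [exact: num_real|move=> y y1 x _; rewrite /= normr1 ltW].
apply: le_integrable (integrableD _ i1 i2) => //; first exact/measurable_EFinP.
move=> x _ /=; rewrite lee_fin [leRHS]ger0_norm ?addr_ge0 ?sqr_ge0//.
rewrite -(real_normK (num_real (f x))); have := normr_ge0 (f x).
by move: `|f x| => z; nra.
Qed.

End Gronwall.

(** * Uniform continuity in time *)

Section Heine.
Context {R : realType} {E : lmodType R} (D : set E) (B : E -> E -> R).
Hypotheses (HB : semi_inner D B) (D0 : D 0).
Variables (T : R) (g : R -> E).
Hypothesis T0 : 0 <= T.
Hypothesis gD : forall t, `[0, T]%classic t -> D (g t).
Hypothesis gc : forall t, `[0, T]%classic t ->
  si_norm B (g s - g t) @[s --> within `[0, T]%classic (nbhs t)] --> (0 : R).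

Lemma clamp_mem t : `[0, T]%classic (clamp T t).
Proof. by rewrite /= in_itv/=; exact: clamp_itv. Qed.

(** The Heine-Cantor theorem for a seminorm, from compactness of [0, T]: half radii make a point
    near z also near the centre of the ball covering z. The 1-Lipschitz [clamp] carries the modulus
    to the whole line. *)
Lemma clamped_modulus e : 0 < e -> exists2 d, 0 < d & forall s t, `|s - t| <= d ->
  si_norm B (g (clamp T s) - g (clamp T t)) <= e.
Proof.
move=> e0; have e2 : 0 < e / 2 by rewrite divr_gt0.
have := (@compact_near_coveringP _ (`[0, T]%classic : set R)).1 (@segment_compact R 0 T).
move=> /(_ R (0^'+) (fun d x => forall y, `[0, T]%classic x -> `[0, T]%classic y -> `|y - x| <= d ->
  si_norm B (g y - g x) <= e) _) [].
  move=> x xT; have := gc xT.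
  move=> /cvgrPdist_le /(_ _ e2) /nbhs_ballP[r /= r0 Hr].
  exists (ball x (r / 2), [set d | 0 < d < r / 2]) => /=.
    split; first by apply/nbhsx_ballx; rewrite divr_gt0.
    near=> d; apply/andP; split; near: d; [exact: nbhs_right_gt|].
    by apply: nbhs_right_lt; rewrite divr_gt0.
  move=> [z d] /= [xz /andP[d0 dr]] y zT yT yz.
  have rr : r / 2 < r by rewrite ltr_pdivrMr// ltr_pMr// ltr1n.
  have H1 : si_norm B (g z - g x) <= e / 2.
    have := Hr z; rewrite sub0r normrN ger0_norm ?si_norm_ge0//; apply => //.
    exact: lt_trans xz rr.
  have H2 : si_norm B (g y - g x) <= e / 2.
    have := Hr y; rewrite sub0r normrN ger0_norm ?si_norm_ge0//; apply => //.
    rewrite /ball/=; move: xz; rewrite /ball/= => xz.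
    have := ler_distD z x y; rewrite (distrC z y) => xy; apply: le_lt_trans xy _.
    by have := le_lt_trans yz dr; lra.
  apply: le_trans (si_norm_distD HB D0 (gD yT) (gD xT) (gD zT)) _.
  by rewrite (si_normC HB D0 (gD xT) (gD zT)); lra.
move=> r /= r0 Hr; exists (r / 2); first by rewrite divr_gt0.
move=> s t st; apply: (Hr (r / 2)) => /=.
- by rewrite sub0r normrN gtr0_norm ?divr_gt0// ltr_pdivrMr// ltr_pMr// ltr1n.
- by rewrite divr_gt0.
- exact: clamp_mem.
- exact: clamp_mem.
- exact: clamp_mem.
- exact: le_trans (clamp_dist _ _ _) st.
Unshelve. all: by end_near.
Qed.

Lemma clamped_bounded : exists M, forall t, si_norm B (g (clamp T t)) <= M.
Proof.
have gD' t : D (g (clamp T t)) by apply: gD; exact: clamp_mem.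
have cn : continuous (fun t => si_norm B (g (clamp T t))).
  apply: modulus_continuous => e /clamped_modulus[d d0 Hd]; exists d => // x y xy.
  by apply: le_trans (si_norm_dist HB D0 (gD' x) (gD' y)) _; exact: Hd.
have [c _ Hc] := EVT_max T0 (continuous_subspaceT cn).
exists (si_norm B (g (clamp T c))) => t.
rewrite -{1}(clamp_id (clamp_itv t T0)); apply: Hc; exact: clamp_mem.
Qed.

Lemma clamped_pairing_continuous v : D v -> continuous (fun t => B (g (clamp T t)) v).
Proof.
have gD' t : D (g (clamp T t)) by apply: gD; exact: clamp_mem.
move=> Dv; apply: modulus_continuous => e e0.
have n0 : 0 < si_norm B v + 1 by rewrite ltr_wpDl// si_norm_ge0.
have [d d0 Hd] := clamped_modulus (divr_gt0 e0 n0); exists d => // x y xy.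
rewrite -(si_Bl HB D0)//; apply: le_trans (si_CS HB D0 _ _) _ => //.
  exact: (si_B HB D0).
apply: le_trans (ler_pM (si_norm_ge0 B _) (si_norm_ge0 B _) (Hd _ _ xy) (lexx _)) _.
by rewrite mulrAC ler_pdivrMr// ler_pM2l// lerDl.
Qed.

End Heine.

Lemma sqr_le_add2 (R : realDomainType) (x y z : R) : 0 <= x -> x <= y + z ->
  x ^+ 2 <= 2 * (y ^+ 2 + z ^+ 2).
Proof.
move=> x0 xyz; have := sqr_ge0 (y - z).
have : x ^+ 2 <= (y + z) ^+ 2 by rewrite lerXn2r// nnegrE (le_trans x0).
by rewrite sqrrD sqrrB; lra.
Qed.

(** * Measurability and square integrability in time of H-norms *)

Section TimeSpaceH.
Context {R : realType} (L : \bar R).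
Local Notation leb := (@lebesgue_measure R).
Local Notation HL := (ipH_semi_inner L).
Local Notation HL0 := (@L2_I0 R L).

Lemma ipH_bounded_functional v : L2_I L v ->
  @bounded_functional R (spaceH L) (fun u => ipH L u v).
Proof.
move=> Lv; split.
- exact: L2_I0.
- by move=> r u w Lu Lw; exact: L2_I_lin.
- by move=> r u w Lu Lw; exact: (si_l HL).
- exists (si_norm (ipH L) v + 1); first by rewrite ltr_wpDl// si_norm_ge0.
  move=> u Lu; apply: le_trans (si_CS HL HL0 Lu Lv) _.
  by rewrite mulrC ler_wpM2r ?si_norm_ge0// lerDl.
Qed.

Lemma measurable_ipH_step (D : set R) (s1 s2 : step (spaceH L)) :
  step_wf s1 -> step_wf s2 ->
  measurable_fun D (fun t => ipH L (step_val s1 t) (step_val s2 t)).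
Proof.
move=> + ws2; elim: s1 => [_|q s1 IH /step_wf_cons[mq nq ws1]].
  rewrite (_ : (fun t => _) = cst 0); first exact: measurable_cst.
  apply/funext => t; rewrite /step_val big_nil; apply: (si_0l HL HL0).
  exact: (step_val_mem (ipH_bounded_functional HL0) t ws2).
have m2 t := step_val_mem (ipH_bounded_functional HL0) t ws2.
have m1 t := step_val_mem (ipH_bounded_functional HL0) t ws1.
rewrite (_ : (fun t => _) = (fun t => \1_(q.1) t * ipH L (step_val s2 t) q.2
    + ipH L (step_val s1 t) (step_val s2 t))); last first.
  apply/funext => t; rewrite step_val_cons (si_l HL)//; last 2 first.
  - exact: m1.
  - exact: m2.
  by rewrite (si_C HL nq)//; exact: m2.
apply: measurable_funD; last exact: IH.
apply: measurable_funM; first exact: measurable_indic.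
have H := @measurable_step R (spaceH L) (fun u => ipH L u q.2) (ipH_bounded_functional nq) s2 D ws2.
exact: H.
Qed.

(** The norm of the difference is the limit of the norms for step functions, and these are
    measurable by expanding the square into inner products of steps. *)
Lemma measurable_ip_norm_diff (D : set R) (f g : R -> R -> R) :
  (forall t, D t -> L2_I L (f t)) -> (forall t, D t -> L2_I L (g t)) ->
  strongly_measurable (X := spaceH L) D f -> strongly_measurable (X := spaceH L) D g ->
  measurable_fun D (fun t => ip_norm (ipH L) (f t - g t)).
Proof.
move=> fm gm [s1 [ws1 H1]] [s2 [ws2 H2]].
have m1 n t := step_val_mem (ipH_bounded_functional HL0) t (ws1 n).
have m2 n t := step_val_mem (ipH_bounded_functional HL0) t (ws2 n).
apply: (@measurable_fun_cvg _ _ R D (fun n t =>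
    si_norm (ipH L) (step_val (s1 n) t - step_val (s2 n) t : R -> R^o))) => [n|t Dt].
  rewrite (_ : (fun t => _) = (fun t => Num.sqrt
    (ipH L (step_val (s1 n) t) (step_val (s1 n) t) - 2 * ipH L (step_val (s1 n) t) (step_val (s2 n) t)
     + ipH L (step_val (s2 n) t) (step_val (s2 n) t)))); last first.
    by apply/funext => t; rewrite /si_norm (si_sqrB HL HL0 (m1 n t) (m2 n t)).
  apply: measurableT_comp.
    by apply: continuous_measurable_fun; exact: sqrt_continuous.
  apply: measurable_funD; last exact: measurable_ipH_step.
  apply: measurable_funB; first exact: measurable_ipH_step.
  by apply: measurable_funM => //; exact: measurable_ipH_step.
have L0 : ip_norm (ipH L) ((f t : R -> R^o) - step_val (s1 n) t)
    + ip_norm (ipH L) ((g t : R -> R^o) - step_val (s2 n) t) @[n --> \oo] --> (0 : R).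
  rewrite -[0 in X in _ --> X]addr0; apply: cvgD; [exact: H1|exact: H2].
apply/cvgrPdist_le => e e0; move: L0 => /cvgrPdist_le /(_ _ e0).
apply: filterS => n; rewrite sub0r normrN => Hn.
have [F G] := (fm t Dt, gm t Dt); have [S1 S2] := (m1 n t, m2 n t).
have FG := si_B HL HL0 F G; have S12 := si_B HL HL0 S1 S2.
apply: le_trans (si_norm_dist HL HL0 FG S12) _.
have -> : (f t - g t : R -> R^o) - (step_val (s1 n) t - step_val (s2 n) t)
   = (f t - step_val (s1 n) t : R -> R^o) - (g t - step_val (s2 n) t).
  by rewrite !opprD !opprK addrACA.
apply: le_trans (si_normB HL HL0 (si_B HL HL0 F S1) (si_B HL HL0 G S2)) _.
by apply: le_trans Hn; rewrite ler_norm.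
Qed.

Lemma strongly_measurable0 (D : set R) : strongly_measurable (X := spaceH L) D (fun=> 0).
Proof.
exists (fun=> [::]); split; first by move=> n k.
move=> t _; rewrite /step_val big_nil subr0 /= /ip_norm (si_0l HL HL0 HL0) sqrtr0.
exact: cvg_cst.
Qed.

Lemma L2_time_norm (D : set R) (f : R -> R -> R) : measurable D -> (leb D < +oo)%E ->
  L2_time (X := spaceH L) D f ->
  leb.-integrable D (EFin \o (fun t => ip_norm (ipH L) (f t) ^+ 2)).
Proof.
move=> mD fD [fm sm fi].
have mf : measurable_fun D (fun t => ip_norm (ipH L) (f t)).
  have := measurable_ip_norm_diff fm (fun _ _ => HL0) sm (strongly_measurable0 D).
  apply: eq_measurable_fun => t _; congr (ip_norm _ _).
  by apply/funext => x; rewrite !fctE subr0.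
by have [] := integrable_of_sqr mD fD mf fi.
Qed.

Lemma L2_time_norm_diff (D : set R) (f g : R -> R -> R) : measurable D -> (leb D < +oo)%E ->
  L2_time (X := spaceH L) D f -> L2_time (X := spaceH L) D g ->
  leb.-integrable D (EFin \o (fun t => ip_norm (ipH L) (f t - g t) ^+ 2)).
Proof.
move=> mD fD Hf Hg; have i1 := L2_time_norm mD fD Hf; have i2 := L2_time_norm mD fD Hg.
have [fm sf _] := Hf; have [gm sg _] := Hg.
have mfg := measurable_ip_norm_diff fm gm sf sg.
apply: le_integrable (integrableZl _ 2 (integrableD _ i1 i2)) => //.
  by apply/measurable_EFinP; exact: measurable_funX.
move=> t Dt /=; rewrite lee_fin.
have := si_normB HL HL0 (fm t Dt) (gm t Dt).
rewrite ger0_norm ?sqr_ge0// ger0_norm; last first.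
  by rewrite mulr_ge0// addr_ge0// sqr_ge0.
exact: (sqr_le_add2 (si_norm_ge0 _ _)).
Qed.

End TimeSpaceH.

(** * Weak solutions tested against fixed vectors *)

Section Solution.
Context {R : realType} (L : \bar R) (V : set (R -> R)) (ip : (R -> R) -> (R -> R) -> R).
Hypothesis hV : is_energy_space L V ip.
Local Notation leb := (@lebesgue_measure R).
Local Notation HL := (ipH_semi_inner L).
Local Notation HL0 := (@L2_I0 R L).
Local Notation HV := (ip_semi_inner hV).
Local Notation HV0 := (energy0 hV).

Lemma dual_lin (l : (R -> R) -> R) : dual_mem V ip l ->
  l (0 : R -> R^o) = 0 /\ forall r (u : R -> R^o), V u -> l (r *: u) = r * l u.
Proof.
move=> [ll _]; have l0 : l (0 : R -> R^o) = 0.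
  have := ll 1 0 0 HV0 HV0.
  rewrite (_ : (fun x => _) = (0 : R -> R^o)); last first.
    by apply/funext => x; exact: etrans (addr0 _) (mul1r _).
  by rewrite mul1r => H; apply: (addrI (l 0)); rewrite addr0 -H.
split => // r u Vu; have := ll r u 0 Vu HV0; rewrite l0 addr0 => <-; congr l.
by apply/funext => x; exact: esym (addr0 _).
Qed.

Lemma dual_norm_le (l : (R -> R) -> R) u : dual_mem V ip l -> V u ->
  `|l u| <= dual_norm V ip l * ip_norm ip u.
Proof.
move=> hl Vu; have [l0 lZ] := dual_lin hl; have [_ [C HC]] := hl.
set n := ip_norm ip u.
(* A vector of norm 0 cannot be normalized, but there the bound by C already makes l vanish. *)
have [n0|n0] := eqVneq n 0; first by have := HC u Vu; rewrite -/n n0 !mulr0.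
have n1 : 0 < n by rewrite lt_neqAle eq_sym n0 sqrtr_ge0.
have Vn : V (n^-1 *: (u : R -> R^o)) by exact: (si_Z HV HV0).
have nn : ip_norm ip (n^-1 *: (u : R -> R^o)) = 1.
  rewrite -[LHS]/(si_norm ip (n^-1 *: (u : R -> R^o))) (si_normZ HV HV0)//.
  by rewrite gtr0_norm ?invr_gt0// mulVf.
suff : `|l (n^-1 *: (u : R -> R^o))| <= dual_norm V ip l.
  by rewrite lZ// normrM gtr0_norm ?invr_gt0// ler_pdivrMl// mulrC.
(* A [sup] dominates its set only if the set is bounded above, which the constant of [dual_mem]
   provides. *)
apply: ub_le_sup; last by exists (n^-1 *: (u : R -> R^o)) => //; split => //; rewrite nn.
exists `|C| => _ [v [Vv v1] <-]; apply: le_trans (HC v Vv) _.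
apply: le_trans (_ : `|C| * ip_norm ip v <= _).
  by rewrite ler_wpM2r ?sqrtr_ge0// ler_norm.
by rewrite ler_piMr.
Qed.

Lemma dual_bounded_functional v : V v ->
  @bounded_functional R (spaceVdual V ip) (fun l => l v).
Proof.
move=> Vv; split.
- split; first by move=> r u w _ _; apply: esym; exact: etrans (addr0 _) (mulr0 _).
  by exists 0 => u _; rewrite mul0r normr_le0; apply/eqP.
- move=> r l1 l2 [ll1 [C1 H1]] [ll2 [C2 H2]]; split.
    move=> c u w Vu Vw.
    rewrite -[LHS]/(r * l1 (fun x => c * u x + w x) + l2 (fun x => c * u x + w x)).
    rewrite -[RHS]/(c * (r * l1 u + l2 u) + (r * l1 w + l2 w)) ll1// ll2//.
    by move: (l1 u) (l1 w) (l2 u) (l2 w) => a1 a2 a3 a4; ring.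
  exists (`|r| * C1 + C2) => u Vu; rewrite -[X in `|X|]/(r * l1 u + l2 u).
  apply: le_trans (ler_normD _ _) _; rewrite normrM mulrDl -mulrA.
  by apply: lerD; [rewrite ler_wpM2l//; exact: H1|exact: H2].
- by [].
- exists (ip_norm ip v + 1); first by rewrite ltr_wpDl// sqrtr_ge0.
  move=> l hl; have b := dual_norm_le hl Vv; apply: le_trans b _.
  rewrite mulrC ler_wpM2r ?lerDl//=.
  have [l0 _] := dual_lin hl; have [_ [C HC]] := hl.
  apply: ub_le_sup.
    exists `|C| => _ [u [Vu u1] <-]; apply: le_trans (HC u Vu) _.
    apply: le_trans (_ : `|C| * ip_norm ip u <= _).
      by rewrite ler_wpM2r ?sqrtr_ge0// ler_norm.
    by rewrite ler_piMr.
  exists (0 : R -> R^o); last by rewrite l0 normr0.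
  split; first exact: HV0.
  by rewrite /ip_norm (si_0l HV HV0 HV0) sqrtr0.
Qed.

Lemma ip_norm_H_le : exists2 c : R, 0 < c & forall u, V u ->
  ip_norm (ipH L) u <= c * ip_norm ip u.
Proof.
have [c c0 H] := ipH_le_ip hV; exists (Num.sqrt c); first by rewrite sqrtr_gt0.
move=> u Vu; rewrite /ip_norm -sqrtrM ?(ltW c0)// ler_sqrt; first exact: H.
by rewrite mulr_ge0 ?(ltW c0)// (si_ge0 HV).
Qed.

Lemma H_to_dual_mem u : L2_I L u -> dual_mem V ip (H_to_dual L u).
Proof.
move=> Lu; split.
  move=> r v1 v2 V1 V2; have [L1 L2] := (energy_L2 hV V1, energy_L2 hV V2).
  rewrite /H_to_dual (si_C HL Lu); last exact: L2_I_lin.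
  by rewrite (si_l HL)// (si_C HL L1 Lu) (si_C HL L2 Lu).
have [c c0 Hc] := ip_norm_H_le; exists (ip_norm (ipH L) u * c) => v Vv.
apply: le_trans (si_CS HL HL0 Lu (energy_L2 hV Vv)) _.
by rewrite -mulrA ler_wpM2l ?sqrtr_ge0//; exact: Hc.
Qed.

Variables (T : R) (eta deta : R -> R -> R) (ddeta : R -> (R -> R) -> R).
Hypothesis T0 : 0 < T.
Hypothesis ceta : continuous_time (X := spaceV V ip) T eta.
Hypothesis cdeta : continuous_time (X := spaceH L) T deta.
Hypothesis Weta : in_W L V ip T eta deta ddeta.

Lemma solution_V t : `[0, T]%classic t -> V (eta t).
Proof. by move=> /ceta[]. Qed.

Lemma solution_L2 t : `[0, T]%classic t -> L2_I L (eta t).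
Proof. by move=> tT; exact: energy_L2 hV _ (solution_V tT). Qed.

Lemma velocity_L2 t : `[0, T]%classic t -> L2_I L (deta t).
Proof. by move=> /cdeta[]. Qed.

Lemma oo_cc t : `]0, T[%classic t -> `[0, T]%classic t.
Proof. by apply: subset_itv_oo_cc. Qed.

(** Carries the continuity of eta in V to weaker seminorms: the norm of H, and the norm given by
    [a]. *)
Lemma continuous_time_dominated (n : (R -> R) -> R) (c : R) :
  (forall u, V u -> 0 <= n u) ->
  (forall u, V u -> n u <= c * ip_norm ip u) -> forall t, `[0, T]%classic t ->
  n ((eta s : R -> R^o) - eta t) @[s --> within `[0, T]%classic (nbhs t)] --> (0 : R).
Proof.
move=> n0 nc t tT; have [Vt H] := ceta tT.
have H' : c * ip_norm ip ((eta s : R -> R^o) - eta t) @[s --> within `[0, T]%classic (nbhs t)] --> (0 : R).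
  by rewrite -[0 in X in _ --> X](mulr0 c); apply: cvgM H; exact: cvg_cst.
apply/cvgrPdist_le => e e0; move: H' => /cvgrPdist_le /(_ _ e0).
rewrite !near_withinE; apply: filterS => s Hs sT.
have Vst : V ((eta s : R -> R^o) - eta t).
  by apply: (si_B HV HV0) => //; exact: solution_V.
rewrite sub0r normrN ger0_norm ?n0//; apply: le_trans (nc _ Vst) _.
by have := Hs sT; rewrite sub0r normrN; apply: le_trans; exact: ler_norm.
Qed.

Lemma displacement_identity v : L2_I L v -> forall s t, 0 <= s -> s <= t -> t <= T ->
  ipH L ((eta t : R -> R^o) - eta s) v = itvint (fun r => ipH L (deta (clamp T r)) v) s t.
Proof.
move=> Lv s t s0 st tT.
have sT : `[0, T]%classic s by rewrite /= in_itv/= s0 (le_trans st).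
have tT' : `[0, T]%classic t by rewrite /= in_itv/= tT (le_trans s0).
have [c c0 Hc] := ip_norm_H_le.
have cH : forall t, `[0, T]%classic t ->
    si_norm (ipH L) ((eta s : R -> R^o) - eta t)
      @[s --> within `[0, T]%classic (nbhs t)] --> (0 : R).
  by apply: (continuous_time_dominated (c := c)) => // u _; exact: sqrtr_ge0.
have c1 := clamped_pairing_continuous HL HL0 (ltW T0) (fun t tT => solution_L2 tT) cH Lv.
have c2 := clamped_pairing_continuous HL HL0 (ltW T0) (fun t tT => velocity_L2 tT)
  (fun t tT => (cdeta tT).2) Lv.
have [_ _ _ td _] := Weta.
have := du_bois_reymond c1 (continuous_locint c2) (a := 0) (b := T).
move=> /(_ _ s t s0 st tT).
rewrite !(@clamp_id _ T t) ?(@clamp_id _ T s) ?s0 ?tT ?(le_trans st) ?(le_trans s0)//.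
rewrite (si_Bl HL HL0)//; [apply|exact: solution_L2..].
move=> phi tphi.
have clampE x : x \in (`]0, T[%classic : set R) -> clamp T x = x.
  rewrite inE/= in_itv/= => /andP[x0 xT]; apply: clamp_id.
  by rewrite (ltW x0) (ltW xT).
under eq_Rintegral => x xD do rewrite clampE//.
under [in RHS]eq_Rintegral => x xD do rewrite clampE//.
apply: (time_derivative_pairing (ipH_bounded_functional Lv) _ _ td tphi).
- by move=> x /oo_cc; exact: solution_L2.
- by move=> x /oo_cc; exact: velocity_L2.
Qed.

Lemma leb_oo_lty : (leb `]0%R, T[%classic < +oo)%E.
Proof. by rewrite lebesgue_measure_itv/=; case: ifP => _; rewrite ?ltry// -EFinB ltry. Qed.

(** The V^* norm of [ddeta] bounds the scalar function divided by |v| + 1, and its square has finite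
    integral. The comparison uses [ge0_le_integralW], as that norm may be nonmeasurable. *)
Lemma acceleration_integrable v : V v ->
  leb.-integrable `]0, T[ (EFin \o (fun r => ddeta r v)).
Proof.
move=> Vv; have [_ _ [dm sm di] _ _] := Weta.
have bf := dual_bounded_functional Vv.
have mD : measurable (`]0, T[%classic : set R) by [].
have md := measurable_pairing bf dm sm.
pose n := ip_norm ip v + 1; have n0 : 0 < n by rewrite ltr_wpDl// sqrtr_ge0.
have mdn : measurable_fun `]0, T[ (fun r => n^-1 * ddeta r v).
  by apply: measurable_funM => //; exact: measurable_cst.
suff fin : (\int[leb]_(r in `]0%R, T[) ((n^-1 * ddeta r v) ^+ 2)%:E < +oo)%E.
  have [_ i1] := integrable_of_sqr mD leb_oo_lty mdn fin.
  apply: eq_integrable (integrableZl _ n i1) => // r _ /=.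
  by rewrite -EFinM mulrA divff ?gt_eqF// mul1r.
apply: le_lt_trans di; apply: ge0_le_integralW.
  by move=> r _; rewrite lee_fin sqr_ge0.
move=> r rT; rewrite lee_fin /=.
have hd := dm r rT; have b := dual_norm_le hd Vv.
have d0 : 0 <= dual_norm V ip (ddeta r).
  rewrite leNgt; apply/negP => dn.
  have [l0 _] := dual_lin hd; have [_ [C HC]] := hd.
  have : `|ddeta r (0 : R -> R^o)| <= dual_norm V ip (ddeta r).
    apply: ub_le_sup; last first.
      exists (0 : R -> R^o) => //; split; first exact: HV0.
      by rewrite /ip_norm (si_0l HV HV0 HV0) sqrtr0.
    exists `|C| => _ [u [Vu u1] <-]; apply: le_trans (HC u Vu) _.
    apply: le_trans (_ : `|C| * ip_norm ip u <= _).
      by rewrite ler_wpM2r ?sqrtr_ge0// ler_norm.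
    by rewrite ler_piMr.
  by rewrite l0 normr0 leNgt dn.
rewrite -(real_normK (num_real (n^-1 * _))) lerXn2r// ?nnegrE//.
rewrite normrM gtr0_norm ?invr_gt0// ler_pdivrMl//; apply: le_trans b _.
by rewrite mulrC ler_wpM2r// lerDl.
Qed.

(** [ddeta] is controlled only inside (0, T), hence the truncation by 0; the identity still reaches
    both endpoints through [du_bois_reymond]. *)
Lemma velocity_identity v : V v -> forall s t, 0 <= s -> s <= t -> t <= T ->
  ipH L ((deta t : R -> R^o) - deta s) v =
  itvint ((fun r => ddeta r v) \_ `]0, T[) s t.
Proof.
move=> Vv s t s0 st tT; have Lv := energy_L2 hV Vv.
have sT : `[0, T]%classic s by rewrite /= in_itv/= s0 (le_trans st).
have tT' : `[0, T]%classic t by rewrite /= in_itv/= tT (le_trans s0).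
have c2 := clamped_pairing_continuous HL HL0 (ltW T0) (fun t tT => velocity_L2 tT)
  (fun t tT => (cdeta tT).2) Lv.
have [_ _ [dm _ _] _ td] := Weta.
have lb : locint ((fun r => ddeta r v) \_ `]0, T[).
  apply: locint_integrable; rewrite -restrict_EFin.
  by apply: (integrable_mkcond _ _).1 (acceleration_integrable Vv).
have := du_bois_reymond c2 lb (a := 0) (b := T).
move=> /(_ _ s t s0 st tT).
rewrite !(@clamp_id _ T t) ?(@clamp_id _ T s) ?s0 ?tT ?(le_trans st) ?(le_trans s0)//.
rewrite (si_Bl HL HL0)//; [apply|exact: velocity_L2..].
move=> phi tphi.
have clampE x : x \in (`]0, T[%classic : set R) -> clamp T x = x.
  rewrite inE/= in_itv/= => /andP[x0 xT]; apply: clamp_id.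
  by rewrite (ltW x0) (ltW xT).
under eq_Rintegral => x xD do rewrite clampE//.
under [in RHS]eq_Rintegral => x xD do rewrite patchE xD.
apply: (time_derivative_pairing (dual_bounded_functional Vv) _ _ td tphi).
- by move=> x /oo_cc xT; apply: H_to_dual_mem; exact: velocity_L2.
- exact: dm.
Qed.

End Solution.

(** * Null sets of times, and the constants of the final estimate *)

Section NegligibleSets.
Context {R : realType}.
Local Notation leb := (@lebesgue_measure R).

Lemma locint_restrict (f : R -> R) (A : set R) : measurable A -> locint f ->
  locint (f \_ A).
Proof.
move=> mA lf a b; rewrite -restrict_EFin.
apply: (integrable_restrict _ _ _ _).1 => //.
by apply: integrableS (lf a b) => //; exact: measurableI.
Qed.

Lemma itvint_ae_eq (f g : R -> R) (M : set R) (s t : R) : locint f -> locint g ->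
  leb.-negligible M -> (forall x, s <= x <= t -> ~ M x -> f x = g x) ->
  itvint f s t = itvint g s t.
Proof.
move=> lf lg nM fg; rewrite /itvint /Rintegral; congr fine.
apply: ae_eq_integral => //.
- exact: measurable_int (lf s t).
- exact: measurable_int (lg s t).
- apply: negligibleS nM => x /= H; apply: contrapT => Mx; apply: H => xst.
  by congr EFin; apply: fg => //; move: xst; rewrite in_itv.
Qed.

(** Passes from the energy x + A, with A the value of the form, to x + y with y the squared norm in
    V and k the inverse of the coercivity constant; the factor 2 absorbs the 2 g. *)
Lemma energy_constant (x y A e z g K k : R) : 0 <= x -> 0 <= A -> 0 <= z -> 0 <= g ->
  0 < K -> 0 < k -> e <= z -> y <= k * A -> x + A <= (e + 2 * g) * K ->
  x + y <= (1 + k) * (2 * K) * (z + g).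
Proof.
move=> x0 A0 z0 g0 K0 k0 ez yA xA.
have kx : 0 <= k * x by rewrite mulr_ge0// ltW.
apply: (@le_trans _ _ ((1 + k) * (x + A))); first by lra.
rewrite -mulrA; apply: ler_wpM2l; first by lra.
by apply: le_trans xA _; rewrite mulrAC ler_pM2r//; lra.
Qed.

(** Origin of the Gronwall rate 1 + 2 c: the kinetic part p enters once, and the Lipschitz part of
    the squared force is at most 2 c times the potential energy q. *)
Lemma force_density_arith (c h p q f : R) : 0 < c -> 0 <= p -> 0 <= q -> h <= c * q ->
  2 * (h + f) + p <= 2 * f + (1 + 2 * c) * (p + q).
Proof.
move=> c0 p0 q0 hq; have : 0 <= c * p by rewrite mulr_ge0// ltW.
lra.
Qed.

Lemma negligible_set1 (x : R) : leb.-negligible [set x].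
Proof. by exists [set x]; split => //; exact: lebesgue_measure_set1. Qed.

End NegligibleSets.

(** * The sine nonlinearity in H *)

Section Nonlinearity.
Context {R : realType} (L : \bar R) (eps : R) (phi : R -> R -> R).
Hypothesis eps0 : 0 < eps.
Hypothesis hphi : sine_gordon_solution phi.
Local Notation HL := (ipH_semi_inner L).
Local Notation HL0 := (@L2_I0 R L).

Definition sine_increment t (u : R -> R) x : R :=
  eps^-1 * (sin (phi x t) - sin (phi x t + eps * u x)).

Lemma sine_increment_measurable t u : measurable_fun setT u ->
  measurable_fun setT (sine_increment t u).
Proof.
move=> mu_; have msin : measurable_fun setT (@sin R).
  by apply: continuous_measurable_fun; exact: continuous_sin.
have mphi : measurable_fun setT (phi ^~ t).
  apply: continuous_measurable_fun => x.
  by apply: differentiable_continuous; apply/derivable1_diffP; exact: (sg_dx hphi).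
apply: measurable_funM => //; apply: measurable_funB; first exact: measurableT_comp.
apply: measurableT_comp => //; apply: measurable_funD => //.
exact: measurable_funM.
Qed.

Lemma sine_increment_diff t u v x :
  `|sine_increment t v x - sine_increment t u x| <= `|v x - u x|.
Proof.
have -> : sine_increment t v x - sine_increment t u x
    = eps^-1 * (sin (phi x t + eps * u x) - sin (phi x t + eps * v x)).
  by rewrite /sine_increment -mulrBr; congr (_ * _); rewrite addrC opprB addrA subrK.
rewrite normrM gtr0_norm ?invr_gt0// ler_pdivrMl//.
apply: le_trans (sin_lipschitz _ _) _.
have -> : phi x t + eps * u x - (phi x t + eps * v x) = eps * (u x - v x) by ring.
by rewrite normrM gtr0_norm// distrC.
Qed.

Lemma sine_increment0 t x : sine_increment t (cst 0) x = 0.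
Proof. by rewrite /sine_increment /= mulr0 addr0 subrr mulr0. Qed.

(** On an unbounded interval sin phi need not be square integrable; the difference of sines is,
    being bounded pointwise by |u|. *)
Lemma sine_increment_L2 t u : L2_I L u -> L2_I L (sine_increment t u).
Proof.
move=> Lu; apply: L2_I_bounded_by (Lu) _.
  exact: sine_increment_measurable (L2_I_measurable Lu).
move=> x; have := sine_increment_diff t (cst 0) u x.
by rewrite sine_increment0 /= !subr0.
Qed.

Lemma sine_increment_norm t u v : L2_I L u -> L2_I L v ->
  si_norm (ipH L) ((sine_increment t v : R -> R^o) - sine_increment t u)
  <= si_norm (ipH L) ((v : R -> R^o) - u).
Proof.
move=> Lu Lv; have [L1 L2] := (sine_increment_L2 t Lu, sine_increment_L2 t Lv).
have Lvu := si_B HL HL0 Lv Lu; have L21 := si_B HL HL0 L2 L1.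
rewrite /si_norm ler_sqrt; last exact: (si_ge0 HL).
apply: ipH_le => //; first exact: L2_I_measurable L21.
by move=> x; exact: sine_increment_diff.
Qed.

Lemma sg_nonlinearity_L2 g t u : L2_I L (g t) -> L2_I L u ->
  L2_I L (sg_nonlinearity eps phi g t u).
Proof. by move=> Lg Lu; exact: (si_D HL (sine_increment_L2 t Lu) Lg). Qed.

Lemma sg_nonlinearity_norm g1 g2 t u v : L2_I L (g1 t) -> L2_I L (g2 t) ->
  L2_I L u -> L2_I L v ->
  si_norm (ipH L) ((sg_nonlinearity eps phi g2 t v : R -> R^o) - sg_nonlinearity eps phi g1 t u)
  <= si_norm (ipH L) ((v : R -> R^o) - u) + si_norm (ipH L) ((g2 t : R -> R^o) - g1 t).
Proof.
move=> Lg1 Lg2 Lu Lv; have [L1 L2] := (sine_increment_L2 t Lu, sine_increment_L2 t Lv).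
have -> : (sg_nonlinearity eps phi g2 t v : R -> R^o) - sg_nonlinearity eps phi g1 t u
   = ((sine_increment t v : R -> R^o) - sine_increment t u) + ((g2 t : R -> R^o) - g1 t).
  by rewrite addrACA -opprD.
apply: le_trans (si_normD HL HL0 (si_B HL HL0 L2 L1) (si_B HL HL0 Lg2 Lg1)) _.
by rewrite lerD2r; exact: sine_increment_norm.
Qed.

End Nonlinearity.

(** * The difference of two solutions *)

Section Estimate.
Context {R : realType} (L : \bar R) (V : set (R -> R)) (ip : (R -> R) -> (R -> R) -> R).
Hypothesis hV : is_energy_space L V ip.
Variable kappa : R.
Hypothesis ha_bound : forall u v, V u -> V v ->
  `|form_a L kappa u v| <= ip_norm ip u * ip_norm ip v.
Hypothesis ha_coercive : exists2 c0 : R, 0 < c0 &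
  forall u, V u -> c0 * ip_norm ip u ^+ 2 <= form_a L kappa u u.
Variables (phi : R -> R -> R) (eps T : R).
Hypotheses (hphi : sine_gordon_solution phi) (eps0 : 0 < eps) (T0 : 0 < T).
Local Notation leb := (@lebesgue_measure R).
Local Notation HL := (ipH_semi_inner L).
Local Notation HL0 := (@L2_I0 R L).
Local Notation HV := (ip_semi_inner hV).
Local Notation HV0 := (energy0 hV).
Local Notation a := (form_a L kappa).
Local Notation HA := (form_a_semi_inner hV ha_coercive).
Local Notation nH := (si_norm (ipH L)).

Lemma form_a_le u : V u -> a u u <= ip_norm ip u ^+ 2.
Proof.
by move=> Vu; apply: le_trans (ler_norm _) _; rewrite expr2; exact: ha_bound.
Qed.

Lemma ae_eqB (u1 u2 v1 v2 : R -> R) : u1 = v1 %[ae mu_I L] -> u2 = v2 %[ae mu_I L] ->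
  ((u2 : R -> R^o) - u1) - ((v2 : R -> R^o) - v1) = 0 %[ae mu_I L].
Proof.
move=> H1 H2; have H := negligibleU H1 H2; apply: negligibleS H => x /= Hx.
apply: contrapT => /not_orP[/contrapT E1 /contrapT E2]; apply: Hx => _.
by rewrite !fctE E1// E2// subrr.
Qed.

Variables (g1 g2 : R -> R -> R) (u01 u02 v01 v02 : R -> R)
  (eta1 eta2 deta1 deta2 : R -> R -> R).
Hypotheses (hg1 : L2_time (X := spaceH L) `]0, T[%classic g1)
  (hg2 : L2_time (X := spaceH L) `]0, T[%classic g2).
Hypothesis sol1 : weak_solution L V ip kappa T (sg_nonlinearity eps phi g1) u01 v01 eta1 deta1.
Hypothesis sol2 : weak_solution L V ip kappa T (sg_nonlinearity eps phi g2) u02 v02 eta2 deta2.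

Definition diff_sol t : R -> R^o := (eta2 (clamp T t) : R -> R^o) - eta1 (clamp T t).
Definition diff_vel t : R -> R^o := (deta2 (clamp T t) : R -> R^o) - deta1 (clamp T t).
Definition diff_force : R -> R :=
  (fun r => nH ((g2 r : R -> R^o) - g1 r) ^+ 2) \_ `]0, T[.
(** The root of twice the sum of squares replaces the sum of the norms, so that its square is linear
    in two functions known to be locally integrable. *)
Definition force_bound r := Num.sqrt (2 * (nH (diff_sol r) ^+ 2 + diff_force r)).

Let T0' := ltW T0.
Let ce1 : continuous_time (X := spaceV V ip) T eta1. Proof. by case: sol1. Qed.
Let ce2 : continuous_time (X := spaceV V ip) T eta2. Proof. by case: sol2. Qed.
Let cd1 : continuous_time (X := spaceH L) T deta1. Proof. by case: sol1. Qed.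
Let cd2 : continuous_time (X := spaceH L) T deta2. Proof. by case: sol2. Qed.

Lemma diff_sol_V t : V (diff_sol t).
Proof. by apply: (si_B HV HV0); [case: (ce2 (clamp_mem T0' t))|case: (ce1 (clamp_mem T0' t))]. Qed.

Lemma diff_vel_L2 t : L2_I L (diff_vel t).
Proof. by apply: (si_B HL HL0); [case: (cd2 (clamp_mem T0' t))|case: (cd1 (clamp_mem T0' t))]. Qed.

Lemma diff_sol_modulus e : 0 < e -> exists2 d, 0 < d &
  forall s t, `|s - t| <= d -> si_norm a (diff_sol s - diff_sol t) <= e.
Proof.
move=> e0; have e2 : 0 < e / 2 by rewrite divr_gt0.
have an u : V u -> si_norm a u <= 1 * ip_norm ip u.
  move=> Vu; rewrite mul1r -(@ler_pXn2r _ 2)// ?nnegrE ?sqrtr_ge0//.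
  by rewrite (si_norm_sqr HA)// form_a_le.
have c1 := continuous_time_dominated hV ce1 (fun u _ => si_norm_ge0 a u) an.
have c2 := continuous_time_dominated hV ce2 (fun u _ => si_norm_ge0 a u) an.
have [d1 d10 H1] := clamped_modulus HA HV0 T0' (fun t tT => (ce1 tT).1) c1 e2.
have [d2 d20 H2] := clamped_modulus HA HV0 T0' (fun t tT => (ce2 tT).1) c2 e2.
exists (Num.min d1 d2); first by rewrite lt_min d10.
move=> s t; rewrite le_min => /andP[st1 st2].
have V1 r : V (eta1 (clamp T r)) by case: (ce1 (clamp_mem T0' r)).
have V2 r : V (eta2 (clamp T r)) by case: (ce2 (clamp_mem T0' r)).
have -> : diff_sol s - diff_sol t = ((eta2 (clamp T s) : R -> R^o) - eta2 (clamp T t))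
    - ((eta1 (clamp T s) : R -> R^o) - eta1 (clamp T t)).
  by rewrite /diff_sol !opprD !opprK addrACA.
apply: le_trans (si_normB HA HV0 (si_B HV HV0 (V2 s) (V2 t)) (si_B HV HV0 (V1 s) (V1 t))) _.
by rewrite [leRHS](splitr e); apply: lerD; [exact: H2|exact: H1].
Qed.

Lemma diff_vel_modulus e : 0 < e -> exists2 d, 0 < d &
  forall s t, `|s - t| <= d -> nH (diff_vel s - diff_vel t) <= e.
Proof.
move=> e0; have e2 : 0 < e / 2 by rewrite divr_gt0.
have [d1 d10 H1] := clamped_modulus HL HL0 T0' (fun t tT => (cd1 tT).1) (fun t tT => (cd1 tT).2) e2.
have [d2 d20 H2] := clamped_modulus HL HL0 T0' (fun t tT => (cd2 tT).1) (fun t tT => (cd2 tT).2) e2.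
exists (Num.min d1 d2); first by rewrite lt_min d10.
move=> s t; rewrite le_min => /andP[st1 st2].
have V1 r : L2_I L (deta1 (clamp T r)) by case: (cd1 (clamp_mem T0' r)).
have V2 r : L2_I L (deta2 (clamp T r)) by case: (cd2 (clamp_mem T0' r)).
have -> : diff_vel s - diff_vel t = ((deta2 (clamp T s) : R -> R^o) - deta2 (clamp T t))
    - ((deta1 (clamp T s) : R -> R^o) - deta1 (clamp T t)).
  by rewrite /diff_vel !opprD !opprK addrACA.
apply: le_trans (si_normB HL HL0 (si_B HL HL0 (V2 s) (V2 t)) (si_B HL HL0 (V1 s) (V1 t))) _.
by rewrite [leRHS](splitr e); apply: lerD; [exact: H2|exact: H1].
Qed.

Lemma diff_force_ge0 r : 0 <= diff_force r.
Proof. by rewrite /diff_force patchE; case: ifP => // _; exact: sqr_ge0. Qed.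

Lemma diff_force_locint : locint diff_force.
Proof.
apply: locint_integrable; rewrite /diff_force -restrict_EFin.
apply: (integrable_mkcond _ _).1 => //.
by apply: (L2_time_norm_diff _ _ hg2 hg1) => //; exact: leb_oo_lty.
Qed.

Lemma itvint_diff_force_le t : 0 <= t <= T -> itvint diff_force 0 t <=
  \int[leb]_(s in `]0, T[) (ip_norm (ipH L) ((g2 s : R -> R^o) - g1 s) ^+ 2).
Proof.
move=> /andP[t0 tT]; rewrite Rintegral_mkcond.
have -> : \int[leb]_s ((fun s => ip_norm (ipH L) ((g2 s : R -> R^o) - g1 s) ^+ 2) \_ `]0, T[) s
    = itvint diff_force 0 T.
  apply: Rintegral_support => // x xT; rewrite /diff_force patchE; case: ifPn => //.
  rewrite inE/= in_itv/= => /andP[x0 x1]; exfalso; move: xT.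
  by rewrite (ltW x0) (ltW x1).
rewrite (@itvint_cat _ _ 0 t T)//; last exact: diff_force_locint.
by rewrite lerDl; apply: itvint_ge0 => x _; exact: diff_force_ge0.
Qed.

Lemma force_bound_sqr r : force_bound r ^+ 2 = 2 * (nH (diff_sol r) ^+ 2 + diff_force r).
Proof. by rewrite sqr_sqrtr// mulr_ge0// addr_ge0 ?sqr_ge0// diff_force_ge0. Qed.

Lemma diff_sol_H_le : exists2 c : R, 0 < c & forall u, V u ->
  ipH L u u <= c * a u u.
Proof.
have [c c0' Hc] := ipH_le_ip hV; have [k k0 Hk] := ha_coercive.
exists (c / k) => [|u Vu]; first by rewrite divr_gt0.
apply: le_trans (Hc u Vu) _; rewrite -mulrA ler_pM2l// ler_pdivlMl//.
by have := Hk u Vu; rewrite -/(si_norm ip u) (si_norm_sqr HV).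
Qed.

Lemma diff_sol_H_modulus e : 0 < e -> exists2 d, 0 < d &
  forall s t, `|s - t| <= d -> nH (diff_sol s - diff_sol t) <= e.
Proof.
move=> e0; have [c c0' Hc] := diff_sol_H_le.
have sc : 0 < Num.sqrt c by rewrite sqrtr_gt0.
have [d d0 Hd] := diff_sol_modulus (divr_gt0 e0 sc); exists d => // s t st.
have Vst := si_B HV HV0 (diff_sol_V s) (diff_sol_V t).
have : nH (diff_sol s - diff_sol t) <= Num.sqrt c * si_norm a (diff_sol s - diff_sol t).
  rewrite /si_norm -sqrtrM ?(ltW c0')// ler_sqrt; first exact: Hc.
  by rewrite mulr_ge0 ?(ltW c0')// (si_ge0 HA).
by move=> /le_trans; apply; rewrite mulrC -ler_pdivlMr//; exact: Hd.
Qed.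

Lemma diff_sol_H_sqr_locint : locint (fun r => nH (diff_sol r) ^+ 2).
Proof.
have cn : continuous (fun r => nH (diff_sol r)).
  apply: modulus_continuous => e /diff_sol_H_modulus[d d0 Hd]; exists d => // x y xy.
  have Lr r : L2_I L (diff_sol r) by exact: energy_L2 hV _ (diff_sol_V r).
  by apply: le_trans (si_norm_dist HL HL0 (Lr x) (Lr y)) _; exact: Hd.
by apply: continuous_locint => x; exact: (cvgM (cn x) (cn x)).
Qed.

Lemma force_bound_locint : locint (fun r => force_bound r ^+ 2).
Proof.
rewrite (_ : (fun r => _) = (fun r => 2 * (nH (diff_sol r) ^+ 2 + diff_force r))); last first.
  by apply/funext => r; exact: force_bound_sqr.
by apply/locintZ/locintD; [exact: diff_sol_H_sqr_locint|exact: diff_force_locint].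
Qed.

Lemma diff_displacement v : L2_I L v -> forall s t, 0 <= s -> s <= t -> t <= T ->
  ipH L (diff_sol t - diff_sol s) v = itvint (fun r => ipH L (diff_vel r) v) s t.
Proof.
move=> Lv s t s0 st tT.
have [_ _ [dd1 W1 _] _ _] := sol1; have [_ _ [dd2 W2 _] _ _] := sol2.
have I1 := displacement_identity hV T0 ce1 cd1 W1 Lv s0 st tT.
have I2 := displacement_identity hV T0 ce2 cd2 W2 Lv s0 st tT.
have Es : clamp T s = s by apply: clamp_id; rewrite s0 (le_trans st).
have Et : clamp T t = t by apply: clamp_id; rewrite tT (le_trans s0).
have L1 r : L2_I L (eta1 (clamp T r)) by exact: energy_L2 hV _ (ce1 (clamp_mem T0' r)).1.
have L2 r : L2_I L (eta2 (clamp T r)) by exact: energy_L2 hV _ (ce2 (clamp_mem T0' r)).1.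
have D1 r : L2_I L (deta1 (clamp T r)) by exact: (cd1 (clamp_mem T0' r)).1.
have D2 r : L2_I L (deta2 (clamp T r)) by exact: (cd2 (clamp_mem T0' r)).1.
have -> : diff_sol t - diff_sol s = ((eta2 (clamp T t) : R -> R^o) - eta2 (clamp T s))
    - ((eta1 (clamp T t) : R -> R^o) - eta1 (clamp T s)).
  by rewrite /diff_sol !opprD !opprK addrACA.
rewrite (si_Bl HL HL0 (si_B HL HL0 (L2 t) (L2 s)) (si_B HL HL0 (L1 t) (L1 s)) Lv).
rewrite Es Et I1 I2 -itvintB; first last.
- apply: continuous_locint; apply: (clamped_pairing_continuous HL HL0 T0') Lv => r rT.
    exact: (cd1 rT).1.
  exact: (cd1 rT).2.
- apply: continuous_locint; apply: (clamped_pairing_continuous HL HL0 T0') Lv => r rT.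
    exact: (cd2 rT).1.
  exact: (cd2 rT).2.
by apply: eq_itvint => r _; rewrite /diff_vel (si_Bl HL HL0).
Qed.

Lemma diff_equation_bound dd1 dd2 r v : `]0, T[%classic r -> V v ->
  dd1 v + operator_A L kappa (eta1 r) v = H_to_dual L (sg_nonlinearity eps phi g1 r (eta1 r)) v ->
  dd2 v + operator_A L kappa (eta2 r) v = H_to_dual L (sg_nonlinearity eps phi g2 r (eta2 r)) v ->
  `|dd2 v - dd1 v + a (diff_sol r) v| <= force_bound r * nH v.
Proof.
move=> rT Vv E1 E2; have Lv := energy_L2 hV Vv.
have rT' : `[0, T]%classic r by exact: oo_cc.
have rE : clamp T r = r by apply: clamp_id; move: rT'; rewrite /= in_itv.
have V1 := (ce1 rT').1; have V2 := (ce2 rT').1.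
have L1 := energy_L2 hV V1; have L2 := energy_L2 hV V2.
have [m1 _ _] := hg1; have [m2 _ _] := hg2.
have G1 := m1 r rT; have G2 := m2 r rT.
have F1 := sg_nonlinearity_L2 eps0 hphi G1 L1.
have F2 := sg_nonlinearity_L2 eps0 hphi G2 L2.
have -> : dd2 v - dd1 v + a (diff_sol r) v = ipH L ((sg_nonlinearity eps phi g2 r (eta2 r) : R -> R^o)
    - sg_nonlinearity eps phi g1 r (eta1 r)) v.
  rewrite (si_Bl HL HL0)// /diff_sol rE (si_Bl HA HV0)//.
  rewrite -[ipH L (sg_nonlinearity _ _ g1 _ _) v]/(H_to_dual L (sg_nonlinearity eps phi g1 r (eta1 r)) v).
  rewrite -[ipH L (sg_nonlinearity _ _ g2 _ _) v]/(H_to_dual L (sg_nonlinearity eps phi g2 r (eta2 r)) v).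
  rewrite -E1 -E2 /operator_A; move: (dd1 v) (dd2 v) (a _ v) (a _ v) => x1 x2 x3 x4.
  by rewrite (opprD x1) (addrACA x2).
apply: le_trans (si_CS HL HL0 (si_B HL HL0 F2 F1) Lv) _.
rewrite ler_wpM2r ?si_norm_ge0//.
apply: le_trans (sg_nonlinearity_norm eps0 hphi G1 G2 L1 L2) _.
rewrite -(@ler_pXn2r _ 2)// ?nnegrE ?addr_ge0 ?si_norm_ge0 ?sqrtr_ge0//.
rewrite force_bound_sqr /diff_force patchE mem_set// /diff_sol rE.
exact: sqr_le_add2 (addr_ge0 (si_norm_ge0 _ _) (si_norm_ge0 _ _)) (lexx _).
Qed.

(** The equations hold outside a null set of times, whereas the bound is required at every r; the
    difference of the accelerations is therefore redefined on that set and outside (0, T), which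
    leaves its integrals over subintervals of [0, T] unchanged. *)
Lemma diff_velocity v : V v -> exists beta, [/\ locint beta,
  forall s t, 0 <= s -> s <= t -> t <= T ->
    ipH L (diff_vel t - diff_vel s) v = itvint beta s t &
  forall r, 0 <= r <= T -> `|beta r + a (diff_sol r) v| <= force_bound r * nH v].
Proof.
move=> Vv; have Lv := energy_L2 hV Vv.
have [_ _ [dd1 W1 Q1] _ _] := sol1; have [_ _ [dd2 W2 Q2] _ _] := sol2.
have [M [mM M0 subM]] := negligibleU Q1 Q2.
have i1 := acceleration_integrable hV W1 Vv.
have i2 := acceleration_integrable hV W2 Vv.
have trunc (f : R -> R) : leb.-integrable `]0, T[ (EFin \o f) -> locint (f \_ `]0, T[).
  move=> fi; apply: locint_integrable; rewrite -restrict_EFin.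
  by apply: (integrable_mkcond _ _).1 fi.
have l1 := trunc _ i1; have l2 := trunc _ i2.
have l21 : locint ((fun r => dd2 r v - dd1 r v) \_ `]0, T[).
  by apply: trunc; exact: (integrableB _ i2 i1).
have la : locint (fun r => - a (diff_sol r) v).
  apply: continuous_locint; apply: modulus_continuous => e e0.
  have n0 : 0 < si_norm a v + 1 by rewrite ltr_wpDl// si_norm_ge0.
  have [d d0 Hd] := diff_sol_modulus (divr_gt0 e0 n0); exists d => // x y xy.
  have Vxy := si_B HV HV0 (diff_sol_V x) (diff_sol_V y).
  rewrite -opprD normrN -(si_Bl HA HV0); [|exact: diff_sol_V..|by []].
  apply: le_trans (si_CS HA HV0 Vxy Vv) _.
  apply: le_trans (ler_pM (si_norm_ge0 _ _) (si_norm_ge0 _ _) (Hd _ _ xy) (lexx _)) _.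
  by rewrite mulrAC ler_pdivrMr// ler_pM2l// lerDl.
(* On [D], where both equations hold, b is the difference of the accelerations and c is 0. Off [D],
   b is 0 and c is -a(w r, v), so the quantity to be bounded vanishes there. *)
pose b := ((fun r => dd2 r v - dd1 r v) \_ `]0, T[) \_ (~` M).
pose D : set R := `]0, T[%classic `\` M.
have mD : measurable D by exact: measurableD.
pose c := (fun r => - a (diff_sol r) v) \_ (~` D).
have lb : locint b by apply: locint_restrict l21; exact: measurableC.
have lc : locint c by apply: locint_restrict la; exact: measurableC.
exists (fun r => b r + c r); split; first exact: locintD.
- move=> s t s0 st tT.
  have Es : clamp T s = s by apply: clamp_id; rewrite s0 (le_trans st).
  have Et : clamp T t = t by apply: clamp_id; rewrite tT (le_trans s0).
  have I1 := velocity_identity hV T0 cd1 W1 Vv s0 st tT.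
  have I2 := velocity_identity hV T0 cd2 W2 Vv s0 st tT.
  have D1 r : L2_I L (deta1 (clamp T r)) by exact: (cd1 (clamp_mem T0' r)).1.
  have D2 r : L2_I L (deta2 (clamp T r)) by exact: (cd2 (clamp_mem T0' r)).1.
  have -> : diff_vel t - diff_vel s = ((deta2 (clamp T t) : R -> R^o) - deta2 (clamp T s))
      - ((deta1 (clamp T t) : R -> R^o) - deta1 (clamp T s)).
    by rewrite /diff_vel !opprD !opprK addrACA.
  rewrite (si_Bl HL HL0 (si_B HL HL0 (D2 t) (D2 s)) (si_B HL HL0 (D1 t) (D1 s)) Lv).
  rewrite Es Et I1 I2 -itvintB//.
  (* The endpoints 0 and T join the null set, since c need not vanish at them. *)
  apply: (itvint_ae_eq (M := M `|` ([set 0] `|` [set T]))).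
  + exact: locintB.
  + exact: locintD.
  + apply: negligibleU; first by exists M; split.
    by apply: negligibleU; exact: negligible_set1.
  + move=> x /andP[x1 x2] /not_orP[Mx /not_orP[/= x0 xT]].
    have xD : `]0, T[%classic x.
      rewrite /= in_itv/= !lt_neqAle (le_trans s0 x1) (le_trans x2 tT) !andbT.
      by rewrite eq_sym; apply/andP; split; apply/eqP.
    rewrite /b /c !patchE !(mem_set xD) (mem_set (A := ~` M) Mx) memNset ?addr0//.
    by apply; split.
- move=> r rT; have [rD|rD] := pselect (D r); last first.
    rewrite /b /c !patchE (mem_set (A := ~` D) rD).
    have -> : (if r \in ~` M then
        if r \in (`]0, T[%classic : set R) then dd2 r v - dd1 r v else 0 else 0) = 0.
      case: ifPn => // /set_mem Mr; case: ifPn => // /set_mem rT'; exfalso; exact: rD.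
    by rewrite add0r addNr normr0 mulr_ge0 ?sqrtr_ge0.
  have [rI rM] := rD.
  rewrite /b /c !patchE (mem_set (A := ~` M) rM) (mem_set rI) memNset ?addr0; last by apply.
  have /not_orP[/contrapT G1 /contrapT G2] : ~ (~` [set t | `]0, T[%classic t -> forall v, V v ->
         dd1 t v + operator_A L kappa (eta1 t) v
           = H_to_dual L (sg_nonlinearity eps phi g1 t (eta1 t)) v] `|`
     ~` [set t | `]0, T[%classic t -> forall v, V v ->
         dd2 t v + operator_A L kappa (eta2 t) v
           = H_to_dual L (sg_nonlinearity eps phi g2 t (eta2 t)) v]) r.
    by move=> /subM.
  by apply: diff_equation_bound => //; [exact: G1|exact: G2].
Qed.

Lemma diff_bounded : exists M, forall t,
  [/\ si_norm a (diff_sol t) <= M, nH (diff_sol t) <= M & nH (diff_vel t) <= M].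
Proof.
have bounded (B : (R -> R) -> (R -> R) -> R) (D : set (R -> R)) (f : R -> R -> R^o) :
    @semi_inner R (R -> R^o) D B -> D (0 : R -> R^o) -> (forall t, D (f t)) ->
    (forall t, f (clamp T t) = f t) ->
    (forall e, 0 < e -> exists2 d, 0 < d &
       forall s t, `|s - t| <= d -> si_norm B (f s - f t) <= e) ->
    exists M, forall t, si_norm B (f t) <= M.
  move=> HB D0 Df fc fm.
  have [M HM] : exists M, forall t, si_norm B (f (clamp T t)) <= M.
    apply: (clamped_bounded HB D0 T0') => // t tT.
    apply/cvgrPdist_le => e /fm[d d0 Hd].
    rewrite near_withinE; apply/nbhs_ballP; exists d => //= s ts _.
    rewrite sub0r normrN ger0_norm ?si_norm_ge0//; apply: Hd.
    by rewrite distrC ltW.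
  by exists M => t; rewrite -fc.
have cc t : clamp T (clamp T t) = clamp T t by exact/clamp_id/clamp_itv.
have [M1 H1] := bounded _ _ _ HA HV0 diff_sol_V
  (fun t => ltac:(by rewrite /diff_sol cc)) diff_sol_modulus.
have VL t : L2_I L (diff_sol t) by exact: energy_L2 hV _ (diff_sol_V t).
have [M2 H2] := bounded _ _ _ HL HL0 VL
  (fun t => ltac:(by rewrite /diff_sol cc)) diff_sol_H_modulus.
have [M3 H3] := bounded _ _ _ HL HL0 diff_vel_L2
  (fun t => ltac:(by rewrite /diff_vel cc)) diff_vel_modulus.
exists (Num.max M1 (Num.max M2 M3)) => t.
split; [apply: le_trans (H1 t) _|apply: le_trans (H2 t) _|apply: le_trans (H3 t) _];
  by rewrite !le_max lexx ?orbT.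
Qed.

Local Notation E := (energy (ipH L) a diff_sol diff_vel).

Lemma diff_energy_inequality tau : 0 <= tau -> tau < T ->
  E tau <= E 0 + itvint (force_density (ipH L) diff_vel force_bound) 0 tau.
Proof.
have [M HM] := diff_bounded.
apply: (@energy_inequality R (R -> R^o) (L2_I L) V (ipH L) a HL HA HL0 HV0 _
  diff_sol diff_vel force_bound T M) => //.
- exact: (@energy_L2 _ _ _ _ hV).
- exact: diff_sol_V.
- exact: diff_vel_L2.
- by move=> t; have [] := HM t.
- by move=> t; have [] := HM t.
- by move=> t; have [] := HM t.
- exact: diff_sol_modulus.
- exact: diff_vel_modulus.
- exact: diff_displacement.
- exact: force_bound_locint.
- exact: diff_velocity.
Qed.

Lemma diff_energy_continuous : continuous E.
Proof.
have [M HM] := diff_bounded.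
have MA t : si_norm a (diff_sol t) <= M by have [] := HM t.
have MH t : nH (diff_vel t) <= M by have [] := HM t.
move=> x; apply: cvgD.
  exact: (w'_sqr_continuous HL HL0 diff_vel_L2 MA MH diff_vel_modulus).
(* The potential energy is handled by the lemma on the kinetic one, with V and [a] in the roles of H
   and its product. *)
exact: (w'_sqr_continuous HA HV0 diff_sol_V MA MA diff_sol_modulus).
Qed.

Lemma diff_vel_sqr_locint : locint (fun r => ipH L (diff_vel r) (diff_vel r)).
Proof.
have [M HM] := diff_bounded; apply: continuous_locint.
apply: (@w'_sqr_continuous R (R -> R^o) (L2_I L) (ipH L) a HL HL0 diff_sol diff_vel M).
- exact: diff_vel_L2.
- by move=> t; have [] := HM t.
- by move=> t; have [] := HM t.
- exact: diff_vel_modulus.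
Qed.

Local Notation G := (\int[leb]_(s in `]0, T[)
  (ip_norm (ipH L) ((g2 s : R -> R^o) - g1 s) ^+ 2)).

Lemma diff_energy_integral c : 0 < c -> (forall u, V u -> ipH L u u <= c * a u u) ->
  forall t, 0 <= t -> t < T -> E t <= (E 0 + 2 * G) + (1 + 2 * c) * itvint E 0 t.
Proof.
move=> c0 Hc t t0 tT; apply: le_trans (diff_energy_inequality t0 tT) _.
rewrite -[leRHS]addrA lerD2l.
have lE : locint E by exact/continuous_locint/diff_energy_continuous.
apply: (@le_trans _ _ (2 * itvint diff_force 0 t + (1 + 2 * c) * itvint E 0 t)).
  rewrite -!itvintZ// -?itvintD//; last 3 first.
  - exact/locintZ/diff_force_locint.
  - exact/locintZ.
  - exact/diff_force_locint.
  apply: le_itvint => //.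
  - apply: locintD; [exact: force_bound_locint|exact: diff_vel_sqr_locint].
  - by apply: locintD; [exact/locintZ/diff_force_locint|exact: locintZ].
  move=> r _; rewrite /force_density force_bound_sqr /energy (si_norm_sqr HL); last first.
    exact: energy_L2 hV _ (diff_sol_V r).
  apply: (force_density_arith _ c0).
  - by have := si_ge0 HL (diff_vel_L2 r).
  - by have := si_ge0 HA (diff_sol_V r).
  - exact: Hc _ (diff_sol_V r).
rewrite lerD2r ler_pM2l//; apply: itvint_diff_force_le.
by rewrite t0 ltW.
Qed.

Lemma diff_energy_estimate c : 0 < c -> (forall u, V u -> ipH L u u <= c * a u u) ->
  forall t, 0 <= t <= T -> E t <= (E 0 + 2 * G) * expR ((1 + 2 * c) * T).
Proof.
move=> c0 Hc.
have E0 : 0 <= E 0.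
  by rewrite addr_ge0 ?(si_ge0 HL (diff_vel_L2 _)) ?(si_ge0 HA (diff_sol_V _)).
have G0 : 0 <= G by apply: Rintegral_ge0 => r _; exact: sqr_ge0.
have cE := diff_energy_continuous.
have H t : 0 <= t -> t < T -> E t <= (E 0 + 2 * G) * expR ((1 + 2 * c) * T).
  apply: gronwall => //.
  - by rewrite addr_ge0// mulr_ge0.
  - by rewrite addr_ge0// mulr_ge0// ltW.
  - exact: diff_energy_integral.
move=> t /andP[t0]; rewrite le_eqVlt => /predU1P[->|tT]; last exact: H.
exact: continuous_le_endpoint cE T0 H.
Qed.

Hypotheses (Vu1 : V u01) (Vu2 : V u02) (Lv1 : L2_I L v01) (Lv2 : L2_I L v02).

(** Initial values agree with the data only a.e.; such a difference has norm 0 both in H and in V,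
    so the norms coincide. *)
Lemma diff_energy_initial :
  E 0 <= ip_norm (ipH L) ((v02 : R -> R^o) - v01) ^+ 2 + ip_norm ip ((u02 : R -> R^o) - u01) ^+ 2.
Proof.
have [_ _ _ iu1 iv1] := sol1; have [_ _ _ iu2 iv2] := sol2.
have C0 : clamp T 0 = 0 by apply: clamp_id; rewrite lexx ltW.
have Vu := si_B HV HV0 Vu2 Vu1; have Lv := si_B HL HL0 Lv2 Lv1.
have Vw := diff_sol_V 0; have Lw := diff_vel_L2 0.
apply: lerD.
  suff -> : ipH L (diff_vel 0) (diff_vel 0) = nH ((v02 : R -> R^o) - v01) ^+ 2 by [].
  rewrite -(si_norm_sqr HL Lw); congr (_ ^+ 2); apply/eqP.
  rewrite -subr_eq0 -normr_le0; apply: le_trans (si_norm_dist HL HL0 Lw Lv) _.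
  rewrite /si_norm ipH_ae0 ?sqrtr0//; [exact: (si_B HL HL0)..|].
  by rewrite /diff_vel C0; exact: ae_eqB.
apply: le_trans (form_a_le Vw) _.
suff -> : ip_norm ip (diff_sol 0) = ip_norm ip ((u02 : R -> R^o) - u01) by [].
apply/eqP; rewrite -subr_eq0 -normr_le0; apply: le_trans (si_norm_dist HV HV0 Vw Vu) _.
rewrite /si_norm (ae0_ip_eq0 hV) ?sqrtr0//; first exact: (si_B HV HV0).
by rewrite /diff_sol C0; exact: ae_eqB.
Qed.

Lemma diff_estimate c c0 : 0 < c -> (forall u, V u -> ipH L u u <= c * a u u) ->
  0 < c0 -> (forall u, V u -> c0 * ip_norm ip u ^+ 2 <= a u u) ->
  forall t, 0 <= t <= T ->
  ip_norm (ipH L) ((deta2 t : R -> R^o) - deta1 t) ^+ 2 + ip_norm ip ((eta2 t : R -> R^o) - eta1 t) ^+ 2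
  <= (1 + c0^-1) * (2 * expR ((1 + 2 * c) * T)) *
     (ip_norm (ipH L) ((v02 : R -> R^o) - v01) ^+ 2 + ip_norm ip ((u02 : R -> R^o) - u01) ^+ 2 + G).
Proof.
move=> cp Hc c0p Hc0 t tT; have Ct : clamp T t = t by exact: clamp_id.
have Ew : E t = ip_norm (ipH L) ((deta2 t : R -> R^o) - deta1 t) ^+ 2
    + a ((eta2 t : R -> R^o) - eta1 t) ((eta2 t : R -> R^o) - eta1 t).
  have := si_norm_sqr HL (diff_vel_L2 t).
  by rewrite /energy /diff_sol /diff_vel Ct => <-.
have Vt := diff_sol_V t; rewrite /diff_sol Ct in Vt.
apply: (energy_constant (sqr_ge0 _) (si_ge0 HA Vt) _ _ (expR_gt0 _) _ diff_energy_initial).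
- by rewrite addr_ge0 ?sqr_ge0.
- by apply: Rintegral_ge0 => r _; exact: sqr_ge0.
- by rewrite invr_gt0.
- by rewrite ler_pdivlMl//; exact: Hc0.
- by rewrite -Ew; exact: diff_energy_estimate.
Qed.

End Estimate.

(** * Continuous dependence on the data and uniqueness *)

Theorem lemma2p3 (R : realType) (L : \bar R) (hL : (0 < L)%E)
    (V : set (R -> R)) (ip : (R -> R) -> (R -> R) -> R)
    (hV : is_energy_space L V ip)
    (kappa : R) (hkappa : 0 <= kappa)
    (ha_bound : forall u v, V u -> V v ->
       `|form_a L kappa u v| <= ip_norm ip u * ip_norm ip v)
    (ha_coercive : exists2 c0 : R, 0 < c0 &
       forall u, V u -> c0 * ip_norm ip u ^+ 2 <= form_a L kappa u u)
    (phi : R -> R -> R) (hphi : sine_gordon_solution phi)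
    (eps : R) (heps0 : 0 < eps) (heps1 : eps <= 1)
    (T : R) (hT : 0 < T) :
  (exists c : R,
     forall (g1 g2 : R -> R -> R) (u01 u02 v01 v02 : R -> R)
            (eta1 eta2 deta1 deta2 : R -> R -> R),
     L2_time (X := spaceH L) `]0, T[%classic g1 ->
     L2_time (X := spaceH L) `]0, T[%classic g2 ->
     V u01 -> V u02 -> L2_I L v01 -> L2_I L v02 ->
     weak_solution L V ip kappa T (sg_nonlinearity eps phi g1)
       u01 v01 eta1 deta1 ->
     weak_solution L V ip kappa T (sg_nonlinearity eps phi g2)
       u02 v02 eta2 deta2 ->
     forall t : R, 0 <= t <= T ->
       ip_norm (ipH L) (deta2 t - deta1 t) ^+ 2
         + ip_norm ip (eta2 t - eta1 t) ^+ 2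
       <= c * (ip_norm (ipH L) (v02 - v01) ^+ 2
               + ip_norm ip (u02 - u01) ^+ 2
               + \int[@lebesgue_measure R]_(s in `]0, T[%classic)
                   (ip_norm (ipH L) (g2 s - g1 s) ^+ 2)))
  /\
  (forall (g : R -> R -> R) (u0 v0 : R -> R)
          (eta1 eta2 deta1 deta2 : R -> R -> R),
     L2_time (X := spaceH L) `]0, T[%classic g -> V u0 -> L2_I L v0 ->
     weak_solution L V ip kappa T (sg_nonlinearity eps phi g)
       u0 v0 eta1 deta1 ->
     weak_solution L V ip kappa T (sg_nonlinearity eps phi g)
       u0 v0 eta2 deta2 ->
     forall t : R, 0 <= t <= T -> eta1 t = eta2 t %[ae mu_I L]).
Proof.
have [c cp Hc] := diff_sol_H_le hV ha_coercive.
have [c0 c0p Hc0] := ha_coercive.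
(* Here c bounds the square of the H norm by the form and c0 is the coercivity constant, so C
   depends only on the space, the form and T. *)
pose C := (1 + c0^-1) * (2 * expR ((1 + 2 * c) * T)).
have main g1 g2 u01 u02 v01 v02 eta1 eta2 deta1 deta2 :
    L2_time (X := spaceH L) `]0, T[%classic g1 ->
    L2_time (X := spaceH L) `]0, T[%classic g2 ->
    V u01 -> V u02 -> L2_I L v01 -> L2_I L v02 ->
    weak_solution L V ip kappa T (sg_nonlinearity eps phi g1) u01 v01 eta1 deta1 ->
    weak_solution L V ip kappa T (sg_nonlinearity eps phi g2) u02 v02 eta2 deta2 ->
    forall t : R, 0 <= t <= T ->
    ip_norm (ipH L) (deta2 t - deta1 t) ^+ 2 + ip_norm ip (eta2 t - eta1 t) ^+ 2
    <= C * (ip_norm (ipH L) (v02 - v01) ^+ 2 + ip_norm ip (u02 - u01) ^+ 2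
            + \int[@lebesgue_measure R]_(s in `]0, T[%classic)
                (ip_norm (ipH L) (g2 s - g1 s) ^+ 2)).
  move=> hg1 hg2 Vu1 Vu2 Lv1 Lv2 sol1 sol2 t tT.
  exact: (diff_estimate hV ha_bound ha_coercive hphi heps0 hT hg1 hg2 sol1 sol2).
split; first by exists C => g1 g2 u01 u02 v01 v02 eta1 eta2 deta1 deta2; exact: main.
move=> g u0 v0 eta1 eta2 deta1 deta2 hg Vu Lv sol1 sol2 t tT.
(* With equal data the right-hand side is 0. The solutions are passed in reverse order so that the
   differences appear as eta1 - eta2; its norm in V vanishes, hence it is 0 a.e. *)
have := main _ _ _ _ _ _ _ _ _ _ hg hg Vu Vu Lv Lv sol2 sol1 t tT.
have Bx (x : R -> R) : x - x = (0 : R -> R) by apply/funext => r; exact: subrr.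
have nH0 : ip_norm (ipH L) 0 = 0.
  by rewrite /ip_norm (si_0l (ipH_semi_inner L) (L2_I0 L) (L2_I0 L)) sqrtr0.
have nV0 : ip_norm ip 0 = 0.
  by rewrite /ip_norm (si_0l (ip_semi_inner hV) (energy0 hV) (energy0 hV)) sqrtr0.
rewrite !Bx nH0 nV0 expr0n/= (_ : \int[_]_(s in _) _ = 0); last first.
  under eq_Rintegral do rewrite Bx nH0 expr0n.
  by rewrite /Rintegral integral0.
rewrite !addr0 mulr0 => le0.
have [c1 _ _ _ _] := sol1; have [c2 _ _ _ _] := sol2.
have tT' : `[0, T]%classic t by rewrite /= in_itv.
have V12 := si_B (ip_semi_inner hV) (energy0 hV) (c1 t tT').1 (c2 t tT').1.
have z : ip (eta1 t - eta2 t) (eta1 t - eta2 t) = 0.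
  have := si_norm_sqr (ip_semi_inner hV) V12; rewrite -/(ip_norm ip) => <-.
  apply/eqP; rewrite eq_le sqr_ge0 andbT; apply: le_trans le0.
  by rewrite lerDr sqr_ge0.
apply: negligibleS (ip_eq0_ae hV V12 z) => x /= H H'; apply: H => /H' /eqP.
by rewrite !fctE subr_eq0 => /eqP.
Qed.
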